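(* Fix $\delta>0$. For each $n$ let $N=\binom{n}{2}$, let $M=M(n)$ and $k=k(n)$ be integers with $M/N\in[\delta,1-\delta]$ and $k/n\in[\delta,1-\delta]$, let $K=\binom{k}{2}$, and let \[ \lambda=\frac{(n^2-k^2)k^2}{2n^4}\cdot\frac{M(N-M)}{N^2}. \] Let $G=G_{n,M}$. Then for any $\varepsilon>0$, with very high probability (in the choice of $G$) we have for all integers $z$ \[ n\,\big|\Pr_S(e(S)=z)-\varphi(z)\big|\le n^{-1/14+\varepsilon}, \] where $S$ is a uniformly random $k$-subset of $V(G)$ and $\varphi$ is the density function of a normal random variable with mean $KM/N$ and variance $\lambda n^2$.
   Context: $G_{n,M}$ denotes the uniformly random graph on vertex set $[n]$ with exactly $M$ edges. For $S\subseteq V(G)$, $e(S)$ denotes the number of edges of the induced subgraph $G[S]$. $\Pr_S$ denotes probability over the uniform random choice of the $k$-set $S$ with $G$ fixed. An event $E$ (concerning $G$) holds ''with very high probability'' if there is $\eta>0$ such that $\Pr(E)\ge 1-\exp(-n^{\eta})$ for all sufficiently large $n$. *)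

(* Defs.v *)
From HB Require Import structures.
From mathcomp Require Import all_boot all_order all_algebra.
From mathcomp Require Import all_classical all_reals all_analysis.

Set Implicit Arguments.
Unset Strict Implicit.
Unset Printing Implicit Defensive.

Import Order.TTheory GRing.Theory Num.Theory.
Import numFieldNormedType.Exports.

Local Open Scope classical_set_scope.
Local Open Scope ring_scope.

(* A simple graph on the vertex set 'I_n is identified with its edge set,
   a set of two-element subsets of 'I_n. *)
Definition is_simple_graph (n : nat) (G : {set {set 'I_n}}) : bool :=
  [forall e in G, #|e| == 2%N].

Definition graphs_with_edges (n M : nat) : {set {set {set 'I_n}}} :=
  [set G : {set {set 'I_n}} | is_simple_graph G & #|G| == M]%SET.

Definition subsets_of_size (n k : nat) : {set {set 'I_n}} :=
  [set S : {set 'I_n} | #|S| == k]%SET.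

Definition induced_edges (n : nat) (G : {set {set 'I_n}}) (S : {set 'I_n}) : nat :=
  #|[set e in G | e \subset S]%SET|.

(* Pr(P x) for x uniform on A; only meaningful when A is nonempty. *)
Definition uniform_pr (R : realType) (T : finType) (A : {set T})
    (P : T -> Prop) : R :=
  #|[set x in A | `[< P x >]]%SET|%:R / #|A|%:R.

(* p n is the probability of the n-th event. *)
Definition with_very_high_probability (R : realType) (p : nat -> R) : Prop :=
  exists2 eta : R, 0 < eta &
    \forall n \near \oo, 1 - expR (- (n%:R `^ eta)) <= p n.

Definition lambda (R : realType) (n M k : nat) : R :=
  let N : R := 'C(n, 2)%:R in
  ((n%:R ^+ 2 - k%:R ^+ 2) * k%:R ^+ 2) / (2 * n%:R ^+ 4)
  * (M%:R * (N - M%:R) / N ^+ 2).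

(* normal_pdf takes the standard deviation, not the variance. *)
Definition phi (R : realType) (n M k : nat) : R -> R :=
  normal_pdf ('C(k, 2)%:R * M%:R / 'C(n, 2)%:R)
             (Num.sqrt (lambda R n M k * n%:R ^+ 2)).

(* Main.v *)
(** Put u = n^(1/32).  For fixed t and a, regard f(G) = E_S cos(t W_S(G) - a),
    where W_S(G) is e(S) minus its conditional mean given the number of edges,
    as a function on the product space G(n, p) with p = M/N.  If t <= u^2/n, the
    squared discrete gradient of f is so small that f is exponentially
    concentrated around its mean.  If u^2/n < t <= pi, then E f^2 is
    exponentially small: f^2 is an average over pairs (S, S'), most of which
    differ in many edges, each of these contributing a factor less than 1.
    Conditioning G(n, p) on having M edges costs a factor N + 1, and Fourier
    inversion on a finite cyclic group turns these bounds into the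
    concentration, up to O(u^-3/n), of Pr_S(e(S) = z) around a number that does
    not depend on G.  The mean of Pr_S(e(S) = z) over G(n, M) is a
    hypergeometric probability, and the quotients h(z+1)/h(z) of the
    hypergeometric distribution give its local limit theorem. *)

From mathcomp Require Import complex.
Require Import Defs.
From mathcomp Require Import all_boot all_order all_algebra.
From mathcomp Require Import all_classical all_reals all_analysis.
From mathcomp Require Import measurable_realfun.
From mathcomp Require Import ring lra zify.
Import Order.TTheory GRing.Theory Num.Theory.
Import numFieldNormedType.Exports.
Local Open Scope ring_scope.
Set Implicit Arguments.
Unset Strict Implicit.
Unset Printing Implicit Defensive.


(** Centring is what makes the low range of frequencies wide enough. The gradient of f is governed
    by the correlation of the edge indicators of two random k-sets: uncentred it has order n^2,
    centred it is about n times the deviation of |S ∩ S'| from k^2/n, hence of order n^(3/2). At t =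
    u^2/n the squared gradient is then about t^2 n^(3/2) = u^(-12), so that a deviation u^(-5) has
    probability exp(-cu). The remaining powers of u are tuned to each other. The k-sets within
    distance u^30 of a given one must be negligible against C(n, k), which is exponential in n =
    u^32; pairs outside that ball give an exponent of order t^2 u^30 n >= u^2 when t >= u^2/n. The
    low frequencies are a fraction of order u^2/n of all, so a tolerance u^(-5) on them costs
    u^(-3)/n in total. Since 3/32 > 1/14, this is more than enough. The number around which
    Pr_S(e(S) = z) concentrates is never computed: almost all graphs are close to it, hence so is
    their mean. *)

(** * Weighted expectations over a finite type *)

Section FiniteExpectation.
Variables (R : realType) (I : finType) (w : I -> R).

Definition expect (f : I -> R) : R := \sum_i w i * f i.

Lemma eq_expect f g : f =1 g -> expect f = expect g.
Proof. by move=> fg; apply: eq_bigr => i _; rewrite fg. Qed.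

Lemma expectD f g : expect (fun i => f i + g i) = expect f + expect g.
Proof. by rewrite -big_split; apply: eq_bigr => i _; rewrite mulrDr. Qed.

Lemma expectZ c f : expect (fun i => c * f i) = c * expect f.
Proof. by rewrite mulr_sumr; apply: eq_bigr => i _; rewrite mulrCA. Qed.

Lemma expectB f g : expect (fun i => f i - g i) = expect f - expect g.
Proof.
rewrite -[- expect g]mulN1r -expectZ -expectD.
by apply: eq_expect => i; rewrite mulN1r.
Qed.

Lemma expect_sum (J : Type) (r : seq J) (P : pred J) (F : J -> I -> R) :
  expect (fun i => \sum_(j <- r | P j) F j i) =
  \sum_(j <- r | P j) expect (F j).
Proof.
rewrite /expect exchange_big; apply: eq_bigr => i _.
by rewrite mulr_sumr.
Qed.

Hypothesis w0 : forall i, 0 <= w i.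

Lemma ler_expect f g : (forall i, f i <= g i) -> expect f <= expect g.
Proof. by move=> fg; apply: ler_sum => i _; apply: ler_wpM2l. Qed.

Lemma expect_ge0 f : (forall i, 0 <= f i) -> 0 <= expect f.
Proof. by move=> f0; apply: sumr_ge0 => i _; apply: mulr_ge0. Qed.

Lemma ler_norm_expect f : `|expect f| <= expect (fun i => `|f i|).
Proof.
apply: le_trans (ler_norm_sum _ _ _) _; apply: ler_sum => i _.
by rewrite normrM ger0_norm.
Qed.

Lemma markov_expect (f : I -> R) (s : R) : 0 < s -> (forall i, 0 <= f i) ->
  expect (fun i => (s <= f i)%R%:R) <= expect f / s.
Proof.
move=> s0 f0; rewrite mulrC -expectZ; apply: ler_expect => i.
rewrite mulrC ler_pdivlMr//; by case: (leP s (f i)) => h; rewrite ?mul1r// mul0r f0.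
Qed.

Hypothesis w1 : \sum_i w i = 1.

Lemma expect_cst c : expect (fun=> c) = c.
Proof. by rewrite /expect -mulr_suml w1 mul1r. Qed.

Lemma expect_le_cst f c : (forall i, f i <= c) -> expect f <= c.
Proof. by move=> fc; rewrite -[leRHS]expect_cst; exact: ler_expect. Qed.

Lemma expect_norm_le_cst f c : (forall i, `|f i| <= c) -> `|expect f| <= c.
Proof.
by move=> fc; apply: le_trans (ler_norm_expect _) _; exact: expect_le_cst.
Qed.

Lemma expect_variance f : expect (fun i => (f i - expect f) ^+ 2) =
  expect (fun i => f i ^+ 2) - expect f ^+ 2.
Proof.
rewrite (@eq_expect _ (fun i => f i ^+ 2 + (- (2 * expect f) * f i + expect f ^+ 2))); last first.
  by move=> i; ring.
by rewrite expectD expectD expectZ expect_cst; ring.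
Qed.

End FiniteExpectation.

(** * Product Bernoulli measures: Poincaré inequality and exponential concentration *)

Section ProductMeasure.
Variables (R : realType) (T : finType) (p : T -> R).
Hypothesis p01 : forall x, 0 <= p x <= 1.
Implicit Types (G : {set T}) (g : {set T} -> R).

Definition bernoulli_weight (G : {set T}) : R :=
  \prod_x (if x \in G then p x else 1 - p x).
Local Notation w := bernoulli_weight.
Local Notation Ex := (expect w).

Lemma bernoulli_weight_ge0 G : 0 <= w G.
Proof.
by apply: prodr_ge0 => x _; have := p01 x; case: ifP => _; lra.
Qed.

(** The morphism [h] lets one expansion serve twice: with the identity for the total mass, with the
    embedding into the complex numbers for the characteristic function. *)
Lemma expect_bernoulli_prod (K : comPzRingType) (h : {rmorphism R -> K})
    (z : T -> K) :
  \sum_(G : {set T}) h (w G) * \prod_(x in G) z x =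
  \prod_x (h (1 - p x) + h (p x) * z x).
Proof.
rewrite (eq_bigr (fun x => h (p x) * z x + h (1 - p x))); last first.
  by move=> x _; rewrite addrC.
rewrite bigA_distr; apply: eq_bigr => G _.
rewrite rmorph_prod (big_mkcond (mem G)) -big_split; apply: eq_bigr => x _ /=.
by case: ifP => _; rewrite ?mulr1.
Qed.

Lemma sum_bernoulli_weight : \sum_G w G = 1.
Proof.
transitivity (\prod_(x : T) ((1 - p x) + p x * (1 : R))).
  rewrite -(expect_bernoulli_prod idfun (fun=> 1)).
  by apply: eq_bigr => G _; rewrite big1// mulr1.
by rewrite big1// => x _; rewrite mulr1 subrK.
Qed.

Lemma big_set_split (x : T) (F : {set T} -> R) :
  \sum_G F G = \sum_(G : {set T} | x \notin G) (F G + F (x |: G)%SET).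
Proof.
rewrite (bigID (fun G : {set T} => x \notin G)) /= big_split; congr (_ + _).
rewrite (reindex_onto (fun G : {set T} => x |: G)%SET (fun G => G :\ x)%SET) /=.
  apply: eq_bigl => G; rewrite finset.in_setU1 eqxx /=.
  apply/eqP/idP => [<-|xG]; first by rewrite !inE eqxx.
  by rewrite setU1K.
by move=> G; rewrite negbK => xG; rewrite finset.setD1K.
Qed.

(** The conditional expectation of [g] given all coordinates but [x]. *)
Definition edge_average (x : T) (g : {set T} -> R) (G : {set T}) : R :=
  p x * g (x |: G)%SET + (1 - p x) * g (G :\ x)%SET.

Definition edge_diff (x : T) (g : {set T} -> R) (G : {set T}) : R :=
  g (x |: G)%SET - g (G :\ x)%SET.

Let rest x G : R := \prod_(y | y != x) (if y \in G then p y else 1 - p y).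

Let weight_out x G : x \notin G -> w G = (1 - p x) * rest x G.
Proof. by move=> xG; rewrite /w (bigD1 x)//= (negbTE xG). Qed.

Let weight_in x G : x \notin G -> w (x |: G)%SET = p x * rest x G.
Proof.
move=> xG; rewrite /w (bigD1 x)//= finset.setU11; congr (_ * _).
by apply: eq_bigr => y yx; rewrite finset.in_setU1 (negbTE yx).
Qed.

Let setU1_id x G : (x |: (x |: G) = x |: G)%SET.
Proof. by rewrite finset.setUA finset.setUid. Qed.

Let setD1_id x G : x \notin G -> (G :\ x = G)%SET.
Proof.
move=> xG; apply/setP => y; rewrite !inE; case: eqP => // ->.
by rewrite (negbTE xG).
Qed.

Lemma expect_edge_average x g : Ex (edge_average x g) = Ex g.
Proof.
rewrite /expect !(big_set_split x); apply: eq_bigr => G xG.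
rewrite (weight_out xG) (weight_in xG) /edge_average setU1_id setU1K// setD1_id//.
by ring.
Qed.

(** The variance of a two-point distribution: p a^2 + (1 - p) b^2 - (p a + (1 - p) b)^2 = p (1 - p)
    (a - b)^2. *)
Lemma expect_sqr_edge_average x g :
  Ex (fun G => g G ^+ 2) - Ex (fun G => edge_average x g G ^+ 2) =
  p x * (1 - p x) * Ex (fun G => edge_diff x g G ^+ 2).
Proof.
rewrite -(expect_edge_average x (fun G => g G ^+ 2)) -expectB -expectZ.
apply: eq_expect => G; rewrite /edge_average /edge_diff; ring.
Qed.

Let setU1D1 x y G : x != y -> (x |: G :\ y = (x |: G) :\ y)%SET.
Proof.
by move=> xy; apply/setP => z; rewrite !inE; case: (eqVneq z x) => // ->; rewrite xy.
Qed.

Lemma edge_diff_average x y g G : x != y ->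
  edge_diff x (edge_average y g) G = edge_average y (edge_diff x g) G.
Proof.
move=> xy; have yx : y != x by rewrite eq_sym.
rewrite /edge_diff /edge_average (setU1D1 _ xy) (setU1D1 _ yx) finset.setUCA.
rewrite (_ : (G :\ x :\ y = G :\ y :\ x)%SET); first ring.
by apply/setP => z; rewrite !inE andbCA.
Qed.

Lemma expect_edge_average_sqr_le y g :
  Ex (fun G => edge_average y g G ^+ 2) <= Ex (fun G => g G ^+ 2).
Proof.
rewrite -subr_ge0 expect_sqr_edge_average.
have := p01 y => py; rewrite mulr_ge0//; first by rewrite mulr_ge0//; lra.
apply: expect_ge0 => [G|G]; [exact: bernoulli_weight_ge0|exact: sqr_ge0].
Qed.

Let averages (s : seq T) g := foldr edge_average g s.

Let expect_averages s g : Ex (averages s g) = Ex g.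
Proof. by elim: s => //= x s IH; rewrite expect_edge_average. Qed.

Let expect_diff_averages s x g : x \notin s ->
  Ex (fun G => edge_diff x (averages s g) G ^+ 2) <= Ex (fun G => edge_diff x g G ^+ 2).
Proof.
elim: s g => //= y s IH g; rewrite inE negb_or => /andP[xy xs].
rewrite (@eq_expect _ _ _ _ (fun G => edge_average y (edge_diff x (averages s g)) G ^+ 2)).
  by apply: le_trans (expect_edge_average_sqr_le _ _) (IH _ xs).
by move=> G; rewrite edge_diff_average.
Qed.

Let variance_averages s g : uniq s ->
  Ex (fun G => g G ^+ 2) - Ex (fun G => averages s g G ^+ 2) <=
  \sum_(x <- s) p x * (1 - p x) * Ex (fun G => edge_diff x g G ^+ 2).
Proof.
elim: s => [_|x s IH /= /andP[xs /IH{}IH]]; first by rewrite big_nil subrr.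
rewrite big_cons.
have := expect_sqr_edge_average x (averages s g).
have := expect_diff_averages g xs.
have px := p01 x; have pp : 0 <= p x * (1 - p x) by rewrite mulr_ge0//; lra.
move=> /(ler_wpM2l pp); lra.
Qed.

Let averages_indep s g y G : y \in s ->
  averages s g (y |: G)%SET = averages s g (G :\ y)%SET.
Proof.
elim: s G => // x s IH G /=; rewrite inE /edge_average.
case: (eqVneq y x) => [->|yx /= ys].
  rewrite setU1_id => _; congr (_ * averages s g _ + _ * averages s g _).
    by apply/setP => z; rewrite !inE; case: eqP.
  by apply/setP => z; rewrite !inE; case: eqP.
have xy : x != y by rewrite eq_sym.
rewrite finset.setUCA IH// (setU1D1 _ xy) -(setU1D1 _ yx) IH//.
rewrite (_ : (G :\ x :\ y = G :\ y :\ x)%SET)//.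
by apply/setP => z; rewrite !inE andbCA.
Qed.

Let averages_cst g G : averages (enum T) g G = averages (enum T) g finset.set0.
Proof.
have [m] := ubnP #|G|; elim: m G => // m IH G; rewrite ltnS => Gm.
have [->//|[y yG]] := finset.set_0Vmem G.
rewrite -[in LHS](finset.setD1K yG) averages_indep ?mem_enum//.
rewrite setD1_id ?IH// ?inE ?eqxx//.
by apply: leq_trans Gm; rewrite [ltnRHS](finset.cardsD1 y) yG.
Qed.

Lemma expect_bernoulli_cst c : Ex (fun=> c) = c.
Proof. exact: expect_cst sum_bernoulli_weight _. Qed.

(** Efron-Stein: averaging out the coordinates one by one turns [g] into its mean, and the losses of
    second moment telescope to the variance. The loss at [x] involves the difference of an already
    averaged function, and averaging over other coordinates only decreases its second moment. *)
Lemma poincare_bernoulli g : Ex (fun G => g G ^+ 2) - Ex g ^+ 2 <=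
  \sum_x p x * (1 - p x) * Ex (fun G => edge_diff x g G ^+ 2).
Proof.
have := variance_averages g (enum_uniq T); rewrite big_enum; apply: le_trans.
rewrite lerD2l lerNl opprK -(expect_averages (enum T) g).
rewrite (eq_expect _ (averages_cst g)) expect_bernoulli_cst.
rewrite (@eq_expect _ _ _ _ (fun=> averages (enum T) g finset.set0 ^+ 2)) ?expect_bernoulli_cst//.
by move=> G; rewrite averages_cst.
Qed.

Let sqr_expRB (a b : R) : (expR (a / 2) - expR (b / 2)) ^+ 2 <=
  (a - b) ^+ 2 / 4 * (expR a + expR b).
Proof.
wlog ab : a b / b <= a.
  move=> H; have [/H//|/ltW/H] := leP b a.
  by rewrite -sqrrN opprB -[(b - a) ^+ 2]sqrrN opprB [expR b + _]addrC.
have e x : expR x = expR (x / 2) ^+ 2 by rewrite expr2 -expRD -splitr.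
have d0 : 0 <= expR (a / 2) - expR (b / 2) by rewrite subr_ge0 ler_expR; lra.
have d1 : expR (a / 2) - expR (b / 2) <= expR (a / 2) * ((a - b) / 2).
  rewrite (_ : expR (b / 2) = expR (a / 2) * expR ((b - a) / 2)); last first.
    by rewrite -expRD; congr expR; field.
  rewrite -{1}[expR (a / 2)]mulr1 -mulrBr ler_wpM2l ?expR_ge0//.
  by have := expR_ge1Dx ((b - a) / 2); lra.
have : (expR (a / 2) - expR (b / 2)) ^+ 2 <= (expR (a / 2) * ((a - b) / 2)) ^+ 2.
  by rewrite lerXn2r// nnegrE//; apply: le_trans d1.
move=> /le_trans; apply; rewrite exprMn -e mulrC.
rewrite (_ : ((a - b) / 2) ^+ 2 = (a - b) ^+ 2 / 4); last by field.
by rewrite ler_wpM2l ?divr_ge0 ?sqr_ge0// lerDl expR_ge0.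
Qed.

Let edge_diffU x g G : edge_diff x g (x |: G)%SET = edge_diff x g G.
Proof.
rewrite /edge_diff setU1_id; congr (_ - g _).
by apply/setP => z; rewrite !inE; case: eqP.
Qed.

Let edge_diffD x g G : edge_diff x g (G :\ x)%SET = edge_diff x g G.
Proof.
rewrite /edge_diff; congr (g _ - g _); apply/setP => z; rewrite !inE; by case: eqP.
Qed.

(** The Poincaré inequality for exp(l f / 2). With A and B the values of [f] with and without [x],
    the weight p (1 - p) (e^(lA) + e^(lB)) is at most p e^(lA) + (1 - p) e^(lB), so it averages back
    to exp(l f). *)
Lemma expR_bernoulli_step f v l :
  (forall G, \sum_x edge_diff x f G ^+ 2 <= v) ->
  Ex (fun G => expR (l * f G)) - Ex (fun G => expR (l / 2 * f G)) ^+ 2 <=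
  l ^+ 2 * v / 4 * Ex (fun G => expR (l * f G)).
Proof.
move=> fv; have := poincare_bernoulli (fun G => expR (l / 2 * f G)).
rewrite (@eq_expect _ _ _ _ (fun G => expR (l * f G))); last first.
  by move=> G; rewrite expr2 -expRD -mulrDl -splitr.
move=> /le_trans; apply.
apply: (@le_trans _ _ (\sum_x l ^+ 2 / 4 *
    Ex (fun G => edge_diff x f G ^+ 2 * expR (l * f G)))).
  apply: ler_sum => x _.
  rewrite -[in leRHS](expect_edge_average x) -!expectZ.
  apply: ler_expect => [|G]; first exact: bernoulli_weight_ge0.
  rewrite /edge_average edge_diffU edge_diffD /edge_diff.
  set A := f _; set B := f (G :\ x)%SET.
  have := sqr_expRB (l * A) (l * B).
  rewrite !(mulrAC l _ 2^-1) -mulrBr exprMn.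
  set e1 := expR (l * A); set e2 := expR (l * B); set D := (A - B) ^+ 2.
  set X := (_ - _) ^+ 2 => XD; have /andP[p0 p1] := p01 x.
  have e10 : 0 <= e1 by exact: expR_ge0.
  have e20 : 0 <= e2 by exact: expR_ge0.
  have D0 : 0 <= l ^+ 2 / 4 * D by rewrite mulr_ge0 ?sqr_ge0// divr_ge0 ?sqr_ge0.
  have q0 : 0 <= p x * (1 - p x) by rewrite mulr_ge0//; lra.
  have := ler_wpM2l q0 XD; move=> /le_trans; apply.
  rewrite [leRHS](_ : _ = l ^+ 2 / 4 * D * (p x * e1 + (1 - p x) * e2)); last by ring.
  rewrite [leLHS](_ : _ = l ^+ 2 / 4 * D * (p x * (1 - p x) * (e1 + e2))); last by ring.
  apply: ler_wpM2l => //; rewrite -subr_ge0 (_ : _ - _ = p x ^+ 2 * e1 + (1 - p x) ^+ 2 * e2); last by ring.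
  by rewrite addr_ge0// mulr_ge0// sqr_ge0.
rewrite -mulr_sumr -expect_sum.
set F := Ex (fun G => expR _).
rewrite [leRHS](_ : _ = l ^+ 2 / 4 * (v * F)); last by ring.
rewrite ler_wpM2l ?divr_ge0 ?sqr_ge0// -expectZ.
apply: ler_expect => [|G]; first exact: bernoulli_weight_ge0.
by rewrite -mulr_suml ler_wpM2r ?expR_ge0.
Qed.

(** Squaring exp(-y/2) >= 1 - y/2 gives e^y (1 - y/2)^2 <= 1, and the right-hand side times (1 -
    y/2)^2 is at least 1 for y <= 1. *)
Lemma expR_le_quadratic (y : R) : y <= 1 -> expR y <= 1 + y + 2 * y ^+ 2.
Proof.
move=> y1; have h := expR_ge1Dx (- (y / 2)).
have h0 : 0 < 1 - y / 2 by lra.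
have e : expR y * expR (- (y / 2)) ^+ 2 = 1.
  by rewrite expr2 -!expRD (_ : y + _ = 0) ?expR0//; field.
have : expR y * (1 - y / 2) ^+ 2 <= 1.
  rewrite -[leRHS]e ler_wpM2l ?expR_ge0// lerXn2r ?nnegrE ?expR_ge0//; lra.
have d0 : 0 < (1 - y / 2) ^+ 2 by rewrite exprn_gt0.
move=> h1; rewrite -(ler_pM2r d0); apply: le_trans h1 _.
rewrite -subr_ge0 (_ : _ - _ = y ^+ 2 * ((1 - y) * (5 / 4 - y / 2))); last by field.
by rewrite mulr_ge0 ?sqr_ge0// mulr_ge0//; lra.
Qed.

(** Halve [l] repeatedly until the exponent is small enough for the quadratic bound. The bound 2 on
    |f| is what a function bounded by 1 satisfies after its mean is subtracted. *)
Lemma expR_bernoulli_bound f v l : 0 <= v ->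
  (forall G, \sum_x edge_diff x f G ^+ 2 <= v) ->
  (forall G, `|f G| <= 2) -> Ex f = 0 -> l ^+ 2 * v <= 1 ->
  Ex (fun G => expR (l * f G)) <= expR 2.
Proof.
move=> v0 fv f2 f0.
(* [J] counts the halvings. Writing L for the Laplace transform, each one gives L(m) <= exp(m^2 v /
   2) L(m/2)^2, and both terms of the exponent reproduce themselves: m^2 v / 2 + 2 (m/2)^2 v = m^2
   v, while the remainder 8 m^2 / 2^J comes from the quadratic bound at the last stage. *)
have H J m : m ^+ 2 * v <= 1 -> `|m| <= 2 ^+ J / 2 ->
    Ex (fun G => expR (m * f G)) <= expR (m ^+ 2 * v + 8 * m ^+ 2 / 2 ^+ J).
  elim: J m => [|J IH] m mv mJ.
    rewrite expr0 divr1; apply: (@le_trans _ _ (1 + 8 * m ^+ 2)).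
      apply: (@le_trans _ _ (Ex (fun G => 1 + m * f G + 8 * m ^+ 2))).
        apply: ler_expect => [|G]; first exact: bernoulli_weight_ge0.
        have mf : `|m * f G| <= 1.
          by rewrite normrM; have := f2 G; have := normr_ge0 m; have := normr_ge0 (f G); nra.
        have := expR_le_quadratic (le_trans (ler_norm _) mf).
        move=> /le_trans; apply; rewrite lerD2l exprMn.
        have : f G ^+ 2 <= 4 by rewrite -[f G ^+ 2]real_normK ?num_real//; have := f2 G; have := normr_ge0 (f G); nra.
        by have := sqr_ge0 m; nra.
      by rewrite 2!expectD expectZ f0 !expect_bernoulli_cst mulr0 addr0.
    by apply: le_trans (expR_ge1Dx _) _; rewrite ler_expR lerDr mulr_ge0// sqr_ge0.
  have := expR_bernoulli_step m fv.
  set E1 := Ex _; set E2 := Ex _ => st.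
  have E20 : 0 <= E2 by apply: expect_ge0 => G; [exact: bernoulli_weight_ge0|exact: expR_ge0].
  have m20 := sqr_ge0 m.
  have {}IH : E2 <= expR ((m / 2) ^+ 2 * v + 8 * (m / 2) ^+ 2 / 2 ^+ J).
    apply: IH; rewrite ?exprMn ?exprVn; first by nra.
    rewrite normrM [`|2^-1|]ger0_norm//; move: mJ; rewrite exprS; lra.
  have y1 : E1 * (1 - m ^+ 2 * v / 4) <= E2 ^+ 2 by lra.
  have y2 : 1 <= expR (m ^+ 2 * v / 2) * (1 - m ^+ 2 * v / 4).
    have := expR_ge1Dx (m ^+ 2 * v / 2).
    have : 0 <= m ^+ 2 * v by apply: mulr_ge0.
    nra.
  have E10 : 0 <= E1 by apply: expect_ge0 => G; [exact: bernoulli_weight_ge0|exact: expR_ge0].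
  have y3 : E1 <= expR (m ^+ 2 * v / 2) * E2 ^+ 2.
    apply: le_trans (ler_wpM2l (expR_ge0 (m ^+ 2 * v / 2)) y1).
    by rewrite mulrCA ler_peMr.
  apply: le_trans y3 _.
  rewrite [leRHS](_ : _ = expR (m ^+ 2 * v / 2) *
    expR ((m / 2) ^+ 2 * v + 8 * (m / 2) ^+ 2 / 2 ^+ J) ^+ 2).
    by rewrite ler_wpM2l ?expR_ge0// lerXn2r ?nnegrE ?expR_ge0.
  rewrite [X in _ = _ * X]expr2 -!expRD; congr expR; rewrite [2 ^+ J.+1]exprS.
  by field; rewrite expf_neq0.
(* The two summands make the remainder at most 1 and meet the requirement |l| <= 2^J / 2. *)
move=> lv; pose J := Num.bound (8 * l ^+ 2 + 2 * `|l|).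
have Jb : 8 * l ^+ 2 + 2 * `|l| <= 2 ^+ J.
  apply: le_trans (ltW (archi_boundP _)) _.
    by rewrite addr_ge0// mulr_ge0// ?sqr_ge0 ?normr_ge0.
  by rewrite -natrX ler_nat ltnW// ltn_expl.
have l20 := sqr_ge0 l.
apply: le_trans (H J l lv _) _; first by lra.
rewrite ler_expR; suff : 8 * l ^+ 2 / 2 ^+ J <= 1 by lra.
rewrite ler_pdivrMr ?exprn_gt0// mul1r; have := normr_ge0 l; lra.
Qed.

(* The exponential concentration of Aida and Stroock: iterating the Poincare
   inequality for [expR (l f / 2)] bounds the Laplace transform of [f]. *)
Lemma bernoulli_concentration f v l (s : R) : 0 <= v -> 0 <= l ->
  (forall G, \sum_x edge_diff x f G ^+ 2 <= v) ->
  (forall G, `|f G| <= 1) -> l ^+ 2 * v <= 1 ->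
  Ex (fun G => (s <= `|f G - Ex f|)%R%:R) <= 2 * expR (2 - l * s).
Proof.
move=> v0 l0 fv f1 lv; set m := Ex f.
have m1 : `|m| <= 1.
  by apply: expect_norm_le_cst => //; [exact: bernoulli_weight_ge0|exact: sum_bernoulli_weight].
have H (c : R) : c ^+ 2 = l ^+ 2 ->
    Ex (fun G => expR (c * (f G - m))) <= expR 2.
  move=> cl; apply: (expR_bernoulli_bound v0); rewrite ?cl//.
  - move=> G; apply: le_trans (fv G); apply: ler_sum => x _.
    by rewrite /edge_diff opprB addrA subrK.
  - by move=> G; apply: le_trans (ler_normB _ _) _; have := f1 G; lra.
  - by rewrite expectB expect_bernoulli_cst subrr.
apply: (@le_trans _ _ (Ex (fun G => expR (- (l * s)) * expR (l * (f G - m)) +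
   expR (- (l * s)) * expR (- l * (f G - m))))).
  apply: ler_expect => [|G]; first exact: bernoulli_weight_ge0.
  rewrite -!expRD; have e1 := expR_ge0 (- (l * s) + l * (f G - m)).
  have e2 := expR_ge0 (- (l * s) + - l * (f G - m)).
  case: (leP s) => h; last by rewrite addr_ge0.
  have [g0|g0] := leP 0 (f G - m).
    rewrite ger0_norm// in h.
    have := expR_ge1Dx (- (l * s) + l * (f G - m)).
    by have := ler_wpM2l l0 h; rewrite mulr1n; lra.
  rewrite ltr0_norm// in h.
  have := expR_ge1Dx (- (l * s) + - l * (f G - m)).
  by have := ler_wpM2l l0 h; rewrite mulr1n; lra.
rewrite expectD !expectZ -mulrDr [2 - _]addrC expRD mulrCA ler_wpM2l ?expR_ge0//.
have := H l erefl; have := H (- l) (sqrrN l); lra.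
Qed.

End ProductMeasure.

(** * Elementary bounds for sine and cosine *)

Section Trigonometry.
Variable R : realType.
Implicit Types x y h t : R.

Lemma mvt_abs (f df : R -> R) x y : (forall z : R, is_derive z 1 f (df z)) ->
  exists2 c, `|c - x| <= `|y - x| & f y - f x = df c * (y - x).
Proof.
move=> fd.
have cont : continuous f.
  move=> z; apply: differentiable_continuous; apply/derivable1_diffP.
  by have [] := fd z.
have H (a b : R) : a < b -> exists2 c, a < c < b & f b - f a = df c * (b - a).
  move=> ab; have [c cab e] : exists2 c, c \in `]a, b[ & f b - f a = df c * (b - a).
    by apply: MVT => //; exact: continuous_subspaceT.
  by exists c => //; move: cab; rewrite in_itv.
have [xy|yx|->] := ltgtP x y.
- have [c /andP[xc cy] e] := H _ _ xy; exists c => //.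
  by rewrite !gtr0_norm ?subr_gt0//; lra.
- have [c /andP[xc cy] e] := H _ _ yx; exists c; last by lra.
  by rewrite !ltr0_norm ?subr_lt0//; lra.
- by exists y; rewrite ?subrr ?mulr0.
Qed.

Lemma sin_lipschitz x y : `|sin y - sin x| <= `|y - x|.
Proof.
have [c _ ->] := @mvt_abs sin cos x y (@is_derive_sin R).
by rewrite normrM ler_piMl ?cos_max.
Qed.

Lemma cos_taylor1 x h : `|cos (x + h) - cos x + h * sin x| <= h ^+ 2.
Proof.
have [c cx ->] := @mvt_abs cos (fun z => - sin z) x (x + h) (@is_derive_cos R).
move: cx; rewrite addrAC subrr add0r => cx.
rewrite (_ : _ + _ = - (h * (sin c - sin x))); last by ring.
rewrite normrN normrM -real_normK ?num_real// expr2 ler_wpM2l//.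
exact: le_trans (sin_lipschitz _ _) cx.
Qed.

(** As 1 - cos t = 2 sin(t/2)^2, it suffices that sin(t/2) >= t/4. The mean value theorem gives
    sin(t/4) >= (t/4) cos(t/4), hence sin(t/2) >= (t/2) cos(t/4)^2, and 2 cos(t/4)^2 = 1 + cos(t/2)
    >= 1. *)
Lemma one_minus_cos_ge t : 0 <= t <= pi -> t ^+ 2 / 8 <= 1 - cos t.
Proof.
move=> /andP[t0 tpi].
have [c cx] := @mvt_abs sin cos 0 (t / 4) (@is_derive_sin R).
rewrite sin0 !subr0 => e.
rewrite !subr0 [`|t / 4|]ger0_norm in cx; last by lra.
have c2 : cos (t / 2) = 2 * cos (t / 4) ^+ 2 - 1.
  have -> : t / 2 = (t / 4) *+ 2 by rewrite [RHS]mulr2n; lra.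
  by rewrite cos_mulr2n; ring.
have s2 : sin (t / 2) = 2 * (sin (t / 4) * cos (t / 4)).
  by rewrite (_ : t / 2 = t / 4 + t / 4) ?sinD; [ring|lra].
have ct : cos t = 1 - 2 * sin (t / 2) ^+ 2.
  have {1}-> : t = (t / 2) *+ 2 by rewrite [RHS]mulr2n; lra.
  by rewrite cos_mulr2n sin2cos2; ring.
have ch : 0 <= cos (t / 2) by apply: cos_ge0_pihalf; lra.
have cq : 0 <= cos (t / 4) by apply: cos_ge0_pihalf; lra.
have cc : cos (t / 4) <= cos c.
  have [c0|c0] := leP 0 c.
    rewrite ger0_norm// in cx.
    by rewrite leNgt; apply/negP; rewrite ltr_cos ?in_itv/=; lra.
  rewrite ltr0_norm// in cx.
  by rewrite -[cos c]cosN leNgt; apply/negP; rewrite ltr_cos ?in_itv/=; lra.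
have s4 : t / 4 * cos (t / 4) <= sin (t / 4).
  by rewrite e mulrC ler_wpM2r//; lra.
have : t / 4 <= sin (t / 2).
  rewrite s2; have := ler_wpM2r cq s4; nra.
rewrite ct => h; have : (t / 4) ^+ 2 <= sin (t / 2) ^+ 2.
  by rewrite lerXn2r ?nnegrE//; lra.
rewrite (_ : (t / 4) ^+ 2 = t ^+ 2 / 16); last by field.
lra.
Qed.

End Trigonometry.

(** * Discrete gradient of an averaged cosine *)

Section CosineAverages.
Variables (R : realType) (T I : finType) (p : T -> R) (w : I -> R).
Hypothesis p01 : forall x, 0 <= p x <= 1.
Hypothesis w0 : forall i, 0 <= w i.
Hypothesis w1 : \sum_i w i = 1.
Variable b : T -> I -> R.
Implicit Types (G : {set T}) (t a : R).

(** The phase [a] carries the target value of the Fourier inversion, which keeps everything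
    real-valued. *)
Definition cos_average t a G : R :=
  expect w (fun i => cos (t * (\sum_(x in G) b x i) - a)).

Lemma cos_average_le1 t a G : `|cos_average t a G| <= 1.
Proof. by apply: expect_norm_le_cst => // i; exact: cos_max. Qed.

(** A first-order expansion around [G] itself, whether or not [x] lies in [G]. The sine factor
    therefore does not depend on [x], which is what allows the squares to be summed over [x]
    afterwards. *)
Lemma edge_diff_cos_average (x : T) t a G : (forall i, `|b x i| <= 1) ->
  edge_diff x (cos_average t a) G ^+ 2 <=
  2 * t ^+ 2 * expect w (fun i => b x i *
     sin (t * (\sum_(y in G) b y i) - a)) ^+ 2 + 2 * t ^+ 4.
Proof.
move=> b1; set E := expect w _; set D := edge_diff _ _ _.
suff H : `|D + t * E| <= t ^+ 2.
  have : (D + t * E) ^+ 2 <= (t ^+ 2) ^+ 2.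
    by rewrite -[leLHS]real_normK ?num_real// lerXn2r ?nnegrE ?sqr_ge0.
  (* This square is exactly 2 (D + t E)^2 + 2 t^2 E^2 - D^2. *)
  have := sqr_ge0 (D + 2 * t * E).
  rewrite -exprM; nra.
rewrite /D /E /edge_diff /cos_average -expectZ -expectB -expectD.
apply: expect_norm_le_cst => // i.
have bt : (t * b x i) ^+ 2 <= t ^+ 2.
  rewrite exprMn ler_piMr ?sqr_ge0// -[leLHS]real_normK ?num_real//.
  by rewrite exprn_ile1.
have sD : \sum_(y in (x |: G)%SET) b y i = b x i + \sum_(y in (G :\ x)%SET) b y i.
  rewrite (big_setD1 x) ?finset.setU11//=; congr (_ + _); apply: eq_bigl => y.
  by rewrite !inE; case: eqP.
case: (boolP (x \in G)) => xG.
  have -> : (x |: G)%SET = G by apply/setP => y; rewrite !inE; case: eqP => // ->.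
  rewrite (big_setD1 x xG) /=; set A := \sum_(_ in _) _.
  have := cos_taylor1 (t * (b x i + A) - a) (- (t * b x i)).
  rewrite sqrrN => /le_trans/(_ bt); rewrite -normrN; congr (`|_| <= _).
  by rewrite (_ : t * (b x i + A) - a - t * b x i = t * A - a); ring.
rewrite sD (_ : G :\ x = G)%SET; last first.
  by apply/setP => y; rewrite !inE; case: eqP => // ->; rewrite (negbTE xG).
set A := \sum_(_ in _) _.
have := cos_taylor1 (t * A - a) (t * b x i).
move=> /le_trans/(_ bt); congr (`|_| <= _).
by rewrite (_ : t * A - a + t * b x i = t * (b x i + A) - a); ring.
Qed.

(** A squared expectation is an expectation over two independent copies [i], [j]. Summing over [x]
    inside leaves the correlation of [b] at [i] and [j], multiplied by two sines that are bounded by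
    1. *)
Lemma sum_edge_diff_cos_average (A : {set T}) t a G :
  (forall x i, `|b x i| <= 1) -> (forall x i, x \notin A -> b x i = 0) ->
  \sum_x edge_diff x (cos_average t a) G ^+ 2 <=
  2 * t ^+ 2 * expect w (fun i => expect w (fun j => `|\sum_x b x i * b x j|)) +
  2 * t ^+ 4 * #|A|%:R.
Proof.
move=> b1 bA; pose s i := sin (t * (\sum_(y in G) b y i) - a).
apply: (@le_trans _ _ (2 * t ^+ 2 * (\sum_x expect w (fun i => b x i * s i) ^+ 2)
    + 2 * t ^+ 4 * (\sum_(x in A) 1))).
  rewrite !mulr_sumr [X in _ + X]big_mkcond -big_split; apply: ler_sum => x _.
  case: ifPn => xA; first by rewrite mulr1; exact: edge_diff_cos_average.
  rewrite /= addr0 (_ : edge_diff x _ G = 0); last first.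
    rewrite /edge_diff /cos_average -expectB.
    rewrite (@eq_expect _ _ _ _ (fun=> 0)) ?expect_cst// => i.
    have e (B : {set T}) : \sum_(y in B) b y i = \sum_(y in (B :\ x)%SET) b y i.
      have [xB|xB] := boolP (x \in B); first by rewrite (big_setD1 x xB)/= bA ?add0r.
      by apply: eq_bigl => y; rewrite !inE; case: eqP => // ->; rewrite (negbTE xB).
    rewrite e [X in _ - cos (t * X - _)]e; apply/eqP; rewrite subr_eq0; apply/eqP.
    congr (cos (_ * _ - _)); apply: eq_bigl => y; rewrite !inE; by case: eqP.
  by rewrite expr0n/= mulr_ge0 ?sqr_ge0// mulr_ge0 ?sqr_ge0.
rewrite sumr_const lerD2r; apply: ler_wpM2l; first by rewrite mulr_ge0 ?sqr_ge0.
apply: (@le_trans _ _ (expect w (fun i => expect w (fun j =>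
   s i * s j * \sum_x b x i * b x j)))).
  rewrite le_eqVlt; apply/orP; left; apply/eqP.
  transitivity (expect w (fun i => \sum_x expect w (fun j => s i * s j * (b x i * b x j)))).
    rewrite expect_sum; apply: eq_bigr => x _.
    rewrite expr2 -expectZ; apply: eq_expect => i.
    by rewrite mulrC -expectZ; apply: eq_expect => j; ring.
  by apply: eq_expect => i; rewrite -expect_sum; apply: eq_expect => j; rewrite mulr_sumr.
apply: ler_expect => // i; apply: ler_expect => // j.
apply: le_trans (ler_norm _) _; rewrite normrM ler_piMl// normrM.
by rewrite mulr_ile1// sin_max.
Qed.

End CosineAverages.

(** * Characteristic function of a sum of independent terms *)

Section CharacteristicFunction.
Variables (R : realType) (T : finType) (p : T -> R).
Local Open Scope complex_scope.

Let cis (x : R) : R[i] := (cos x +i* sin x)%C.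

Let cis_sum (P : pred T) (c : T -> R) :
  cis (\sum_(x | P x) c x) = \prod_(x | P x) cis (c x).
Proof.
apply: (big_morph cis) => [x y|]; last by rewrite /cis cos0 sin0.
by rewrite /cis cosD sinD; apply/eqP; rewrite eq_complex /=; apply/andP; split;
  apply/eqP; ring.
Qed.

(** The expectation is the real part of the product of the factors 1 - p + p e^(ic), whose squared
    moduli are 1 - 2 p (1 - p) (1 - cos c). *)
Lemma expect_cos_sum_le (c : T -> R) :
  `|expect (bernoulli_weight p) (fun G => cos (\sum_(x in G) c x))| <=
  expR (- \sum_x p x * (1 - p x) * (1 - cos (c x))).
Proof.
have -> : expect (bernoulli_weight p) (fun G => cos (\sum_(x in G) c x)) =
   complex.Re (\prod_x ((1 - p x)%:C + (p x)%:C * cis (c x))).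
  rewrite -(expect_bernoulli_prod p (real_complex R)) raddf_sum.
  apply: eq_bigr => G _; rewrite -cis_sum /=.
  by rewrite mul0r subr0.
have H (z : R[i]) : `|complex.Re z| <= complex.Re `|z|.
  by rewrite normc_def /= -sqrtr_sqr ler_wsqrtr// lerDl sqr_ge0.
apply: le_trans (H _) _; rewrite normr_prod -sumrN expR_sum.
rewrite (_ : \prod_x _ = (\prod_x Num.sqrt (1 - 2 * (p x * (1 - p x) * (1 - cos (c x)))))%:C).
  rewrite /=; apply: ler_prod => x _; rewrite sqrtr_ge0 /=.
  rewrite -[leRHS]ger0_norm ?expR_ge0// -sqrtr_sqr.
  rewrite ler_wsqrtr// expr2 -expRD.
  apply: le_trans (expR_ge1Dx _); lra.
rewrite rmorph_prod; apply: eq_bigr => x _; rewrite normc_def /=.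
congr ((Num.sqrt _)%:C); have := cos2Dsin2 (c x).
set C := cos _; set S := sin _ => CS.
transitivity ((1 - p x) ^+ 2 + 2 * (1 - p x) * p x * C + p x ^+ 2 * (C ^+ 2 + S ^+ 2)).
  by ring.
by rewrite CS; ring.
Qed.

End CharacteristicFunction.

(** * Second moment of the averaged cosine *)

Section HighFrequency.
Variables (R : realType) (T I : finType) (p : T -> R) (w : I -> R).
Hypothesis p01 : forall x, 0 <= p x <= 1.
Hypothesis w0 : forall i, 0 <= w i.
Hypothesis w1 : \sum_i w i = 1.
Variable b : T -> I -> R.

(** Adding the square of the sine average completes the square of the cosine average to the
    expectation of cos(th_i - th_j) over two independent copies. For a fixed pair of copies the
    phase difference is a sum over independent edges. *)
Lemma expect_sqr_cos_average_le (t a : R) :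
  expect (bernoulli_weight p) (fun G => cos_average w b t a G ^+ 2) <=
  expect w (fun i => expect w (fun j =>
    expR (- \sum_x p x * (1 - p x) * (1 - cos (t * (b x i - b x j)))))).
Proof.
have bw0 := bernoulli_weight_ge0 p01.
pose th (G : {set T}) i := t * (\sum_(x in G) b x i) - a.
apply: (@le_trans _ _ (expect (bernoulli_weight p) (fun G =>
    expect w (fun i => expect w (fun j => cos (th G i - th G j)))))).
  apply: ler_expect => // G; rewrite /cos_average.
  rewrite (@eq_expect _ _ _ (fun i => expect w (fun j => cos (th G i - th G j)))
    (fun i => expect w (fun j => cos (th G j)) * cos (th G i) +
       expect w (fun j => sin (th G j)) * sin (th G i))); last first.
    move=> i; rewrite [RHS]addrC ![_ * cos (th G i)]mulrC ![_ * sin (th G i)]mulrC.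
    by rewrite addrC -!expectZ -expectD; apply: eq_expect => j; rewrite cosB.
  by rewrite expectD !expectZ -!expr2 lerDl sqr_ge0.
rewrite (_ : expect _ _ = expect w (fun i => expect w (fun j =>
   expect (bernoulli_weight p) (fun G => cos (th G i - th G j))))).
  apply: ler_expect => // i; apply: ler_expect => // j.
  apply: le_trans (ler_norm _) _.
  apply: le_trans (expect_cos_sum_le p (fun x => t * (b x i - b x j))).
  rewrite le_eqVlt; apply/orP; left; apply/eqP; congr `|_|; apply: eq_expect => G.
  congr cos; rewrite /th -mulr_sumr sumrB; ring.
rewrite /expect.
under eq_bigr do rewrite mulr_sumr.
rewrite exchange_big; apply: eq_bigr => i _ /=.
under eq_bigr do rewrite !mulr_sumr.
rewrite exchange_big mulr_sumr; apply: eq_bigr => j _ /=.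
rewrite !mulr_sumr; apply: eq_bigr => G _; ring.
Qed.

End HighFrequency.

(** * Uniform k-subsets: intersections, correlations and distances *)

Lemma exp2_le_bin (a b : nat) : (2 ^ minn a b <= 'C(a + b, a))%N.
Proof.
elim: a b => [|a IH] [|b]; rewrite ?min0n ?minn0 ?expn0 ?bin_gt0//.
  by rewrite leq_addr.
rewrite minnSS expnS mul2n -addnn addSn binS.
rewrite addnS binS; apply: leq_add; last first.
  by apply: leq_trans (IH b) _; exact: leq_bin2l.
by rewrite (leq_trans (IH b))// leq_addl.
Qed.

(** Such a set is read off [r] slots, each holding an element or nothing. *)
Lemma card_small_sets (V : finType) (r : nat) :
  (#|[set A : {set V} | (#|A| <= r)%N]%SET| <= #|V|.+1 ^ r)%N.
Proof.
pose F (g : {ffun 'I_r -> option V}) : {set V} := [set x | [exists i, g i == Some x]]%SET.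
have : ([set A : {set V} | (#|A| <= r)%N] \subset [set F g | g in {ffun 'I_r -> option V}])%SET.
  apply/fintype.subsetP => A; rewrite inE => Ar.
  apply/imsetP; exists [ffun i : 'I_r => onth (enum A) i] => //.
  apply/setP => x; rewrite inE; apply/idP/existsP => [xA|[j]].
    have xe : x \in enum A by rewrite mem_enum.
    have lt : (index x (enum A) < r)%N.
      by apply: leq_trans Ar; rewrite cardE index_mem.
    exists (Ordinal lt); rewrite ffunE /= onthE (nth_map x) ?index_mem// nth_index//.
  by rewrite ffunE => /eqP e; rewrite -mem_enum; apply/onthP; exists j.
move=> /subset_leq_card/leq_trans; apply; apply: leq_trans (leq_imset_card _ _) _.
by rewrite card_ffun card_option card_ord.
Qed.

Section UniformSubset.
Variables (R : realType) (n k : nat).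
Hypotheses (k2 : (2 <= k)%N) (kn : (k <= n)%N).
Local Notation V := 'I_n.
Implicit Types (S J e : {set V}).

Definition subset_weight (S : {set V}) : R := (#|S| == k)%:R / 'C(n, k)%:R.
Local Notation ES := (expect subset_weight).

Let N : R := 'C(n, 2)%:R.
Let K : R := 'C(k, 2)%:R.

(** K/N is the probability that a pair lies in a random k-set. Summed over the edges of a graph with
    M edges this gives e(S) - KM/N. The first factor kills the sets that are not pairs, since graphs
    are subsets of a type containing all vertex sets. *)
Definition edge_dev (e S : {set V}) : R :=
  (#|e| == 2)%:R * ((e \subset S)%:R - K / N).

Let Cnk_gt0 : 0 < 'C(n, k)%:R :> R.
Proof. by rewrite ltr0n bin_gt0. Qed.

Let n2 : (2 <= n)%N. Proof. exact: leq_trans kn. Qed.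

Let N_gt0 : 0 < N.
Proof. by rewrite ltr0n bin_gt0. Qed.

Lemma subset_weight_ge0 S : 0 <= subset_weight S.
Proof. by rewrite divr_ge0. Qed.

Lemma sum_subset_weight : \sum_S subset_weight S = 1.
Proof.
rewrite -mulr_suml -natr_sum -(@big_mkcond _ _ addn _ _ (fun S : {set V} => #|S| == k) (fun=> 1%N)) sum1_card.
have := card_draws V k; rewrite card_ord cardsE => ->.
by rewrite divff// gt_eqF.
Qed.

Lemma card_supersets J : (#|J| <= k)%N ->
  #|[set S : {set V} | (#|S| == k) && (J \subset S)]%SET| = 'C(n - #|J|, k - #|J|)%N.
Proof.
move=> Jk; have <- : #|(~: J)%SET| = (n - #|J|)%N by rewrite cardsCs finset.setCK card_ord.
rewrite -(cards_draws (~: J)%SET).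
rewrite -[RHS](card_in_imset (f := fun A => J :|: A)%SET).
  apply: eq_card => S; rewrite inE; apply/andP/imsetP => [[/eqP Sk JS]|[A]].
    exists (S :\: J)%SET.
      rewrite inE cardsD (finset.setIidPr JS) Sk eqxx andbT.
      by apply/fintype.subsetP => x; rewrite !inE => /andP[].
    apply/setP => x; have := fintype.subsetP JS x; rewrite !inE.
    by case: (x \in J) => //= ->.
  rewrite inE => /andP[AJ /eqP Ak] ->; split; last exact: finset.subsetUl.
  rewrite cardsU Ak (_ : (J :&: A)%SET = finset.set0) ?cards0 ?subn0 ?subnKC//.
  apply/setP => x; have := fintype.subsetP AJ x; rewrite !inE.
  by case: (x \in A); rewrite ?andbF// => /(_ isT)/negbTE ->.
move=> A B; rewrite !inE => /andP[AJ _] /andP[BJ _] /setP AB; apply/setP => x.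
have := AB x; rewrite !inE.
have := fintype.subsetP AJ x; have := fintype.subsetP BJ x; rewrite !inE.
by case: (x \in J) => //= bB bA _; apply/idP/idP => h; [have := bA h|have := bB h].
Qed.

Lemma expect_superset J : (#|J| <= k)%N ->
  ES (fun S : {set V} => (J \subset S)%:R) = 'C(n - #|J|, k - #|J|)%:R / 'C(n, k)%:R.
Proof.
move=> Jk; rewrite -card_supersets// /expect -sum1_card natr_sum mulr_suml.
rewrite [RHS]big_mkcond; apply: eq_bigr => S _; rewrite inE /subset_weight.
by case: eqP => _; case: (J \subset S); rewrite /= ?mul0r ?mulr0 ?mulr1 ?mul1r.
Qed.

Lemma expect_subset_mem (x : V) : ES (fun S : {set V} => (x \in S)%:R) = k%:R / n%:R.
Proof.
rewrite (@eq_expect _ _ _ _ (fun S : {set V} => ([set x]%SET \subset S)%:R)); last first.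
  by move=> S; rewrite finset.sub1set.
rewrite expect_superset ?cards1 ?(leq_trans _ k2)// !subn1.
have n0 : n%:R != 0 :> R by rewrite pnatr_eq0; case: (n) n2.
have C0 : 'C(n, k)%:R != 0 :> R by rewrite gt_eqF.
apply/eqP; rewrite eqr_div// -!natrM eqr_nat; apply/eqP.
by case: k n k2 kn => [//|k'] [//|n'] _ _ /=; rewrite mulnC mul_bin_diag.
Qed.

Lemma expect_subset_pair e : #|e| = 2%N ->
  ES (fun S : {set V} => (e \subset S)%:R) = K / N.
Proof.
move=> e2; rewrite expect_superset e2// /K /N.
have C0 : 'C(n, k)%:R != 0 :> R by rewrite gt_eqF.
have N0 : 'C(n, 2)%:R != 0 :> R by rewrite gt_eqF.
apply/eqP; rewrite eqr_div// -!natrM eqr_nat; apply/eqP.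
case: k n k2 kn => [//|[//|k']] [//|[//|n']] _ _; rewrite !subSS !subn0.
have h1 := mul_bin_diag n'.+2 k'.+1; have h2 := mul_bin_diag n'.+1 k'.
have h3 := mul_bin_diag n'.+2 1; have h4 := mul_bin_diag k'.+2 1.
rewrite /= !bin1 in h1 h2 h3 h4.
apply/eqP; rewrite -(eqn_pmul2l (isT : 0 < 2)%N); apply/eqP.
rewrite mulnCA -h3 mulnCA [('C(n', _) * _)%N]mulnC h2 mulnCA h1.
by rewrite !mulnA -h4 [(k'.+1 * _)%N]mulnC.
Qed.

Lemma natr_bin2 (m : nat) : 'C(m, 2)%:R = m%:R * (m%:R - 1) / 2 :> R.
Proof.
elim: m => [|m IH]; first by rewrite !mul0r.
by rewrite binS bin1 natrD IH -[m.+1%:R]natr1; field.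
Qed.

Lemma sum_pairs_subset (S S' : {set V}) :
  \sum_(e : {set V} | #|e| == 2%N) (e \subset S)%:R * (e \subset S')%:R =
  'C(#|S :&: S'|%SET, 2)%:R :> R.
Proof.
rewrite -(cards_draws (S :&: S')%SET) -sum1_card natr_sum [RHS]big_mkcond.
rewrite [LHS]big_mkcond; apply: eq_bigr => e _.
rewrite inE finset.subsetI; case: eqP => _; rewrite ?andbF ?andbT//.
by case: (e \subset S); case: (e \subset S'); rewrite ?mul0r ?mulr0 ?mulr1.
Qed.

Lemma sum_edge_devM S S' : #|S| = k -> #|S'| = k ->
  \sum_e edge_dev e S * edge_dev e S' = 'C(#|S :&: S'|%SET, 2)%:R - K ^+ 2 / N.
Proof.
move=> Sk S'k; have h (A : {set V}) : #|A| = k -> \sum_(e : {set V} | #|e| == 2%N) (e \subset A)%:R = K :> R.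
  move=> Ak; have eK := sum_pairs_subset A A; rewrite finset.setIid Ak in eK.
  rewrite /K -eK.
  by apply: eq_bigr => e _; case: (_ \subset _); rewrite ?mulr0 ?mulr1.
rewrite -sum_pairs_subset /edge_dev.
have c2 : \sum_(e : {set V} | #|e| == 2%N) (1 : R) = N.
  by rewrite sumr_const /N -[in RHS](card_ord n) -card_draws cardsE.
transitivity (\sum_(e : {set V} | #|e| == 2%N)
   ((e \subset S)%:R * (e \subset S')%:R - K / N * ((e \subset S)%:R + (e \subset S')%:R)
    + (K / N) ^+ 2 * 1)).
  rewrite [RHS]big_mkcond; apply: eq_bigr => e _.
  by case: eqP => _; rewrite ?mul0r//=; ring.
rewrite big_split /= sumrB -!mulr_sumr big_split /= !h// c2.
by field; rewrite gt_eqF.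
Qed.

Let n_gt0 : 0 < n%:R :> R. Proof. by rewrite ltr0n; lia. Qed.

Let k_le_n : k%:R <= n%:R :> R. Proof. by rewrite ler_nat. Qed.

Let k_ge2 : 2 <= k%:R :> R. Proof. by rewrite (ler_nat R 2). Qed.

Let EScst c : ES (fun=> c) = c.
Proof. exact: expect_cst sum_subset_weight _. Qed.

(** The second moment comes from c^2 = 2 C(c, 2) + c: counting vertices and pairs in the
    intersection gives the mean k^2/n and the pair expectation K^2/N. *)
Lemma expect_card_setI_var S : #|S| = k ->
  ES (fun S' => (#|S :&: S'|%SET%:R - k%:R ^+ 2 / n%:R) ^+ 2) <= n%:R.
Proof.
move=> Sk.
have card S' : #|(S :&: S')%SET|%:R = \sum_(x in S) (x \in S')%:R :> R.
  rewrite -sum1_card natr_sum big_mkcond [RHS]big_mkcond; apply: eq_bigr => x _.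
  by rewrite inE; case: (x \in S); case: (x \in S').
have E1 : ES (fun S' => #|S :&: S'|%SET%:R) = k%:R ^+ 2 / n%:R.
  rewrite (eq_expect _ card) expect_sum (eq_bigr (fun=> k%:R / n%:R)).
    by rewrite sumr_const Sk -mulr_natr; ring.
  by move=> x _; rewrite expect_subset_mem.
have E2 : ES (fun S' => 'C(#|S :&: S'|%SET, 2)%:R) = K ^+ 2 / N.
  rewrite (@eq_expect _ _ _ _ (fun S' => \sum_(e : {set V} | #|e| == 2%N)
     (e \subset S)%:R * (e \subset S')%:R)); last by move=> S'; rewrite sum_pairs_subset.
  rewrite expect_sum (eq_bigr (fun e : {set V} => (e \subset S)%:R * (K / N))).
    rewrite -mulr_suml.
    have := sum_pairs_subset S S; rewrite finset.setIid Sk -/K => <-.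
    rewrite mulrA expr2; congr (_ * _ / _).
    by apply: eq_bigr => e _; case: (_ \subset _); rewrite ?mulr0 ?mulr1.
  by move=> e /eqP e2; rewrite expectZ expect_subset_pair.
rewrite -E1 expect_variance; last exact: sum_subset_weight.
rewrite (@eq_expect _ _ _ _ (fun S' => 2 * 'C(#|S :&: S'|%SET, 2)%:R + #|S :&: S'|%SET%:R)); last first.
  by move=> S'; rewrite natr_bin2; field.
rewrite expectD expectZ E1 E2 /K /N !natr_bin2.
move: n_gt0 k_le_n k_ge2; set m := n%:R; set l := k%:R => m0 lm l2.
rewrite (_ : _ - _ = l ^+ 2 / m - l ^+ 2 * (2 * l * m - m - l ^+ 2) / (m ^+ 2 * (m - 1))); last first.
  by field; rewrite !gt_eqF//; lra.
apply: (@le_trans _ _ (l ^+ 2 / m)).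
  rewrite gerBl divr_ge0//; last by rewrite mulr_ge0 ?sqr_ge0//; lra.
  rewrite mulr_ge0 ?sqr_ge0//; nra.
by rewrite ler_pdivrMr//; nra.
Qed.

(** The correlation C(c, 2) - K^2/N, with c the size of the intersection, is at most n |c - k^2/n| +
    2n in absolute value, and c deviates from its mean k^2/n by about [r], the square root of n. *)
Lemma expect_edge_dev_corr_le (r : R) : 0 < r -> r ^+ 2 = n%:R ->
  ES (fun S => ES (fun S' => `|\sum_e edge_dev e S * edge_dev e S'|)) <=
  n%:R * r + 2 * n%:R.
Proof.
move=> r0 rn.
rewrite -[leRHS]EScst; apply: ler_sum => S _; rewrite {1 3}/subset_weight.
case: eqP => Sk; last by rewrite !mul0r.
apply: ler_wpM2l; first by rewrite divr_ge0.
pose X S' : R := #|S :&: S'|%SET%:R - k%:R ^+ 2 / n%:R.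
apply: (@le_trans _ _ (ES (fun S' => n%:R * (r / 2 + (2 * r)^-1 * X S' ^+ 2) + 2 * n%:R))).
  apply: ler_sum => S' _; rewrite /subset_weight.
  case: eqP => S'k; last by rewrite !mul0r.
  apply: ler_wpM2l; first by rewrite divr_ge0.
  rewrite sum_edge_devM//.
  (* This takes the place of Cauchy-Schwarz: a variance at most r^2 then gives first absolute moment
     at most [r]. *)
  have amgm : `|X S'| <= r / 2 + (2 * r)^-1 * X S' ^+ 2.
    rewrite -[X S' ^+ 2]real_normK ?num_real//; set y := `|_|.
    rewrite -subr_ge0 (_ : _ - _ = (y - r) ^+ 2 / (2 * r)); last by field; rewrite gt_eqF.
    by rewrite divr_ge0 ?sqr_ge0// mulr_ge0// ltW.
  have m0 : 0 <= #|S :&: S'|%SET%:R :> R by [].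
  have mn : #|S :&: S'|%SET%:R <= n%:R :> R.
    by rewrite ler_nat -[leqRHS](card_ord n) max_card.
  have m_n0 : 0 <= n%:R * (r / 2 + (2 * r)^-1 * X S' ^+ 2 - `|X S'|).
    by rewrite mulr_ge0// ?subr_ge0// ltW.
  apply: (@le_trans _ _ (n%:R * `|X S'| + 2 * n%:R)); last by lra.
  rewrite natr_bin2 /K /N !natr_bin2.
  move: mn m0 n_gt0 k_le_n k_ge2; rewrite /X.
  set c := #|_|%:R; set m := n%:R; set l := k%:R => cm c0 m0 lm l2.
  set q := l ^+ 2 / m.
  have q0 : 0 <= q by rewrite divr_ge0 ?sqr_ge0// ltW.
  have qm : q <= m by rewrite ler_pdivrMr//; nra.
  (* The main term (c^2 - q^2)/2 is linear in the deviation c - q; each of the other two terms is at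
     most n in size. *)
  rewrite (_ : _ - _ = (c - q) * ((c + q) / 2) - c / 2 +
     l ^+ 2 * (2 * l * m - m - l ^+ 2) / (2 * (m ^+ 2 * (m - 1)))); last first.
    by rewrite /q; field; rewrite !gt_eqF//; lra.
  set Z := l ^+ 2 * _ / _.
  have m1 : 0 < m - 1 by lra.
  have m2 : 0 < m ^+ 2 * (m - 1) by rewrite mulr_gt0 ?exprn_gt0.
  have m22 : 0 < 2 * (m ^+ 2 * (m - 1)) by lra.
  have Z0 : 0 <= Z.
    apply: divr_ge0; last exact: ltW.
    by apply: mulr_ge0; [exact: sqr_ge0|nra].
  have Zm : Z <= m.
    rewrite ler_pdivrMr//.
    apply: (@le_trans _ _ (l ^+ 2 * (m * (m - 1)))).
      by apply: ler_wpM2l; [exact: sqr_ge0|have := sqr_ge0 (m - l); nra].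
    apply: (@le_trans _ _ (m ^+ 2 * (m * (m - 1)))).
      apply: ler_wpM2r; first by rewrite mulr_ge0// ltW.
      by rewrite lerXn2r ?nnegrE//; lra.
    have : 0 <= m * (m ^+ 2 * (m - 1)) by rewrite mulr_ge0// ltW.
    lra.
  have h : `|(c - q) * ((c + q) / 2)| <= m * `|c - q|.
    rewrite normrM mulrC ler_wpM2r// ger0_norm ?divr_ge0//; lra.
  have := ler_norm ((c - q) * ((c + q) / 2)).
  have := ler_norm (- ((c - q) * ((c + q) / 2))).
  by rewrite normrN ler_norml; lra.
rewrite expectD expectZ expectD (expectZ _ (2 * r)^-1) !EScst.
have := expect_card_setI_var Sk; rewrite -/X => h.
rewrite lerD2r; apply: ler_wpM2l; first exact: ltW.
have : (2 * r)^-1 * ES (fun S' => X S' ^+ 2) <= (2 * r)^-1 * r ^+ 2.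
  by rewrite ler_wpM2l ?rn// invr_ge0 mulr_ge0// ltW.
by rewrite (_ : (2 * r)^-1 * r ^+ 2 = r / 2); [lra|field; rewrite gt_eqF].
Qed.

(** Given [S], the set S' is determined by the two differences S \ S' and S' \ S, each with at most
    [r] elements. *)
Lemma card_subset_near S (r : nat) : #|S| = k ->
  (#|[set S' : {set V} | (#|S'| == k) && (k - #|S :&: S'|%SET <= r)%N]%SET|
    <= n.+1 ^ (2 * r))%N.
Proof.
move=> Sk; set A := [set S' | _]%SET.
pose B := [set C : {set V} | (#|C| <= r)%N]%SET.
have : (A \subset [set (S :\: c.1 :|: c.2)%SET | c in finset.setX B B])%SET.
  apply/fintype.subsetP => S'; rewrite inE => /andP[/eqP S'k h].
  apply/imsetP; exists (S :\: S', S' :\: S)%SET.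
    rewrite !inE /= !cardsD Sk S'k h finset.setIC h//.
  by apply/setP => x; rewrite !inE; case: (x \in S); case: (x \in S').
move=> /subset_leq_card/leq_trans; apply; apply: leq_trans (leq_imset_card _ _) _.
have := card_small_sets V r; rewrite -/B card_ord => h.
by rewrite cardsX mul2n -addnn expnD leq_mul.
Qed.

Lemma expect_near_subset S (r : nat) : #|S| = k ->
  ES (fun S' => (k - #|S :&: S'|%SET <= r)%N%:R) <= n.+1%:R ^+ (2 * r) / 'C(n, k)%:R.
Proof.
move=> Sk; have := card_subset_near r Sk; rewrite -(ler_nat R) natrX => h.
apply: le_trans (ler_wpM2r _ h); last by rewrite invr_ge0.
rewrite -sum1_card natr_sum mulr_suml [leRHS]big_mkcond; apply: ler_sum => S' _.
rewrite inE /subset_weight; case: eqP => _ /=; last by rewrite !mul0r.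
by case: leqP; rewrite ?mulr1 ?mulr0.
Qed.

(** The centring cancels in the difference, so a pair contributes 1 - cos t when it lies in exactly
    one of [S] and S', and nothing otherwise. *)
Lemma sum_edge_dev_dist (q t : R) S S' : #|S| = k -> #|S'| = k ->
  \sum_(e : {set V}) (if #|e| == 2%N then q else 0) *
     (1 - (if #|e| == 2%N then q else 0)) *
     (1 - cos (t * (edge_dev e S - edge_dev e S'))) =
  q * (1 - q) * (1 - cos t) * (2 * (K - 'C(#|S :&: S'|%SET, 2)%:R)).
Proof.
move=> Sk S'k; have h (A : {set V}) : #|A| = k -> \sum_(e : {set V} | #|e| == 2%N) (e \subset A)%:R = K :> R.
  move=> Ak; have eK := sum_pairs_subset A A; rewrite finset.setIid Ak in eK.
  rewrite /K -eK.
  by apply: eq_bigr => e _; case: (_ \subset _); rewrite ?mulr0 ?mulr1.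
rewrite -sum_pairs_subset.
transitivity (\sum_(e : {set V} | #|e| == 2%N) q * (1 - q) * (1 - cos t) *
   ((e \subset S)%:R + (e \subset S')%:R - 2 * ((e \subset S)%:R * (e \subset S')%:R))).
  rewrite [RHS]big_mkcond; apply: eq_bigr => e _; rewrite /edge_dev.
  case: eqP => _; rewrite ?mul0r// !mul1r opprD opprK addrACA addNr addr0.
  case: (e \subset S); case: (e \subset S');
    rewrite /= ?subrr ?subr0 ?sub0r ?mulr0 ?mulr1 ?mulrN1 ?cosN ?cos0; ring.
rewrite -mulr_sumr sumrB big_split /= !h// -mulr_sumr; ring.
Qed.

(** Split according to the distance of S' from [S]: near sets are bounded by 1 and counted, far sets
    differ from [S] in many pairs. *)
Lemma expect_exp_edge_dist_le (q t : R) (r : nat) : 0 <= q <= 1 ->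
  ES (fun S => ES (fun S' => expR (- \sum_(e : {set V})
     (if #|e| == 2%N then q else 0) * (1 - (if #|e| == 2%N then q else 0)) *
     (1 - cos (t * (edge_dev e S - edge_dev e S')))))) <=
  n.+1%:R ^+ (2 * r) / 'C(n, k)%:R +
  expR (- (q * (1 - q) * (1 - cos t) * (r%:R * (k%:R - 1)))).
Proof.
move=> q01; set X := expR (- (_ * _)).
have X0 : 0 <= X by exact: expR_ge0.
have pos : 0 <= n.+1%:R ^+ (2 * r) / 'C(n, k)%:R + X :> R.
  by rewrite addr_ge0// divr_ge0// exprn_ge0.
rewrite -[leRHS]EScst; apply: ler_sum => S _; rewrite {1 3}/subset_weight.
case: eqP => Sk; last by rewrite !mul0r.
apply: ler_wpM2l; first by rewrite divr_ge0.
apply: (@le_trans _ _ (ES (fun S' => (k - #|S :&: S'|%SET <= r)%N%:R + X))); last first.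
  by rewrite expectD EScst lerD2r; exact: expect_near_subset.
apply: ler_sum => S' _; rewrite /subset_weight.
case: eqP => S'k; last by rewrite !mul0r.
apply: ler_wpM2l; first by rewrite divr_ge0.
rewrite sum_edge_dev_dist//.
have mk : (#|S :&: S'|%SET <= k)%N by rewrite -Sk subset_leq_card// finset.subsetIl.
have cc : 0 <= q * (1 - q) * (1 - cos t) by rewrite !mulr_ge0//; lra.
(* With c the size of the intersection, the right-hand side is (k - c)(k + c - 1). *)
have d0 : (k%:R - #|S :&: S'|%SET%:R) * (k%:R - 1) <= 2 * (K - 'C(#|S :&: S'|%SET, 2)%:R).
  rewrite /K !natr_bin2; have : #|S :&: S'|%SET%:R <= k%:R :> R by rewrite ler_nat.
  have : 0 <= #|S :&: S'|%SET%:R :> R by [].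
  nra.
case: leqP => h.
  rewrite -[leLHS]addr0 lerD// -[leRHS](@expR0 R) ler_expR oppr_le0 mulr_ge0//.
  have a1 : 0 <= k%:R - #|S :&: S'|%SET%:R :> R by rewrite subr_ge0 ler_nat.
  have a2 : 0 <= k%:R - 1 :> R by have := k_ge2; lra.
  exact: le_trans (mulr_ge0 a1 a2) d0.
rewrite add0r ler_expR lerN2; apply: ler_wpM2l => //; apply: le_trans d0.
apply: ler_wpM2r; first by have := k_ge2; lra.
by rewrite -natrB// ler_nat ltnW.
Qed.

End UniformSubset.

(** * The mode of the binomial distribution *)

Lemma natr_binS (R : realType) (m j : nat) :
  'C(m, j.+1)%:R * j.+1%:R = 'C(m, j)%:R * (m%:R - j%:R) :> R.
Proof.
have [jm|mj] := leqP j m; last by rewrite !bin_small ?mul0r//; lia.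
rewrite -natrB// -!natrM; congr _%:R.
by rewrite mulnC mul_bin_left mulnC.
Qed.

Section BinomialMode.
Variables (R : realType) (N M : nat).
Hypotheses (M0 : (0 < M)%N) (MN : (M < N)%N).
Let q : R := M%:R / N%:R.
Let f j : R := 'C(N, j)%:R * (q ^+ j * (1 - q) ^+ (N - j)).

Let N0 : 0 < N%:R :> R. Proof. by rewrite ltr0n; lia. Qed.
Let q0 : 0 < q. Proof. by rewrite divr_gt0// ltr0n. Qed.
Let q1 : 0 < 1 - q.
Proof. by rewrite subr_gt0 ltr_pdivrMr// mul1r ltr_nat. Qed.

Let f_step j : (j < N)%N ->
  f j.+1 * (j.+1%:R * (1 - q)) = f j * ((N%:R - j%:R) * q).
Proof.
move=> jN; have e : (N - j = (N - j.+1).+1)%N by lia.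
rewrite /f e; have := natr_binS R N j; set C1 := 'C(N, j.+1)%:R; set C0 := 'C(N, j)%:R.
move=> h; rewrite !exprS.
transitivity ((C1 * j.+1%:R) * (q * q ^+ j * ((1 - q) * (1 - q) ^+ (N - j.+1)))); first by ring.
by rewrite h; ring.
Qed.

Let f_ge0 j : 0 <= f j.
Proof. by rewrite mulr_ge0// mulr_ge0// exprn_ge0// ltW. Qed.

Let up j : (j < M)%N -> f j <= f j.+1.
Proof.
move=> jM; have jN : (j < N)%N by lia.
have a0 : 0 < j.+1%:R * (1 - q) by rewrite mulr_gt0.
rewrite -(ler_pM2r a0) f_step// ler_wpM2l// /q -subr_ge0.
have -> : (N%:R - j%:R) * (M%:R / N%:R) - j.+1%:R * (1 - M%:R / N%:R) =
  (N%:R * (M%:R - j.+1%:R) + M%:R) / N%:R :> R.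
  by rewrite -natr1; field; rewrite gt_eqF.
have : j.+1%:R <= M%:R :> R by rewrite ler_nat.
move=> h; apply: divr_ge0; last exact: ltW.
by apply: addr_ge0 => //; apply: mulr_ge0; [exact: ltW|lra].
Qed.

Let down j : (M <= j)%N -> (j < N)%N -> f j.+1 <= f j.
Proof.
move=> Mj jN.
have a0 : 0 < j.+1%:R * (1 - q) by rewrite mulr_gt0.
rewrite -(ler_pM2r a0) f_step// ler_wpM2l// /q -subr_ge0.
have -> : j.+1%:R * (1 - M%:R / N%:R) - (N%:R - j%:R) * (M%:R / N%:R) =
  (N%:R * (j%:R - M%:R) + (N%:R - M%:R)) / N%:R :> R.
  by rewrite -natr1; field; rewrite gt_eqF.
have h : M%:R <= j%:R :> R by rewrite ler_nat.
have h' : M%:R <= N%:R :> R by rewrite ler_nat ltnW.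
apply: divr_ge0; last exact: ltW.
by apply: addr_ge0; [apply: mulr_ge0; [exact: ltW|lra]|lra].
Qed.

(** Since the mean N q equals M, the quotients f(j+1)/f(j) pass from at least 1 to at most 1 at j =
    M. *)
Lemma binomial_mode j : (j <= N)%N -> f j <= f M.
Proof.
move=> jN; have [jM|Mj] := leqP j M.
  have H d : (d <= M)%N -> f (M - d)%N <= f M.
    elim: d => [|d IH] dM; first by rewrite subn0.
    apply: le_trans (up _) _; first by lia.
    by rewrite (_ : (M - d.+1).+1 = M - d)%N ?IH//; lia.
  by have := H (M - j)%N; rewrite subKn// => ->//; exact: leq_subr.
have H d : (M + d <= N)%N -> f (M + d)%N <= f M.
  elim: d => [|d IH] dN; first by rewrite addn0.
  by rewrite addnS; apply: le_trans (down _ _) (IH _); lia.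
by have := H (j - M)%N; rewrite subnKC ?(ltnW Mj)// => ->.
Qed.

(** N + 1 probabilities sum to 1, so the largest is at least their average. *)
Lemma binomial_mode_ge : 1 <= N.+1%:R * f M.
Proof.
have sum1 : \sum_(j < N.+1) f j = 1.
  have e : 1 = ((1 - q) + q) ^+ N by rewrite subrK expr1n.
  rewrite [RHS]e exprDn.
  by apply: eq_bigr => j _; rewrite /f mulr_natl [q ^+ _ * _]mulrC.
rewrite -[leLHS]sum1 mulr_natl -[X in _ *+ X]card_ord -sumr_const; apply: ler_sum => j _.
by apply: binomial_mode; rewrite -ltnS.
Qed.

End BinomialMode.

(** * Graphs with M edges inside the product space *)

Section GraphCounting.
Variables (R : realType) (n M : nat).
Local Notation E := [set e : {set 'I_n} | #|e| == 2%N]%SET.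
Local Notation N := 'C(n, 2).

Lemma card_pairs : #|E| = N.
Proof. by have := card_draws 'I_n 2; rewrite card_ord. Qed.

Lemma mem_graphs_with_edges G :
  (G \in graphs_with_edges n M) = (G \subset E) && (#|G| == M).
Proof.
rewrite inE; congr (_ && _).
apply/forallP/fintype.subsetP => [h e eG|h e].
  by rewrite inE; have := h e; rewrite eG.
by apply/implyP => /h; rewrite inE.
Qed.

Lemma card_graphs_with_edges : #|graphs_with_edges n M| = 'C(N, M).
Proof.
rewrite -card_pairs -cards_draws; apply: eq_card => G.
by rewrite mem_graphs_with_edges inE.
Qed.

(** The ground set of the product measure is the type of all vertex sets; probability 0 off the
    pairs makes it a model of G(n, q). *)
Definition pair_prob (q : R) (e : {set 'I_n}) : R := if #|e| == 2%N then q else 0.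

Lemma pair_prob01 q : 0 <= q <= 1 -> forall e, 0 <= pair_prob q e <= 1.
Proof. by move=> q01 e; rewrite /pair_prob; case: eqP => // _; rewrite lexx ler01. Qed.

Lemma bernoulli_weight_pair_prob q G : G \in graphs_with_edges n M ->
  bernoulli_weight (pair_prob q) G = q ^+ M * (1 - q) ^+ (N - M).
Proof.
rewrite mem_graphs_with_edges => /andP[GE /eqP GM].
rewrite /bernoulli_weight (bigID (mem G)) /=.
rewrite (eq_bigr (fun=> q)); last first.
  by move=> e eG; rewrite eG /pair_prob; have := fintype.subsetP GE e eG; rewrite inE => ->.
rewrite prodr_const GM; congr (_ * _).
rewrite (bigID (mem E)) /= [X in _ * X]big1 ?mulr1; last first.
  by move=> e /andP[/negbTE -> ]; rewrite inE /pair_prob => /negbTE ->; rewrite subr0.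
rewrite (eq_bigr (fun=> 1 - q)); last first.
  by move=> e /andP[/negbTE ->]; rewrite inE /pair_prob => ->.
rewrite prodr_const; congr (_ ^+ _).
have -> : #|(fun i => (i \notin G) && (i \in E))| = #|(E :\: G)%SET|.
  by apply: eq_card => e; rewrite !inE; rewrite unfold_in inE.
by rewrite cardsD (finset.setIidPr GE) card_pairs GM.
Qed.

(** All graphs with M edges have the same weight, and together they carry the binomial probability
    of M, which is at least 1/(N + 1). *)
Lemma uniform_le_bernoulli (B : pred {set {set 'I_n}}) :
  (0 < M)%N -> (M < N)%N ->
  #|[set G in graphs_with_edges n M | B G]%SET|%:R / #|graphs_with_edges n M|%:R <=
  N.+1%:R * expect (bernoulli_weight (pair_prob (M%:R / N%:R))) (fun G => (B G)%:R) :> R.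
Proof.
move=> M0 MN; set q := M%:R / N%:R; set A := graphs_with_edges n M.
have N0 : 0 < N%:R :> R by rewrite ltr0n; lia.
have q01 : 0 <= q <= 1.
  by rewrite divr_ge0//= ler_pdivrMr// mul1r ler_nat ltnW.
have A0 : 0 < #|A|%:R :> R by rewrite card_graphs_with_edges ltr0n bin_gt0 ltnW.
have := binomial_mode_ge R M0 MN; rewrite -/q -card_graphs_with_edges -/A => h.
rewrite ler_pdivrMr//.
apply: (@le_trans _ _ (N.+1%:R * (#|[set G in A | B G]%SET|%:R * (q ^+ M * (1 - q) ^+ (N - M))) * #|A|%:R)).
  have := ler_wpM2l (ler0n R #|[set G in A | B G]%SET|) h; lra.
rewrite ler_wpM2r// ler_wpM2l// -sum1_card natr_sum mulr_suml big_mkcond.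
apply: ler_sum => G _; rewrite inE.
have w0 : 0 <= bernoulli_weight (pair_prob q) G by apply: bernoulli_weight_ge0; exact: pair_prob01.
case: (boolP (G \in A)) => GA /=; last by rewrite mulr_ge0.
case: (B G); last by rewrite mulr0.
by rewrite mul1r mulr1 bernoulli_weight_pair_prob.
Qed.

Lemma card_subsets_by_intersection (T : finType) (U A : {set T}) (m z : nat) :
  A \subset U -> (z <= m)%N ->
  #|[set G : {set T} | [&& G \subset U, #|G| == m & #|G :&: A|%SET == z]]%SET| =
  ('C(#|A|, z) * 'C(#|U| - #|A|, m - z))%N.
Proof.
move=> AU zm; have <- : #|(U :\: A)%SET| = (#|U| - #|A|)%N by rewrite cardsD (finset.setIidPr AU).
rewrite -!cards_draws -cardsX.
rewrite -[RHS](card_in_imset (f := fun c => c.1 :|: c.2)%SET).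
  apply: eq_card => G; rewrite inE; apply/and3P/imsetP => [[GU /eqP Gm /eqP Gz]|[[B C]]].
    exists (G :&: A, G :\: A)%SET; last by rewrite /= finset.setID.
    rewrite !inE /= finset.subsetIr Gz eqxx finset.setSD//=.
    by rewrite cardsD Gm Gz.
  rewrite !inE /= => /andP[/andP[BA /eqP Bz] /andP[CU /eqP Cm]] ->.
  have BC : (B :&: C)%SET = finset.set0.
    apply/setP => x; have := fintype.subsetP BA x; have := fintype.subsetP CU x; rewrite !inE.
    case: (x \in B); case: (x \in C) => //= h1 h2.
    by have := h1 isT; rewrite (h2 isT).
  split.
  - rewrite finset.subUset (fintype.subset_trans BA AU) /=.
    by apply: fintype.subset_trans CU (finset.subsetDl _ _).
  - by rewrite cardsU BC cards0 subn0 Bz Cm subnKC.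
  - rewrite (_ : ((B :|: C) :&: A)%SET = B) ?Bz//.
    apply/setP => x; have := fintype.subsetP BA x; have := fintype.subsetP CU x; rewrite !inE.
    case: (x \in B); case: (x \in C); case: (x \in A) => //= h1 h2; first by have := h2 isT.
    + by have := h2 isT.
    + by have := h1 isT.
have H (b b' c c' a : bool) : (b -> a) -> (b' -> a) -> (c -> ~~ a) -> (c' -> ~~ a) ->
   b || c = b' || c' -> b = b' /\ c = c'.
  by case: a; case: b; case: b'; case: c; case: c' => //= h1 h2 h3 h4 h5; split => //;
    move: (h1) (h2) (h3) (h4) => //; do ?[by move/(_ isT)]; intuition.
move=> [B C] [B' C']; rewrite !inE /= => /andP[/andP[BA _] /andP[CU _]].
move=> /andP[/andP[BA' _] /andP[CU' _]] /setP e.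
have h x : (x \in B) = (x \in B') /\ (x \in C) = (x \in C').
  apply: (H _ _ _ _ (x \in A)).
  - exact: fintype.subsetP BA x.
  - exact: fintype.subsetP BA' x.
  - by move=> xC; have := fintype.subsetP CU x xC; rewrite inE => /andP[].
  - by move=> xC; have := fintype.subsetP CU' x xC; rewrite inE => /andP[].
  - by have := e x; rewrite !inE.
by congr (_, _); apply/setP => x; case: (h x).
Qed.

End GraphCounting.

(** * Fourier inversion on integers modulo 2N + 1 *)

Section FourierInversion.
Variable R : realType.

Lemma sin_natpi (m : nat) : sin (m%:R * pi) = 0 :> R.
Proof.
elim: m => [|m IH]; first by rewrite mul0r sin0.
by rewrite -natr1 mulrDl mul1r sinDpi IH oppr0.
Qed.

Lemma dirichlet_kernel (x : R) (J : nat) :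
  sin (x / 2) * (1 + 2 * \sum_(j < J) cos (j.+1%:R * x)) = sin (J%:R * x + x / 2).
Proof.
elim: J => [|J IH]; first by rewrite big_ord0 mul0r add0r mulr0 addr0 mulr1.
rewrite big_ord_recr /= [2 * _]mulrDr addrA mulrDr IH.
rewrite (_ : J%:R * x + x / 2 = J.+1%:R * x - x / 2); last first.
  by rewrite -natr1; field.
by rewrite sinB sinD; ring.
Qed.

(** An odd modulus has nonzero residues that pair up under sign, so a sum of cosines over half of
    them is enough and only frequencies in [0, pi] occur. *)
Definition frequency (N j : nat) : R := 2 * pi * j.+1%:R / N.*2.+1%:R.

Lemma frequency_itv (N j : nat) : (j < N)%N -> 0 <= frequency N j <= pi.
Proof.
move=> jN; have p0 := pi_gt0 R; rewrite /frequency; apply/andP; split.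
  by rewrite divr_ge0// mulr_ge0// mulr_ge0// ltW.
rewrite ler_pdivrMr ?ltr0n// mulrAC mulrC; apply: ler_wpM2l; first exact: ltW.
by rewrite -natrM ler_nat; lia.
Qed.

(** At x = 2 pi (a - z) / (2N + 1) the Dirichlet kernel has numerator sin(pi (a - z)) = 0, while
    sin(x/2) is nonzero because 0 < |a - z| < 2N + 1. *)
Lemma fourier_indicator (N a z : nat) : (a <= N)%N -> (z <= N)%N ->
  (a == z)%:R = N.*2.+1%:R^-1 *
    (1 + 2 * \sum_(j < N) cos (frequency N j * (a%:R - z%:R))) :> R.
Proof.
move=> aN zN; set L : R := N.*2.+1%:R.
have LE : L = 2 * N%:R + 1 by rewrite /L -[X in X%:R]addn1 natrD -mul2n natrM.
have p0 := pi_gt0 R.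
have [<-|az] := eqVneq a z.
  rewrite subrr; under eq_bigr do rewrite mulr0 cos0.
  rewrite sumr_const card_ord (_ : 1 + _ = L) ?mulVf ?gt_eqF//.
  by rewrite LE addrC mulr_natr.
pose x : R := 2 * pi * (a%:R - z%:R) / L.
have := dirichlet_kernel x N.
have -> : N%:R * x + x / 2 = a%:R * pi - z%:R * pi.
  rewrite /x LE; field; rewrite -LE gt_eqF//.
rewrite sinB !sin_natpi mul0r mulr0 subrr => /eqP.
rewrite mulf_eq0 => /orP[|/eqP h]; last first.
  rewrite (eq_bigr (fun j : 'I_N => cos (j.+1%:R * x))) ?h ?mulr0//.
  by move=> j _; congr cos; rewrite /frequency /x; ring.
have x2 : x / 2 = pi * (a%:R - z%:R) / L by rewrite /x; field; rewrite gt_eqF.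
have ltL (c : nat) : (c <= N)%N -> c%:R < L :> R by move=> cN; rewrite ltr_nat; lia.
have pos (c d : nat) : (d < c)%N -> (c <= N)%N -> 0 < sin (pi * (c%:R - d%:R) / L).
  move=> dc cN; apply: sin_gt0_pi.
  have d0 : 0 < c%:R - d%:R :> R by rewrite subr_gt0 ltr_nat.
  rewrite divr_gt0 ?mulr_gt0//= ltr_pdivrMr// ltr_pM2l//.
  by apply: le_lt_trans (ltL c cN); rewrite lerBlDr lerDl.
rewrite x2; move: az; rewrite neq_ltn => /orP[za|az].
  by have := pos _ _ za zN; rewrite -[a%:R - z%:R]opprB mulrN mulNr sinN oppr_eq0 => /gt_eqF ->.
by have := pos _ _ az aN => /gt_eqF ->.
Qed.

End FourierInversion.

(** * Normal density: its sum over integers against its integral *)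

Section GaussianRiemannSum.
Variables (R : realType) (m s W : R) (lo hi : nat).
Hypothesis s0 : 0 < s.
Hypothesis W0 : 0 <= W.
Hypothesis window : forall z, (lo <= z <= hi)%N -> `|z%:R - m| <= W + 1.
Hypothesis lo_le : lo%:R <= m - W.
Hypothesis hi_ge : m + W < hi.+1%:R.
Let f (x : R) : R := normal_pdf m s x.
(** A bound for the change of the logarithm of the density over one unit cell of the window: (x -
    m)^2 - (z - m)^2 is at most 1 times (W + 2) + (W + 1). *)
Let theta : R := (2 * W + 3) / (2 * s ^+ 2).
Let s' : R := Num.sqrt 2 * s.
Let tail : R := Num.sqrt 2 * expR (- (W ^+ 2 / (4 * s ^+ 2))).

Let s2 : 0 < s ^+ 2. Proof. exact: exprn_gt0. Qed.
Let sne : s != 0. Proof. by rewrite gt_eqF. Qed.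
Let s'0 : 0 < s'. Proof. by rewrite mulr_gt0// sqrtr_gt0. Qed.

Let fE x : f x = normal_peak s * expR (- (x - m) ^+ 2 / (2 * s ^+ 2)).
Proof. by rewrite /f (normal_pdfE _ sne) /normal_fun -[s ^+ 2 *+ 2]mulr_natl. Qed.

Let peak0 : 0 <= normal_peak s.
Proof. by rewrite invr_ge0 sqrtr_ge0. Qed.

Let f0 x : 0 <= f x. Proof. exact: normal_pdf_ge0. Qed.

Let f_cell (z : nat) x : (lo <= z <= hi)%N -> z%:R <= x < z.+1%:R ->
  expR (- theta) * f z%:R <= f x <= expR theta * f z%:R.
Proof.
move=> zw; rewrite -[z.+1%:R]natr1 => /andP[zx xz].
have := window zw; rewrite ler_norml => /andP[h1 h2].
have H : `|(x - m) ^+ 2 - (z%:R - m) ^+ 2| <= 2 * W + 3.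
  rewrite (_ : _ - _ = (x - z%:R) * ((x - m) + (z%:R - m))); last by ring.
  rewrite normrM; apply: (@le_trans _ _ (1 * (2 * W + 3))); last by rewrite mul1r.
  by apply: ler_pM; rewrite ?normr_ge0// ler_norml; lra.
have e : `|- (x - m) ^+ 2 / (2 * s ^+ 2) - - (z%:R - m) ^+ 2 / (2 * s ^+ 2)| <= theta.
  have i0 : 0 < (2 * s ^+ 2)^-1 by rewrite invr_gt0 mulr_gt0.
  rewrite -mulrBl normrM [`|_^-1|]gtr0_norm// /theta ler_wpM2r ?(ltW i0)//.
  by rewrite -normrN; move: H; congr (`|_| <= _); ring.
move: e; rewrite ler_norml => /andP[e1 e2].
rewrite !fE; set A := - (x - m) ^+ 2 / _ in e1 e2 *; set B := - _ / _ in e1 e2 *.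
have l1 : expR (- theta) * expR B <= expR A by rewrite -expRD ler_expR; lra.
have l2 : expR A <= expR theta * expR B by rewrite -expRD ler_expR; lra.
by apply/andP; split; have := ler_wpM2l peak0 l1; have := ler_wpM2l peak0 l2; lra.
Qed.

(** Half of the exponent is spent on the factor [tail]; the other half is the normal density with
    doubled variance. As that density integrates to 1, no Gaussian tail integral has to be
    estimated. *)
Let f_tail x : ~~ (lo%:R <= x < hi.+1%:R) -> f x <= tail * normal_pdf m s' x.
Proof.
move=> out; have H : W ^+ 2 <= (x - m) ^+ 2.
  move: out; rewrite negb_and -ltNge -leNgt => /orP[h|h].
    by rewrite -[leRHS]sqrrN; apply: lerXn2r; rewrite ?nnegrE; have := W0; have := lo_le; lra.
  by apply: lerXn2r; rewrite ?nnegrE; have := W0; have := hi_ge; lra.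
have s'ne : s' != 0 by rewrite gt_eqF.
rewrite (normal_pdfE _ s'ne) /normal_fun fE /tail.
have s'2 : s' ^+ 2 = 2 * s ^+ 2 by rewrite exprMn sqr_sqrtr.
have -> : normal_peak s' = (Num.sqrt 2)^-1 * normal_peak s.
  rewrite /normal_peak s'2 -invfM -sqrtrM//; congr ((Num.sqrt _)^-1).
  by ring.
have P0 := peak0; set P := normal_peak s in P0 *; set r := Num.sqrt 2.
have r0 : r != 0 by rewrite gt_eqF// sqrtr_gt0.
rewrite (_ : r * _ * _ = P * (expR (- (W ^+ 2 / (4 * s ^+ 2))) *
  expR (- (x - m) ^+ 2 / (s' ^+ 2 *+ 2)))); last by field.
rewrite ler_wpM2l// -expRD ler_expR s'2.
rewrite [leRHS](_ : _ = - (x - m) ^+ 2 / (2 * s ^+ 2) + ((x - m) ^+ 2 - W ^+ 2) / (4 * s ^+ 2)); last first.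
  by field.
by rewrite lerDl divr_ge0 ?subr_ge0// mulr_ge0// ltW.
Qed.

Let cell (z : nat) : set R := [set` `[z%:R, z.+1%:R[].

Let cellP z x : reflect (z%:R <= x < z.+1%:R) (x \in cell z).
Proof. by apply: (iffP idP); rewrite inE /cell/= in_itv. Qed.

Let cell_measure z : lebesgue_measure (cell z) = 1%E.
Proof.
rewrite /cell lebesgue_measure_itv /= lte_fin ltr_nat ltnSn.
by rewrite -EFinB -natr1 addrAC subrr add0r.
Qed.

Let measurable_cell z : measurable (cell z).
Proof. exact: measurable_itv. Qed.

Let cell_trunc (z : nat) (x : R) : z%:R <= x < z.+1%:R -> Num.truncn x = z.
Proof. exact: truncn_def. Qed.

Let step_meas (c : nat -> R) (z : nat) : measurable_fun [set: R]
  (fun x : R => ((c z)%:E * (\1_(cell z) x)%:E)%E : \bar R).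
Proof. by apply: measurable_funeM; apply/measurable_EFinP; exact: measurable_indic. Qed.

Let integral_step (c : nat -> R) : (forall z, 0 <= c z) ->
  (\int[lebesgue_measure]_x (\sum_(z <- index_iota lo hi.+1)
     ((c z)%:E * (\1_(cell z) x)%:E)))%E =
  (\sum_(lo <= z < hi.+1) c z)%:E.
Proof.
move=> c0; rewrite ge0_integral_sum//; last 2 first.
- by move=> z; exact: step_meas.
- by move=> z x _; rewrite mule_ge0// lee_fin.
rewrite -sumEFin; apply: eq_bigr => z _.
rewrite ge0_integralZl_EFin//; last first.
  by apply/measurable_EFinP; apply: measurable_indic; exact: measurable_cell.
rewrite integral_indic//; last exact: measurable_cell.
by rewrite setIT -[RHS]mule1 -(cell_measure z).
Qed.

Let step_sum (c : nat -> R) (x : R) :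
  (\sum_(z <- index_iota lo hi.+1) ((c z)%:E * (\1_(cell z) x)%:E))%E =
  (if lo%:R <= x < hi.+1%:R then c (Num.truncn x) else 0)%:E.
Proof.
rewrite (eq_bigr (fun z => (c z * \1_(cell z) x)%:E)) ?sumEFin//; congr EFin.
have [/andP[lx xh]|out] := boolP (_ <= _ < _); last first.
  rewrite big1_seq// => z /andP[_]; rewrite mem_index_iota => /andP[lz zh].
  rewrite indicE; case: cellP => [/andP[zx xz]|_]; last by rewrite mulr0.
  case/negP: out; apply/andP; split.
    by apply: le_trans zx; rewrite ler_nat.
  by apply: lt_le_trans xz _; rewrite ler_nat.
have x0 : 0 <= x by apply: le_trans lx.
have /andP[tx xt] := truncn_itv x0.
have tin : Num.truncn x \in index_iota lo hi.+1.
  rewrite mem_index_iota; apply/andP; split.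
    by rewrite -ltnS -(ltr_nat R); apply: le_lt_trans xt.
  by rewrite -(ltr_nat R); apply: le_lt_trans xh.
rewrite (bigD1_seq (Num.truncn x)) ?iota_uniq//= big1_seq.
  rewrite indicE; case: cellP => [_|[]]; first by rewrite mulr1 addr0.
  exact/andP.
move=> z /andP[zt _]; rewrite indicE; case: cellP => [h|_]; last by rewrite mulr0.
by rewrite (cell_trunc h) eqxx in zt.
Qed.

Let trunc_window (x : R) : lo%:R <= x < hi.+1%:R ->
  (lo <= Num.truncn x <= hi)%N /\ (Num.truncn x)%:R <= x < (Num.truncn x).+1%:R.
Proof.
move=> /andP[lx xh]; have x0 : 0 <= x by apply: le_trans lx.
have /andP[tx xt] := truncn_itv x0; split; last by rewrite tx.
apply/andP; split.
  by rewrite -ltnS -(ltr_nat R); apply: le_lt_trans xt.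
by rewrite -ltnS -(ltr_nat R); apply: le_lt_trans xh.
Qed.

Let sum_measurable (c : nat -> R) : measurable_fun [set: R] (fun x : R =>
  (\sum_(z <- index_iota lo hi.+1) ((c z)%:E * (\1_(cell z) x)%:E))%E : \bar R).
Proof. by apply: emeasurable_sum => z; exact: step_meas. Qed.

(** Integrate the pointwise majorant of the density: a step function on the window, plus [tail]
    times the wider density. *)
Lemma normal_pdf_sum_ge :
  1 <= expR theta * (\sum_(lo <= z < hi.+1) normal_pdf m s z%:R) + tail.
Proof.
have c0 z : 0 <= expR theta * f z%:R by rewrite mulr_ge0// expR_ge0.
have t0 : 0 <= tail by rewrite mulr_ge0// ?sqrtr_ge0// expR_ge0.
rewrite -lee_fin -(integral_normal_pdf m s) mulr_sumr EFinD -(integral_step c0).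
rewrite -[X in (_ + X)%E]mule1 -(integral_normal_pdf m s') -ge0_integralZl_EFin//; last 2 first.
- by move=> x _; rewrite lee_fin normal_pdf_ge0.
- by apply/measurable_EFinP; exact: measurable_normal_pdf.
rewrite -ge0_integralD//; last 4 first.
- by move=> x _; rewrite sume_ge0// => z _; rewrite mule_ge0// lee_fin.
- exact: sum_measurable.
- by move=> x _; rewrite mule_ge0// lee_fin// normal_pdf_ge0.
- by apply: measurable_funeM; apply/measurable_EFinP; exact: measurable_normal_pdf.
apply: ge0_le_integral => //.
- by move=> x _; rewrite lee_fin normal_pdf_ge0.
- by apply/measurable_EFinP; exact: measurable_normal_pdf.
- apply: emeasurable_funD; first exact: sum_measurable.
  by apply: measurable_funeM; apply/measurable_EFinP; exact: measurable_normal_pdf.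
- move=> x _; rewrite step_sum -EFinM -EFinD lee_fin.
  have n0 : 0 <= tail * normal_pdf m s' x by rewrite mulr_ge0// normal_pdf_ge0.
  case: ifPn => [/trunc_window[h1 h2]|/f_tail]; last by rewrite add0r.
  have /andP[_ h] := f_cell h1 h2.
  by apply: le_trans h _; rewrite lerDl.
Qed.

Lemma normal_pdf_sum_le :
  expR (- theta) * (\sum_(lo <= z < hi.+1) normal_pdf m s z%:R) <= 1.
Proof.
have c0 z : 0 <= expR (- theta) * f z%:R by rewrite mulr_ge0// expR_ge0.
rewrite -lee_fin -(integral_normal_pdf m s) mulr_sumr -(integral_step c0).
apply: ge0_le_integral => //.
- by move=> x _; rewrite sume_ge0// => z _; rewrite mule_ge0// lee_fin.
- exact: sum_measurable.
- by apply/measurable_EFinP; exact: measurable_normal_pdf.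
- move=> x _; rewrite step_sum lee_fin.
  case: ifPn => [/trunc_window[h1 h2]|_]; last exact: normal_pdf_ge0.
  by have /andP[h _] := f_cell h1 h2.
Qed.

End GaussianRiemannSum.

(** * Quotient of consecutive probabilities against its Gaussian counterpart *)

Section RatioEstimate.
Variable R : realType.
Implicit Types x y : R.

(** Use exp(2y^2 - y) >= 1 + 2y^2 - y together with (1 + 2y^2 - y)(1 + y) = 1 + y^2 (1 + 2y) >=
    1. *)
Lemma expR_sub_sqr_le y : `|y| <= 2^-1 -> expR (y - 2 * y ^+ 2) <= 1 + y.
Proof.
rewrite ler_norml => /andP[y1 y2].
have h := expR_ge1Dx (2 * y ^+ 2 - y).
have e : expR (y - 2 * y ^+ 2) * expR (2 * y ^+ 2 - y) = 1.
  by rewrite -expRD (_ : _ + _ = 0) ?expR0//; ring.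
have p0 : 0 <= 1 + (2 * y ^+ 2 - y) by have := sqr_ge0 y; nra.
have h2 : expR (y - 2 * y ^+ 2) * (1 + (2 * y ^+ 2 - y)) <= 1.
  by rewrite -[leRHS]e ler_wpM2l.
have h3 : 1 <= (1 + (2 * y ^+ 2 - y)) * (1 + y).
  rewrite -subr_ge0 (_ : _ - _ = y ^+ 2 * (1 + 2 * y)); last by ring.
  by rewrite mulr_ge0 ?sqr_ge0//; lra.
have p1 : 0 <= 1 + y by lra.
apply: (@le_trans _ _ (expR (y - 2 * y ^+ 2) * ((1 + (2 * y ^+ 2 - y)) * (1 + y)))).
  by rewrite ler_peMr.
by rewrite mulrA -[leRHS]mul1r ler_wpM2r.
Qed.

Variables (a b c d m s Y : R).
Hypotheses (m0 : 0 < m) (ma : m <= a) (mb : m <= b) (mc : m <= c) (md : m <= d).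
Hypotheses (s0 : 0 < s) (Ym : 2 * Y <= m).
Hypothesis bcad : b * c = a * d.

(** Bounds the gap between the logarithm of (b - x)(c - x) / ((a + x + 1)(d + x + 1)) and the
    Gaussian step -(2x + 1)/(2 s^2). The terms are, in order: the mismatch of the coefficients of x,
    the quadratic error of two of the four logarithms, the shift by 1 in the denominator, and the
    constant part of the Gaussian step. *)
Definition ratio_error : R :=
  Y * `|a^-1 + b^-1 + c^-1 + d^-1 - (s ^+ 2)^-1| + 4 * (Y / m) ^+ 2 + 2 / m + (2 * s ^+ 2)^-1.

Let prodE (x : R) : (b - x) * (c - x) = (a * d) * ((1 + - (x / b)) * (1 + - (x / c))).
Proof.
have b0 : b != 0 by rewrite gt_eqF//; have := m0; have := mb; lra.
have c0 : c != 0 by rewrite gt_eqF//; have := m0; have := mc; lra.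
by rewrite -bcad; field; rewrite b0 c0.
Qed.

Let prodE' (x : R) : (a + x + 1) * (d + x + 1) =
  (a * d) * ((1 + (x + 1) / a) * (1 + (x + 1) / d)).
Proof.
have a0 : a != 0 by rewrite gt_eqF//; have := m0; have := ma; lra.
have d0 : d != 0 by rewrite gt_eqF//; have := m0; have := md; lra.
by field; rewrite a0 d0.
Qed.

Let small y e : `|y| <= Y -> m <= e -> `|y / e| <= 2^-1 /\ (y / e) ^+ 2 <= (Y / m) ^+ 2.
Proof.
move=> yY me; have mm := m0; have YY := Ym; have e0 : 0 < e by lra.
have h : `|y / e| <= Y / m.
  rewrite normrM [`|e^-1|]gtr0_norm ?invr_gt0//; apply: ler_pM => //.
    by rewrite invr_ge0 ltW.
  by rewrite lef_pV2.
split; last by rewrite -[leLHS]real_normK ?num_real// lerXn2r ?nnegrE//; apply: le_trans h.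
by apply: le_trans h _; rewrite ler_pdivrMr//; lra.
Qed.

Let main (x : R) : `|x| + 1 <= Y ->
  let L := - (x / b) - x / c - (x + 1) / a - (x + 1) / d in
  (b - x) * (c - x) <= expR (L + 4 * (Y / m) ^+ 2) * ((a + x + 1) * (d + x + 1)) /\
  expR (L - 4 * (Y / m) ^+ 2) * ((a + x + 1) * (d + x + 1)) <= (b - x) * (c - x).
Proof.
move=> xY L; have xY1 : `|x| <= Y by lra.
have xY2 : `|x + 1| <= Y by apply: le_trans (ler_normD _ _) _; rewrite normr1.
have xN : `|- x| <= Y by rewrite normrN.
have [b1 b2] := small xN mb; have [c1 c2] := small xN mc.
have [a1 a2] := small xY2 ma; have [d1 d2] := small xY2 md.
rewrite !mulNr in b1 b2 c1 c2.
have ad0 : 0 <= a * d.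
  by have := m0; have := ma; have := md => *; apply: mulr_ge0; lra.
have pos y : `|y| <= 2^-1 -> 0 <= 1 + y by rewrite ler_norml => /andP[]; lra.
rewrite prodE prodE'; split; [rewrite [leRHS]mulrCA|rewrite [leLHS]mulrCA];
  apply: ler_wpM2l => //.
- have u1 := expR_sub_sqr_le a1; have u2 := expR_sub_sqr_le d1.
  apply: (@le_trans _ _ (expR (- (x / b)) * expR (- (x / c)))).
    by apply: ler_pM; rewrite ?expR_ge1Dx// pos.
  apply: (@le_trans _ _ (expR (L + 4 * (Y / m) ^+ 2) *
    (expR ((x + 1) / a - 2 * ((x + 1) / a) ^+ 2) * expR ((x + 1) / d - 2 * ((x + 1) / d) ^+ 2)))).
    by rewrite -!expRD ler_expR /L; lra.
  by apply: ler_wpM2l; rewrite ?expR_ge0//; apply: ler_pM; rewrite ?expR_ge0.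
- have u1 := expR_sub_sqr_le b1; have u2 := expR_sub_sqr_le c1.
  apply: (@le_trans _ _ (expR (L - 4 * (Y / m) ^+ 2) * (expR ((x + 1) / a) * expR ((x + 1) / d)))).
    by apply: ler_wpM2l; rewrite ?expR_ge0//; apply: ler_pM; rewrite ?expR_ge1Dx ?pos.
  apply: (@le_trans _ _ (expR (- (x / b) - 2 * (- (x / b)) ^+ 2) *
      expR (- (x / c) - 2 * (- (x / c)) ^+ 2))).
    by rewrite -!expRD ler_expR /L; lra.
  by apply: ler_pM; rewrite ?expR_ge0.
Qed.

Lemma ratio_estimate (x : R) : `|x| + 1 <= Y ->
  (b - x) * (c - x) <=
    expR (ratio_error - (2 * x + 1) / (2 * s ^+ 2)) * ((a + x + 1) * (d + x + 1)) /\
  expR (- ratio_error - (2 * x + 1) / (2 * s ^+ 2)) * ((a + x + 1) * (d + x + 1)) <=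
    (b - x) * (c - x).
Proof.
move=> xY; have [h1 h2] := main xY; move: h1 h2.
set L := - (x / b) - x / c - (x + 1) / a - (x + 1) / d => h1 h2.
have H : `|L + (2 * x + 1) / (2 * s ^+ 2)| <= ratio_error - 4 * (Y / m) ^+ 2.
  set D := a^-1 + b^-1 + c^-1 + d^-1 - (s ^+ 2)^-1.
  rewrite (_ : _ + _ = - (x * D) + (- (a^-1 + d^-1) + (2 * s ^+ 2)^-1)); last first.
    rewrite /L /D (_ : (2 * x + 1) / (2 * s ^+ 2) = x * (s ^+ 2)^-1 + (2 * s ^+ 2)^-1); first by ring.
    by field; rewrite gt_eqF.
  have s2 : 0 <= (2 * s ^+ 2)^-1 by rewrite invr_ge0 mulr_ge0// sqr_ge0.
  have ia e : m <= e -> 0 <= e^-1 <= m^-1.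
    by move=> me; have mm := m0; rewrite invr_ge0 lef_pV2 ?posrE//; lra.
  have /andP[a1 a2] := ia _ ma; have /andP[d1 d2] := ia _ md.
  have xD : `|x * D| <= Y * `|D|.
    by rewrite normrM ler_wpM2r//; lra.
  apply: le_trans (ler_normD _ _) _; rewrite normrN.
  have : `|- (a^-1 + d^-1) + (2 * s ^+ 2)^-1| <= 2 / m + (2 * s ^+ 2)^-1.
    by rewrite ler_norml; lra.
  rewrite /ratio_error -/D; lra.
have Y0 : 0 <= Y by have := normr_ge0 x; lra.
have p0 : 0 <= (a + x + 1) * (d + x + 1).
  have := ler_norm (- x); rewrite normrN => ?.
  by have := m0; have := ma; have := md; have := Ym => *; apply: mulr_ge0; lra.
move: H; rewrite ler_norml => /andP[H1 H2]; split.
  by apply: le_trans h1 _; apply: ler_wpM2r => //; rewrite ler_expR; lra.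
by apply: le_trans h2; apply: ler_wpM2r => //; rewrite ler_expR; lra.
Qed.

End RatioEstimate.

(** * Local limit theorem for a distribution given by its step quotients *)

Lemma comparable_steps (R : realType) (r : nat -> R) (E : R) (lo hi : nat) :
  1 <= E -> (forall z, 0 <= r z) ->
  (forall z, (lo <= z < hi)%N -> r z.+1 <= E * r z /\ r z <= E * r z.+1) ->
  forall z z', (lo <= z <= hi)%N -> (lo <= z' <= hi)%N ->
  r z <= E ^+ (hi - lo) * r z'.
Proof.
move=> E1 r0 step; have E0 : 0 <= E by lra.
have H z j : (lo <= z)%N -> (z + j <= hi)%N ->
    r (z + j)%N <= E ^+ j * r z /\ r z <= E ^+ j * r (z + j)%N.
  elim: j => [|j IH] lz zj; first by rewrite addn0 expr0 !mul1r.
  have [|i1 i2] := IH lz; first by lia.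
  have [|s1 s2] := step (z + j)%N; first by lia.
  rewrite addnS; split.
    by apply: le_trans s1 _; rewrite exprS -mulrA ler_wpM2l.
  by apply: le_trans i2 _; rewrite exprSr -mulrA ler_wpM2l// exprn_ge0.
move=> z z' /andP[lz zh] /andP[lz' zh'].
have le (j : nat) : (j <= hi - lo)%N -> E ^+ j <= E ^+ (hi - lo).
  by move=> jh; rewrite ler_weXn2l.
have [zz|zz] := leqP z z'.
  have [||_] := H z (z' - z)%N; [lia|lia|].
  rewrite subnKC// => /le_trans; apply; apply: ler_wpM2r => //; apply: le; lia.
have [||+ _] := H z' (z - z')%N; [lia|lia|].
rewrite subnKC ?(ltnW zz)// => /le_trans; apply; apply: ler_wpM2r => //; apply: le; lia.
Qed.

Section LocalLimit.
Variables (R : realType) (h : nat -> R) (B : nat).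
Variables (a b c d m s W kappa : R).
Hypothesis h0 : forall z, 0 <= h z.
Hypothesis hB : forall z, (B < z)%N -> h z = 0.
Hypothesis sum_h : \sum_(0 <= z < B.+1) h z = 1.
Hypothesis hrec : forall z : nat, let x := z%:R - a in
  h z.+1 * ((a + x + 1) * (d + x + 1)) = h z * ((b - x) * (c - x)).
Hypotheses (ma : m <= a) (mb : m <= b) (mc : m <= c) (md : m <= d).
Hypotheses (s1 : 1 <= s) (W1 : 1 <= W) (Wm : 2 * (W + 2) <= m).
Hypothesis bcad : b * c = a * d.
Local Notation eta := (ratio_error a b c d m s (W + 2)).
Hypothesis k4 : kappa <= 4^-1.
Hypothesis eps_le : eta * (2 * W + 3) + (2 * W + 3) / (2 * s ^+ 2) <= kappa.
Hypothesis tail_le : Num.sqrt 2 * expR (- (W ^+ 2 / (4 * s ^+ 2))) <= kappa.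
(** A bound for [h] at the ends of the window and beyond. The ends are at least W - 1 away from [a],
    and 4 = 2 * 2 bounds [r] there: 2 for its value near the mean, 2 for its variation over the
    window. *)
Let T1 : R := 4 * expR (- ((W - 1) ^+ 2 / (2 * s ^+ 2))).
Hypothesis T1_le : B.+1%:R * T1 <= kappa.
Hypothesis T1_peak : T1 <= kappa * normal_peak s.

Let x (z : nat) : R := z%:R - a.
Let G z := expR (- (x z ^+ 2 / (2 * s ^+ 2))).
(** The quotient of [h] by the unnormalised Gaussian. By the ratio estimate each step changes it by
    a factor within exp(eta) either way, so it is nearly constant on the window; comparing total
    masses then identifies the constant with [P]. *)
Let r z := h z * expR (x z ^+ 2 / (2 * s ^+ 2)).
Let lo := Num.truncn (a - W).
Let hi := Num.truncn (a + W).
Let z0 := Num.truncn a.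
Let eps := eta * (2 * W + 3).
Let theta := (2 * W + 3) / (2 * s ^+ 2).
Let P := normal_peak s.

Let s0 : 0 < s. Proof. by have := s1; lra. Qed.
Let s2 : 0 < s ^+ 2. Proof. by rewrite exprn_gt0. Qed.
Let m0 : 0 < m. Proof. by have := W1; have := Wm; lra. Qed.
Let aW : 0 <= a - W. Proof. by have := ma; have := Wm; have := W1; lra. Qed.
Let theta0 : 0 <= theta.
Proof. by have := W1 => ?; apply: divr_ge0; [lra|apply: mulr_ge0 => //; exact: ltW]. Qed.

Let eta0 : 0 <= eta.
Proof.
have w := W1; rewrite /ratio_error !addr_ge0//.
- by apply: mulr_ge0 => //; lra.
- by rewrite mulr_ge0// sqr_ge0.
- by rewrite divr_ge0// ltW.
- by rewrite invr_ge0 mulr_ge0// sqr_ge0.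
Qed.

Let eps0 : 0 <= eps.
Proof. by have := W1 => ?; apply: mulr_ge0 => //; lra. Qed.

Let kappa0 : 0 <= kappa.
Proof. by apply: le_trans eps_le; apply: addr_ge0; [exact: eps0|exact: theta0]. Qed.

Let rG z : r z * G z = h z.
Proof. by rewrite /r /G -mulrA -expRD subrr expR0 mulr1. Qed.

Let P0 : 0 <= P. Proof. by rewrite invr_ge0 sqrtr_ge0. Qed.

Let phiE z : normal_pdf a s z%:R = P * G z.
Proof.
rewrite normal_pdfE ?gt_eqF// /normal_fun /G -[s ^+ 2 *+ 2]mulr_natl.
by rewrite mulNr.
Qed.

Let step z : `|x z| <= W + 1 -> r z.+1 <= expR eta * r z /\ r z <= expR eta * r z.+1.
Proof.
move=> xW; have xY : `|x z| + 1 <= W + 2 by lra.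
have [h1 h2] := ratio_estimate m0 ma mb mc md s0 Wm bcad xY.
have p0 : 0 < (a + x z + 1) * (d + x z + 1).
  have := ler_norm (- x z); rewrite normrN => ?.
  by have := ma; have := md; have := Wm; have := W1 => *; apply: mulr_gt0; lra.
have xS : x z.+1 ^+ 2 / (2 * s ^+ 2) = x z ^+ 2 / (2 * s ^+ 2) + (2 * x z + 1) / (2 * s ^+ 2).
  by rewrite /x -[z.+1%:R]natr1 -mulrDl; congr (_ / _); ring.
have := hrec z; rewrite -/(x z) /= => e.
set PP := (a + x z + 1) * _ in p0 h1 h2 e.
rewrite /r xS expRD; set E := expR (x z ^+ 2 / _); set F := (2 * x z + 1) / _ in h1 h2 *.
have E0 : 0 <= E by exact: expR_ge0.
have h1' := ler_wpM2l (h0 z) h1; have h2' := ler_wpM2l (h0 z) h2.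
rewrite -e [leRHS]mulrA ler_pM2r// in h1'; rewrite -e [leLHS]mulrA ler_pM2r// in h2'.
split.
  rewrite mulrA mulrAC [leRHS]mulrA ler_wpM2r//.
  apply: le_trans (ler_wpM2r (expR_ge0 F) h1') _.
  by rewrite -mulrA -expRD subrK mulrC.
rewrite [leRHS](_ : _ = (expR eta * expR F * h z.+1) * E) ?ler_wpM2r//; last by ring.
have := ler_wpM2l (mulr_ge0 (expR_ge0 eta) (expR_ge0 F)) h2'.
rewrite mulrCA -!expRD (_ : eta + F + _ = 0) ?expR0 ?mulr1//; ring.
Qed.

Let xE z : x z.+1 = x z + 1. Proof. by rewrite /x -natr1 addrAC. Qed.

Let window z : (lo <= z <= hi)%N -> `|x z| <= W + 1.
Proof.
move=> /andP[lz zh]; rewrite ler_norml; apply/andP; split.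
  have /andP[_ h1] := truncn_itv aW.
  have : lo.+1%:R <= z.+1%:R :> R by rewrite ler_nat.
  by rewrite -/lo in h1; rewrite /x -[z.+1%:R]natr1; lra.
have aW' : 0 <= a + W by have := aW; have := W1; lra.
have /andP[h1 _] := truncn_itv aW'.
have : z%:R <= hi%:R :> R by rewrite ler_nat.
by rewrite -/hi in h1; rewrite /x; lra.
Qed.

Let lo_le : lo%:R <= a - W.
Proof. by have /andP[] := truncn_itv aW. Qed.

Let aW' : 0 <= a + W. Proof. by have := aW; have := W1; lra. Qed.

Let hi_ge : a + W < hi.+1%:R.
Proof. by have /andP[] := truncn_itv aW'. Qed.

Let a0 : 0 <= a. Proof. by have := aW; have := W1; lra. Qed.

Let z0_window : (lo <= z0 <= hi)%N.
Proof.
have /andP[h1 h2] := truncn_itv a0; have w1 := W1; have l := lo_le; have h' := hi_ge.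
by apply/andP; split; rewrite -ltnS -(ltr_nat R); rewrite -/z0 in h1 h2; lra.
Qed.

Let lohi : (hi - lo)%:R <= 2 * W + 3.
Proof.
have /andP[l h1] := z0_window; have lh : (lo <= hi)%N by exact: leq_trans h1.
have l1 := window (z := lo); have l2 := window (z := hi).
rewrite natrB//; move: (l1) (l2); rewrite !leqnn lh !ler_norml /x.
by move=> /(_ isT)/andP[? _] /(_ isT)/andP[_ ?]; lra.
Qed.

Let r0_ge0 z : 0 <= r z. Proof. by rewrite mulr_ge0// expR_ge0. Qed.

Let r_window z z' : (lo <= z <= hi)%N -> (lo <= z' <= hi)%N -> r z <= expR eps * r z'.
Proof.
move=> zw zw'; have E1 : 1 <= expR eta by rewrite -[leLHS](@expR0 R) ler_expR.
have st y : (lo <= y < hi)%N -> r y.+1 <= expR eta * r y /\ r y <= expR eta * r y.+1.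
  by move=> /andP[ly yh]; apply: step; apply: window; rewrite ly ltnW.
apply: le_trans (comparable_steps E1 r0_ge0 st zw zw') _.
by rewrite ler_wpM2r// -expRM_natl ler_expR /eps mulrC ler_wpM2l.
Qed.

Let G_ge0 z : 0 <= G z. Proof. exact: expR_ge0. Qed.

Let G_le1 z : G z <= 1.
Proof.
by rewrite -[leRHS](@expR0 R) ler_expR oppr_le0 divr_ge0 ?sqr_ge0// mulr_ge0// ltW.
Qed.

Let h_le1 z : h z <= 1.
Proof.
have [zB|Bz] := leqP z B; last by rewrite hB.
rewrite -sum_h (bigD1_seq z) ?iota_uniq//= ?lerDl ?sumr_ge0//.
by rewrite mem_index_iota.
Qed.

Let r0_le2 : r z0 <= 2.
Proof.
have /andP[h1 h2] := truncn_itv a0; rewrite -/z0 -natr1 in h1 h2.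
have x1 : x z0 ^+ 2 <= 1 by rewrite /x; nra.
have q : x z0 ^+ 2 / (2 * s ^+ 2) <= 2^-1.
  have ss : 1 <= s ^+ 2 by have := s1; nra.
  by rewrite ler_pdivrMr; have := s2; lra.
have e2 : expR (x z0 ^+ 2 / (2 * s ^+ 2)) <= 2.
  have := expR_ge1Dx (- (x z0 ^+ 2 / (2 * s ^+ 2))).
  have e : expR (x z0 ^+ 2 / (2 * s ^+ 2)) * expR (- (x z0 ^+ 2 / (2 * s ^+ 2))) = 1.
    by rewrite -expRD subrr expR0.
  have := expR_ge0 (x z0 ^+ 2 / (2 * s ^+ 2)); nra.
have := h_le1 z0; have := h0 z0; have := expR_ge0 (x z0 ^+ 2 / (2 * s ^+ 2)).
rewrite /r; nra.
Qed.

Let expk : expR (eps + theta) <= 1 + 2 * kappa.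
Proof.
have kk := k4; have k0 := kappa0.
apply: (@le_trans _ _ (expR kappa)); first by rewrite ler_expR; exact: eps_le.
by apply: le_trans (expR_le_quadratic _) _; nra.
Qed.

Let e1 : 1 <= expR eps. Proof. by rewrite -[leLHS](@expR0 R) ler_expR. Qed.

Let e2 : 1 <= expR theta. Proof. by rewrite -[leLHS](@expR0 R) ler_expR. Qed.

Let e12 : expR eps * expR theta <= 1 + 2 * kappa.
Proof. by rewrite -expRD; exact: expk. Qed.

Let h_edge z : (lo <= z <= hi)%N -> W - 1 <= `|x z| -> h z <= T1.
Proof.
move=> zw Wx; have w1 := W1; have ee : expR eps <= 2.
  by have := e12; have := e2; have := e1; have := k4; nra.
have rz := r_window zw z0_window.
have r4 : r z <= 4.
  apply: le_trans rz _; have := r0_le2; have := r0_ge0 z0; have := e1; nra.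
rewrite -rG /T1; apply: ler_pM => //; rewrite /G ler_expR lerN2.
have i0 : 0 <= (2 * s ^+ 2)^-1 by rewrite invr_ge0 mulr_ge0// ltW.
apply: ler_wpM2r => //; rewrite -[leRHS]real_normK ?num_real// lerXn2r ?nnegrE//; lra.
Qed.

(** If b - x and c - x are nonnegative, their product is at most bc = ad; if just one is negative,
    the product is at most 0; if both are, it is at most x^2. This monotonicity carries the bound at
    the end of the window outward, so [h] needs no separate tail estimate. *)
Let dec (z : nat) : 0 <= x z -> h z.+1 <= h z.
Proof.
move=> xz; have := hrec z; rewrite -/(x z) /= => e.
have [mm aa bb cc dd] : [/\ 0 < m, m <= a, m <= b, m <= c & m <= d].
  by split; [exact: m0|exact: ma|exact: mb|exact: mc|exact: md].
have p0 : 0 < (a + x z + 1) * (d + x z + 1) by apply: mulr_gt0; lra.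
rewrite -(ler_pM2r p0) e; apply: ler_wpM2l => //.
have [xb|bx] := leP (x z) b; last first.
  have [xc|cx] := leP (x z) c; last by have := bcad; nra.
  by apply: (@le_trans _ _ 0); [rewrite mulr_le0_ge0//; lra|exact: ltW].
have [xc|cx] := leP (x z) c; last first.
  by apply: (@le_trans _ _ 0); [rewrite mulr_ge0_le0//; lra|exact: ltW].
have := bcad; nra.
Qed.

Let inc (z : nat) : x z + 1 <= 0 -> h z <= h z.+1.
Proof.
move=> xz; have := hrec z; rewrite -/(x z) /= => e.
have [mm aa bb cc dd] : [/\ 0 < m, m <= a, m <= b, m <= c & m <= d].
  by split; [exact: m0|exact: ma|exact: mb|exact: mc|exact: md].
have p0 : 0 < (b - x z) * (c - x z) by apply: mulr_gt0; lra.
have ax : 0 < a + x z + 1.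
  by rewrite (_ : _ + _ = z.+1%:R) ?ltr0n// /x -natr1; ring.
have [dx|dx] := leP (d + x z + 1) 0.
  have : h z * ((b - x z) * (c - x z)) <= 0.
    by rewrite -e mulr_ge0_le0// mulr_ge0_le0// ltW.
  by rewrite pmulr_lle0// => hz; apply: le_trans hz _.
rewrite -(ler_pM2r p0) -e; apply: ler_wpM2l => //.
have := bcad; nra.
Qed.

Let h_above z : (hi <= z)%N -> h z <= T1.
Proof.
have hh : h hi <= T1.
  apply: h_edge.
    by have /andP[l1 l2] := z0_window; rewrite leqnn (leq_trans l1 l2).
  by have := hi_ge; rewrite -natr1 /x => ?; apply: le_trans (ler_norm _); lra.
have xh : W - 1 < x hi by have := hi_ge; rewrite -natr1 /x; lra.
elim: z => [|z IH]; first by rewrite leqn0 => /eqP <-.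
rewrite leq_eqVlt => /orP[/eqP <-//|]; rewrite ltnS => hz.
apply: le_trans (dec _) (IH hz).
have : hi%:R <= z%:R :> R by rewrite ler_nat.
by have := W1; rewrite /x in xh *; lra.
Qed.

Let h_below z : (z <= lo)%N -> h z <= T1.
Proof.
have hh : h lo <= T1.
  apply: h_edge.
    by have /andP[l1 l2] := z0_window; rewrite leqnn (leq_trans l1 l2).
  by have := lo_le; rewrite /x -normrN => ?; apply: le_trans (ler_norm _); lra.
move=> zl; rewrite -(subKn zl); move: (lo - z)%N (leq_subr z lo) => j.
elim: j => [|j IH] jl; first by rewrite subn0.
have e : (lo - j = (lo - j.+1).+1)%N by rewrite subnSK.
apply: le_trans (IH (ltnW jl)); rewrite e; apply: inc.
rewrite -xE -e /x; have : (lo - j)%:R <= lo%:R :> R by rewrite ler_nat leq_subr.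
by have := lo_le; have := W1; lra.
Qed.

Let Sh : R := \sum_(lo <= z < hi.+1) h z.

Let T10 : 0 <= T1. Proof. by rewrite mulr_ge0// expR_ge0. Qed.

Let Sh_le1 : Sh <= 1.
Proof.
have e n' : (B <= n')%N -> \sum_(0 <= z < n'.+1) h z = 1.
  move=> Bn; rewrite (big_cat_nat (n := B.+1))//= sum_h big_nat big1 ?addr0// => z /andP[Bz _].
  exact: hB.
rewrite -(e (maxn B hi) (leq_maxl _ _)) (big_cat_nat (n := lo))//=; last first.
  have /andP[l1 l2] := z0_window.
  by apply: leq_trans (leqnSn _); apply: leq_trans (leq_maxr B hi); exact: leq_trans l1 l2.
rewrite [X in _ + X](big_cat_nat (n := hi.+1))//=; last 2 first.
- by have /andP[l1 l2] := z0_window; exact: leq_trans (leq_trans l1 l2) (leqnSn _).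
- by rewrite ltnS leq_maxr.
by rewrite addrCA lerDl addr_ge0// sumr_ge0.
Qed.

Let Sh_ge : 1 - kappa <= Sh.
Proof.
rewrite lerBlDr; apply: le_trans (lerD (lexx Sh) T1_le).
rewrite -[leLHS]sum_h.
apply: (@le_trans _ _ (\sum_(0 <= z < B.+1) ((if (lo <= z < hi.+1)%N then h z else 0) + T1))).
  apply: ler_sum => z _; case: ifPn => [_|]; first by rewrite lerDl.
  rewrite add0r negb_and -ltnNge -leqNgt => /orP[zl|zh].
    by apply: h_below; exact: ltnW.
  by apply: h_above; exact: ltnW.
rewrite big_split /= sumr_const_nat subn0 mulr_natl lerD2r /Sh.
rewrite -big_mkcond /= [leRHS]big_nat_cond (big_nat_widen _ _ (maxn B hi).+1)//; last first.
  by rewrite ltnS leq_maxl.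
rewrite [leRHS](big_nat_widen _ _ (maxn B hi).+1)/=; last by rewrite ltnS leq_maxr.
rewrite [leRHS](big_nat_widenl _ 0)//= big_mkcond [leRHS]big_mkcond /=.
apply: ler_sum => z _; rewrite andbT.
by case: (lo <= z)%N => //=; case: (z < hi.+1)%N => //=; case: ifP.
Qed.

Let SG : R := \sum_(lo <= z < hi.+1) G z.

Let SGE : P * SG = \sum_(lo <= z < hi.+1) normal_pdf a s z%:R.
Proof. by rewrite mulr_sumr; apply: eq_bigr => z _; rewrite phiE. Qed.

Let SG_ge : 1 <= expR theta * (P * SG) + kappa.
Proof.
have w0 : 0 <= W by have := W1; lra.
have := normal_pdf_sum_ge s0 w0 window lo_le hi_ge; rewrite -SGE => h1.
by apply: le_trans h1 _; rewrite lerD2l.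
Qed.

Let SG_le : P * SG <= expR theta.
Proof.
have w0 : 0 <= W by have := W1; lra.
have := normal_pdf_sum_le s0 window; rewrite -SGE => h1.
have := ler_wpM2l (expR_ge0 theta) h1.
by rewrite mulrA -expRD subrr expR0 mul1r mulr1.
Qed.

Let in_window z : z \in index_iota lo hi.+1 -> (lo <= z <= hi)%N.
Proof. by rewrite mem_index_iota ltnS. Qed.

Let SG_Sh1 : r z0 * SG <= expR eps.
Proof.
rewrite mulr_sumr; apply: (@le_trans _ _ (expR eps * Sh)); last first.
  by rewrite ler_piMr ?expR_ge0.
rewrite mulr_sumr big_seq [leRHS]big_seq; apply: ler_sum => z /in_window zw.
by rewrite -rG mulrA ler_wpM2r// r_window.
Qed.

Let SG_Sh2 : Sh <= expR eps * (r z0 * SG).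
Proof.
rewrite /Sh 2!mulr_sumr big_seq [leRHS]big_seq; apply: ler_sum => z /in_window zw.
by rewrite -rG mulrA ler_wpM2r// r_window.
Qed.

(** [r z0 * SG] agrees with the mass of [h] on the window up to exp(eps), and [P * SG] with 1 up to
    exp(theta) and the tail; eliminating [SG] compares [r z0] with [P]. *)
Let r0_upper : r z0 * (1 - kappa) <= (1 + 2 * kappa) * P.
Proof.
have u1 : 1 - kappa <= expR theta * (P * SG) by have := SG_ge; lra.
have u2 := ler_wpM2l (r0_ge0 z0) u1.
have et0 := mulr_ge0 (expR_ge0 theta) P0.
have u3 := ler_wpM2l et0 SG_Sh1.
have u4 := ler_wpM2r P0 e12; lra.
Qed.

Let r0_lower : (1 - kappa) * P <= (1 + 2 * kappa) * r z0.
Proof.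
have u1 := ler_wpM2l P0 (le_trans Sh_ge SG_Sh2).
have u2 := ler_wpM2l (mulr_ge0 (expR_ge0 eps) (r0_ge0 z0)) SG_le.
have u4 := ler_wpM2r (r0_ge0 z0) e12; lra.
Qed.

(** Inside the window [r z] lies within a factor 1 ± 20 kappa of [P], and the Gaussian factor is at
    most 1. Outside, each of the two terms is at most kappa P by itself. *)
Lemma local_limit_of_step_ratio z : `|h z - normal_pdf a s z%:R| <= 20 * kappa * P.
Proof.
have kk := k4; have k0 := kappa0; have PP := P0.
rewrite phiE.
have [/andP[lz zh]|out] := boolP (lo <= z <= hi)%N; last first.
  have hz : h z <= T1.
    move: out; rewrite negb_and -!ltnNge => /orP[/ltnW|/ltnW]; [exact: h_below|exact: h_above].
  have Wx : W <= `|x z|.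
    move: out; rewrite negb_and -!ltnNge => /orP[zl|zh].
      have : z%:R <= lo%:R :> R by rewrite ler_nat ltnW.
      by rewrite -normrN => ?; apply: le_trans (ler_norm _); have := lo_le; rewrite /x; lra.
    have : hi.+1%:R <= z%:R :> R by rewrite ler_nat.
    by move=> ?; apply: le_trans (ler_norm _); have := hi_ge; rewrite /x; lra.
  have Gk : G z <= kappa.
    apply: le_trans tail_le; apply: (@le_trans _ _ (expR (- (W ^+ 2 / (4 * s ^+ 2))))).
      rewrite ler_expR lerN2.
      have W2 : W ^+ 2 <= x z ^+ 2.
        by rewrite -[leRHS]real_normK ?num_real// lerXn2r ?nnegrE//; have := W1; lra.
      apply: (@le_trans _ _ (x z ^+ 2 / (4 * s ^+ 2))).
        by apply: ler_wpM2r => //; rewrite invr_ge0 mulr_ge0// ltW.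
      apply: ler_wpM2l; first exact: sqr_ge0.
      by have ss := s2; rewrite lef_pV2 ?posrE; lra.
    rewrite ler_peMl ?expR_ge0// -[leLHS](@sqrtr1 R) ler_wsqrtr//; lra.
  have GP := ler_wpM2l PP Gk; have PG0 := mulr_ge0 PP (G_ge0 z).
  have T1P := T1_peak; rewrite -/P in T1P.
  by have := h0 z; rewrite ler_norml; lra.
have zw : (lo <= z <= hi)%N by rewrite lz.
have b1 := r_window zw z0_window; have b2 := r_window z0_window zw.
have ee : expR eps <= 1 + 2 * kappa by have := e12; have := e2; have := e1; nra.
have up := r0_upper; have low := r0_lower; have rz0 := r0_ge0 z0; have rz := r0_ge0 z.
have r0up : r z0 <= (1 + 6 * kappa) * P.
  have : (1 + 2 * kappa) * P <= (1 - kappa) * ((1 + 6 * kappa) * P).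
    by rewrite mulrA ler_wpM2r//; nra.
  have : 0 < 1 - kappa by lra.
  by move=> k1 v; rewrite -(ler_pM2l k1); lra.
have rup : r z <= (1 + 20 * kappa) * P.
  apply: le_trans b1 _; apply: (@le_trans _ _ ((1 + 2 * kappa) * ((1 + 6 * kappa) * P))).
    by apply: ler_pM => //; exact: expR_ge0.
  by rewrite mulrA ler_wpM2r//; nra.
have rlow : (1 - 20 * kappa) * P <= r z.
  have v1 : r z0 <= (1 + 2 * kappa) * r z.
    by apply: le_trans b2 _; rewrite ler_wpM2r.
  have k1 : 0 < (1 + 2 * kappa) * (1 + 2 * kappa) by apply: mulr_gt0; lra.
  rewrite -(ler_pM2l k1).
  have v2 : (1 + 2 * kappa) * r z0 <= (1 + 2 * kappa) * ((1 + 2 * kappa) * r z).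
    by rewrite ler_wpM2l//; lra.
  apply: le_trans (_ : (1 - kappa) * P <= _); last by lra.
  by rewrite mulrA ler_wpM2r//; nra.
rewrite -rG -mulrBl normrM [`|G z|]ger0_norm//.
apply: (@le_trans _ _ (20 * kappa * P * 1)); last by rewrite mulr1.
by apply: ler_pM => //; rewrite ler_norml; lra.
Qed.

End LocalLimit.

(** * The hypergeometric distribution and its recurrence *)

Section Hypergeometric.
Variables (R : realType) (N K M : nat).
Hypotheses (KN : (K <= N)%N) (MN : (M <= N)%N) (N0 : (0 < N)%N).

(** The test is needed because M - z is truncated at 0: for z > M the second binomial coefficient
    would be 1. *)
Definition hypergeometric (z : nat) : R :=
  if (z <= M)%N then 'C(K, z)%:R * 'C(N - K, M - z)%:R / 'C(N, M)%:R else 0.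

Let C0 : 'C(N, M)%:R != 0 :> R.
Proof. by rewrite pnatr_eq0 -lt0n bin_gt0. Qed.

Lemma hypergeometric_ge0 z : 0 <= hypergeometric z.
Proof. by rewrite /hypergeometric; case: ifP => // _; rewrite divr_ge0// mulr_ge0. Qed.

Lemma hypergeometric_out z : (M < z)%N -> hypergeometric z = 0.
Proof. by move=> Mz; rewrite /hypergeometric leqNgt Mz. Qed.

Lemma sum_hypergeometric : \sum_(0 <= z < M.+1) hypergeometric z = 1.
Proof.
rewrite big_mkord (eq_bigr (fun z : 'I_M.+1 => ('C(K, z) * 'C(N - K, M - z))%:R / 'C(N, M)%:R)).
  by rewrite -mulr_suml -natr_sum binomial.Vandermonde subnKC// divff.
by move=> z _; rewrite /hypergeometric -ltnS ltn_ord natrM.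
Qed.

(** The identity h(z+1) (z+1) (N-K-M+z+1) = h(z) (K-z) (M-z), recentred at the mean. The constants
    in the four factors become the expected cell counts of a 2 by 2 table. *)
Lemma hypergeometric_rec (z : nat) : let mu := K%:R * M%:R / N%:R in let x := z%:R - mu in
  hypergeometric z.+1 * ((mu + x + 1) * ((N%:R - K%:R - M%:R + mu) + x + 1)) =
  hypergeometric z * (((K%:R - mu) - x) * ((M%:R - mu) - x)).
Proof.
move=> mu x; rewrite (_ : mu + x + 1 = z.+1%:R); last by rewrite /x -natr1; ring.
rewrite (_ : N%:R - K%:R - M%:R + mu + x + 1 = N%:R - K%:R - M%:R + z.+1%:R); last first.
  by rewrite /x -natr1; ring.
rewrite (_ : K%:R - mu - x = K%:R - z%:R); last by rewrite /x; ring.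
rewrite (_ : M%:R - mu - x = M%:R - z%:R); last by rewrite /x; ring.
have [zM|Mz] := ltnP z M; last first.
  rewrite hypergeometric_out// mul0r; move: Mz; rewrite leq_eqVlt => /orP[/eqP <-|Mz].
    by rewrite subrr !mulr0.
  by rewrite hypergeometric_out// mul0r.
rewrite /hypergeometric zM (ltnW zM).
have h1 := natr_binS R K z; have := natr_binS R (N - K) (M - z.+1).
rewrite subnSK// (natrB _ KN) (natrB _ zM) => h2.
have e : (M - z)%:R = M%:R - z%:R :> R by rewrite natrB// ltnW.
rewrite -e; set A := 'C(K, z.+1)%:R in h1 *; set A' := 'C(K, z)%:R in h1 *.
set D := 'C(N - K, M - z)%:R in h2 *; set D' := 'C(N - K, M - z.+1)%:R in h2 *.
transitivity ((A * z.+1%:R) * (D' * (N%:R - K%:R - (M%:R - z.+1%:R))) / 'C(N, M)%:R); first by ring.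
by rewrite h1 -h2; ring.
Qed.

End Hypergeometric.

(** * Estimates for the dense regime and the hypergeometric local limit *)

(** exp(cu) is at least (cu/(j+1))^(j+1); the one factor of [u] beyond u^j absorbs the constant. *)
Lemma exprn_le_expR (R : realType) (c : R) (j : nat) (u : R) : 0 < c -> 0 <= u ->
  (j.+1%:R / c) ^+ j.+1 <= u -> u ^+ j <= expR (c * u).
Proof.
move=> c0 u0 hu; set v := c * u / j.+1%:R.
have v0 : 0 <= v by rewrite divr_ge0 ?mulr_ge0// ltW.
have [->|un0] := eqVneq u 0.
  rewrite mulr0 expR0 expr0n; by case: (j == 0)%N; rewrite ?lexx ?ler01.
have up : 0 < u by rewrite lt_neqAle eq_sym un0.
have h : v ^+ j.+1 <= expR (c * u).
  rewrite (_ : c * u = j.+1%:R * v); last by rewrite /v; field; rewrite gt_eqF.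
  rewrite expRM_natl lerXn2r ?nnegrE ?expR_ge0//.
  by apply: le_trans (expR_ge1Dx _); lra.
apply: le_trans h; have w0 : 0 < (j.+1%:R / c) ^+ j.+1 by rewrite exprn_gt0// divr_gt0.
have -> : v ^+ j.+1 = u ^+ j.+1 / (j.+1%:R / c) ^+ j.+1.
  by rewrite -expr_div_n; congr (_ ^+ _); rewrite /v; field; rewrite !gt_eqF.
by rewrite ler_pdivlMr// [leRHS]exprSr; apply: ler_wpM2l => //; exact: exprn_ge0.
Qed.

Section DenseRegime.
Variables (R : realType) (delta u : R) (n k M : nat).
Hypothesis dl0 : 0 < delta.
Hypothesis hM : delta <= M%:R / 'C(n, 2)%:R <= 1 - delta.
Hypothesis hk : delta <= k%:R / n%:R <= 1 - delta.
Hypothesis nu : n%:R = u ^+ 32.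
Hypothesis u_ge : 64 / delta <= u.
Hypothesis u_exp : u ^+ 300 <= expR (u / 24).

Local Notation N := 'C(n, 2).
Local Notation K := 'C(k, 2).
Local Notation nn := (n%:R : R).
Local Notation kk := (k%:R : R).
Local Notation p := (M%:R / 'C(n, 2)%:R : R).

Lemma delta_le_half : delta <= 2^-1.
Proof. by have /andP[h1 h2] := hk; lra. Qed.

Lemma u_ge128 : 128 <= u.
Proof.
have h := delta_le_half; apply: le_trans u_ge.
by rewrite ler_pdivlMr//; lra.
Qed.

Let ud : 64 <= u * delta.
Proof. by have := u_ge; rewrite ler_pdivrMr. Qed.

Let n_big : u <= nn /\ 0 < nn.
Proof.
have h := u_ge128; have : u <= nn by rewrite nu -[leLHS]expr1 ler_weXn2l//; lra.
by move=> h1; split=> //; lra.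
Qed.

Let nd : 64 <= nn * delta.
Proof.
have [h1 _] := n_big; apply: le_trans ud _; rewrite ler_wpM2r//; exact: ltW.
Qed.

Let k_bounds : delta * nn <= kk <= (1 - delta) * nn.
Proof. by have [_ n0] := n_big; move: hk; rewrite ler_pdivlMr// ler_pdivrMr. Qed.

Lemma order_size_bounds : (2 <= k)%N /\ (k <= n)%N /\ (2 <= n)%N.
Proof.
have /andP[k1 k2] := k_bounds; have nd' := nd; have [_ n0] := n_big.
have kn : (k <= n)%N by rewrite -(ler_nat R); nra.
have k2' : (2 <= k)%N by rewrite -(ler_nat R); lra.
by split => //; split => //; exact: leq_trans kn.
Qed.

Let nnu : 128 <= nn.
Proof. by have [h _] := n_big; have := u_ge128; lra. Qed.

Lemma edge_count_bounds : nn ^+ 2 / 4 <= N%:R <= nn ^+ 2 / 2.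
Proof. by rewrite natr_bin2; have := nnu; nra. Qed.

Let N0 : 0 < N%:R :> R.
Proof. by have /andP[h _] := edge_count_bounds; have [_ n0] := n_big; nra. Qed.

Let ME : M%:R = p * N%:R :> R.
Proof. by rewrite divfK// gt_eqF. Qed.

Lemma edges_strict : (0 < M)%N /\ (M < N)%N.
Proof.
have /andP[h1 h2] := hM; have d0 := dl0.
split; first by rewrite -(ltr_nat R) ME mulr_gt0//; lra.
by rewrite -(ltr_nat R) ME gtr_pMl//; lra.
Qed.

Let al : R := K%:R / N%:R.

Let KE : K%:R = al * N%:R :> R.
Proof. by rewrite divfK// gt_eqF. Qed.

(** The variance in the theorem is written with [beta], the hypergeometric one with [al]; they
    differ by O(1/n). *)
Let beta : R := (kk / nn) ^+ 2.

Let beta_al : 0 <= beta - al <= nn^-1.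
Proof.
have [_ n0] := n_big; have n128 := nnu; have /andP[k1 k2] := k_bounds.
have dn : 0 <= delta * nn by rewrite mulr_ge0// ltW.
have k0 : 0 <= kk by [].
have kn : kk <= nn by lra.
rewrite /beta /al !natr_bin2.
have -> : (kk / nn) ^+ 2 - kk * (kk - 1) / 2 / (nn * (nn - 1) / 2) =
   kk * (nn - kk) / (nn ^+ 2 * (nn - 1)).
  by field; rewrite !gt_eqF//; lra.
have den : 0 < nn ^+ 2 * (nn - 1) by rewrite mulr_gt0 ?exprn_gt0//; lra.
apply/andP; split; first by rewrite divr_ge0 ?(ltW den)// mulr_ge0//; lra.
rewrite ler_pdivrMr// mulrA expr2 mulrA mulVf ?gt_eqF// mul1r; nra.
Qed.

Let beta_bounds : delta ^+ 2 <= beta <= 1 - delta.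
Proof.
have /andP[h1 h2] := hk; have d0 := dl0; rewrite /beta; move: (kk / nn) h1 h2 => y *.
by apply/andP; split; nra.
Qed.

Let al_bounds : delta ^+ 2 / 2 <= al <= 1 - delta.
Proof.
have /andP[h1 h2] := beta_al; have /andP[b1 b2] := beta_bounds.
have [_ n0] := n_big.
have : nn^-1 <= delta ^+ 2 / 2.
  rewrite -[leLHS]mul1r ler_pdivrMr//.
  have : 2 / delta ^+ 2 <= nn.
    have u1 := u_ge128; apply: (@le_trans _ _ (u ^+ 2)).
      rewrite ler_pdivrMr ?exprn_gt0//; have := ud; nra.
    by rewrite nu ler_weXn2l//; lra.
  by rewrite ler_pdivrMr ?exprn_gt0//; lra.
by move=> ?; apply/andP; split; lra.
Qed.

Definition variance : R := beta * (1 - beta) / 2 * (p * (1 - p)) * nn ^+ 2.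

Lemma lambdaE : lambda R n M k * nn ^+ 2 = variance.
Proof.
have [_ n0] := n_big; rewrite /lambda /variance /beta.
field; rewrite !gt_eqF//.
Qed.

Let p_bounds : delta / 2 <= p * (1 - p) <= 4^-1.
Proof.
have /andP[h1 h2] := hM; have d0 := dl0.
move: p h1 h2 => y *; apply/andP; split; have := sqr_ge0 (y - 2^-1); nra.
Qed.

Lemma variance_bounds : delta ^+ 4 * nn ^+ 2 / 4 <= variance <= nn ^+ 2 / 32.
Proof.
have /andP[h1 h2] := p_bounds; have d0 := dl0; have /andP[b1 b2] := beta_bounds.
have hb : delta ^+ 3 <= beta * (1 - beta) <= 4^-1.
  apply/andP; split; last by have := sqr_ge0 (beta - 2^-1); lra.
  by rewrite exprSr; apply: ler_pM => //; [exact: sqr_ge0|exact: ltW|lra].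
have d3 : 0 <= delta ^+ 3 by rewrite exprn_ge0// ltW.
move: hb => /andP[c1 c2]; rewrite /variance.
have n2 : 0 <= nn ^+ 2 by exact: sqr_ge0.
apply/andP; split.
  rewrite [leLHS](_ : _ = delta ^+ 3 / 2 * (delta / 2) * nn ^+ 2); last by field.
  by rewrite ler_wpM2r// ler_pM//; [exact: divr_ge0|apply: divr_ge0 => //; exact: ltW|lra].
rewrite [leRHS](_ : _ = 8^-1 * 4^-1 * nn ^+ 2); last by field.
rewrite ler_wpM2r// ler_pM//; lra.
Qed.

Let Np := 'C(n, 2)%:R : R.
Let mu : R := K%:R * M%:R / N%:R.

Let abcdE : [/\ mu = al * p * Np, K%:R - mu = al * (1 - p) * Np,
  M%:R - mu = (1 - al) * p * Np & N%:R - K%:R - M%:R + mu = (1 - al) * (1 - p) * Np].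
Proof.
have n0 : N%:R != 0 :> R by rewrite gt_eqF.
have ke := KE; have me := ME; move: al (p) ke me => x y ke me.
rewrite /mu /Np ke me; move: (N%:R : R) n0 => z z0.
by split; field.
Qed.

(** The reciprocal of the sum of the inverse cell means, which is the variance that the step
    quotients of the hypergeometric distribution see. *)
Let v0 : R := al * (1 - al) * (p * (1 - p)) * Np.

Let v0_bounds : delta ^+ 4 * nn ^+ 2 / 16 <= v0.
Proof.
have /andP[h1 _] := p_bounds; have /andP[b1 b2] := al_bounds.
have /andP[n1 _] := edge_count_bounds.
have hb : delta ^+ 3 / 2 <= al * (1 - al).
  by rewrite exprSr mulrAC; apply: ler_pM => //; [rewrite divr_ge0 ?sqr_ge0|exact: ltW|lra].
rewrite /v0 [leLHS](_ : _ = delta ^+ 3 / 2 * (delta / 2) * (nn ^+ 2 / 4)); last by field.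
have d3 : 0 <= delta ^+ 3 / 2 by rewrite divr_ge0// exprn_ge0// ltW.
have d2 : 0 <= delta / 2 by rewrite divr_ge0// ltW.
apply: ler_pM => //; first by rewrite mulr_ge0.
by apply: ler_pM.
Qed.

Let v0_variance : `|v0 - variance| <= nn.
Proof.
have [_ n0] := n_big.
have /andP[q1 q2] := p_bounds; have d0 := dl0; have /andP[a1 a2] := al_bounds.
have /andP[b1 b2] := beta_bounds; have /andP[c1 c2] := beta_al.
rewrite (_ : v0 - variance = p * (1 - p) * (- ((beta - al) * nn) * (1 - al - beta) * nn / 2 -
   al * (1 - al) * nn / 2)); last first.
  have e : Np = nn * (nn - 1) / 2 by rewrite /Np natr_bin2.
  rewrite /v0 /variance e; by move: al beta (p) nn => x1 x2 x3 x4; field.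
rewrite normrM ger0_norm; last lra.
have x1 : 0 <= (beta - al) * nn <= 1.
  by rewrite mulr_ge0 ?(ltW n0)//=; have := ler_wpM2r (ltW n0) c2; rewrite mulVf ?gt_eqF.
move: x1; set y := (beta - al) * nn => /andP[y1 y2].
have d2 : 0 <= delta ^+ 2 by exact: sqr_ge0.
have a3 : 0 <= al * (1 - al) <= 4^-1.
  by apply/andP; split; have := sqr_ge0 (al - 2^-1); [move=> _; rewrite mulr_ge0//; lra|lra].
move: a3 => /andP[a3 a4].
have t1 : `|y * (1 - al - beta)| <= 1.
  rewrite normrM -[leRHS]mulr1; apply: ler_pM => //; rewrite ler_norml; lra.
move: t1; rewrite ler_norml => /andP[t1 t2].
have : `|- y * (1 - al - beta) * nn / 2 - al * (1 - al) * nn / 2| <= nn.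
  have u1 : - nn <= y * (1 - al - beta) * nn by have := ler_wpM2r (ltW n0) t1; lra.
  have u2 : y * (1 - al - beta) * nn <= nn by have := ler_wpM2r (ltW n0) t2; lra.
  have u3 : 0 <= al * (1 - al) * nn by rewrite mulr_ge0// ltW.
  have u4 : al * (1 - al) * nn <= 4^-1 * nn by rewrite ler_wpM2r// ltW.
  by rewrite ler_norml; lra.
move=> h; apply: le_trans (_ : 1 * nn <= _); last by rewrite mul1r.
by apply: ler_pM => //; lra.
Qed.

Let s : R := Num.sqrt (lambda R n M k * nn ^+ 2).

Let sE : s ^+ 2 = variance.
Proof.
have /andP[h _] := variance_bounds; rewrite /s lambdaE sqr_sqrtr//.
by apply: le_trans h; rewrite divr_ge0// mulr_ge0 ?exprn_ge0// ltW.
Qed.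

Let s_bounds : delta ^+ 2 * nn / 2 <= s <= nn.
Proof.
have [_ n0] := n_big; have /andP[h1 h2] := variance_bounds; rewrite -sE in h1 h2.
have s0 : 0 <= s by exact: sqrtr_ge0.
have l0 : 0 <= delta ^+ 2 * nn / 2 by rewrite divr_ge0// mulr_ge0 ?sqr_ge0// ltW.
apply/andP; split.
  rewrite -(ler_pXn2r (n := 2)) ?nnegrE//; apply: le_trans h1; rewrite le_eqVlt.
  by apply/orP; left; apply/eqP; field.
rewrite -(ler_pXn2r (n := 2)) ?nnegrE// ?(ltW n0)//; apply: le_trans h2 _.
by have := sqr_ge0 nn; lra.
Qed.

(** At least u^4 standard deviations, as s <= n, so the tails have order exp(-c u^8); yet W is small
    against [m], the common lower bound of the cell means, which is quadratic in n. *)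
Let W : R := nn * u ^+ 4.
Let m : R := delta ^+ 3 * nn ^+ 2 / 8.
(** Since n times the peak is at most u^2/32, a relative error u^(-6) leaves u^(-4) after
    multiplication by n. *)
Let kap : R := u ^- 6.

Let dinv : delta^-1 <= u / 64.
Proof. by have := u_ge; lra. Qed.

Let u0 : 0 < u. Proof. by have := u_ge128; lra. Qed.

Let u1 : 1 <= u. Proof. by have := u_ge128; lra. Qed.

(** Powers of 1/delta are traded for powers of [u]; the factors 64 leave room for numerical
    constants. *)
Let dinv_pow (j : nat) : (delta ^+ j)^-1 * 64 ^+ j <= u ^+ j.
Proof.
rewrite -exprVn -exprMn; apply: lerXn2r; rewrite ?nnegrE.
- by rewrite mulr_ge0// invr_ge0 ltW.
- exact: ltW.
- by have := dinv; lra.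
Qed.

Let E0 : R := expR (- (u / 24)).

Let E0_small : E0 * u ^+ 300 <= 1.
Proof.
have e : E0 * expR (u / 24) = 1 by rewrite -expRD addNr expR0.
by rewrite -[leRHS]e ler_wpM2l// expR_ge0.
Qed.

(** A constant up to 128 costs one further power of [u]. *)
Let E0_pow (j : nat) (c : R) : (j < 300)%N -> c <= 128 -> c * E0 * u ^+ j <= 1.
Proof.
move=> j300 c1; apply: le_trans E0_small; rewrite [c * E0]mulrC -mulrA.
apply: ler_wpM2l; first exact: expR_ge0.
apply: (@le_trans _ _ (u ^+ j.+1)); last by rewrite ler_weXn2l.
rewrite exprS; apply: ler_wpM2r; first by rewrite exprn_ge0// ltW.
by have := u_ge128; lra.
Qed.

Let s0 : 0 < s.
Proof.
have /andP[h _] := s_bounds; have [_ n0] := n_big.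
by apply: lt_le_trans h; rewrite divr_gt0// mulr_gt0// exprn_gt0.
Qed.

Let s_inv : (s ^+ 2)^-1 <= u ^+ 4 / nn ^+ 2 / 16.
Proof.
have /andP[h _] := variance_bounds; have [_ n0] := n_big; rewrite -sE in h.
have d4 : 0 < delta ^+ 4 by rewrite exprn_gt0.
apply: (@le_trans _ _ (delta ^+ 4 * nn ^+ 2 / 4)^-1).
  by rewrite lef_pV2 ?posrE ?exprn_gt0 ?divr_gt0 ?mulr_gt0.
rewrite (_ : _^-1 = (delta ^+ 4)^-1 * 64 ^+ 4 * (4 / 64 ^+ 4 / nn ^+ 2)); last first.
  by field; rewrite !gt_eqF.
apply: le_trans (ler_wpM2r _ (dinv_pow 4)) _; first by rewrite !divr_ge0// ltW.
rewrite [leLHS](_ : _ = u ^+ 4 / nn ^+ 2 * (4 / 64 ^+ 4)); last by field; rewrite gt_eqF.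
by apply: ler_wpM2l; [rewrite divr_ge0// ?exprn_ge0// ltW|lra].
Qed.

Let m0 : 0 < m.
Proof.
by have [_ n0] := n_big; rewrite divr_gt0// mulr_gt0 ?exprn_gt0.
Qed.

Let m_inv : m^-1 <= u ^+ 3 / nn ^+ 2 / 16.
Proof.
have [_ n0] := n_big.
have d4 : 0 < delta ^+ 3 by rewrite exprn_gt0.
rewrite (_ : _^-1 = (delta ^+ 3)^-1 * 64 ^+ 3 * (8 / 64 ^+ 3 / nn ^+ 2)); last first.
  by rewrite /m; field; rewrite !gt_eqF.
apply: le_trans (ler_wpM2r _ (dinv_pow 3)) _; first by rewrite !divr_ge0// ltW.
rewrite [leLHS](_ : _ = u ^+ 3 / nn ^+ 2 * (8 / 64 ^+ 3)); last by field; rewrite gt_eqF.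
by apply: ler_wpM2l; [rewrite divr_ge0// ?exprn_ge0// ltW|lra].
Qed.

Let mE : [/\ m <= mu, m <= K%:R - mu, m <= M%:R - mu & m <= N%:R - K%:R - M%:R + mu].
Proof.
have [e1 e2 e3 e4] := abcdE; rewrite e4 e3 e2 e1.
have /andP[a1 a2] := al_bounds; have /andP[p1 p2] := hM; have /andP[n1 _] := edge_count_bounds.
have d0 := dl0; have [_ n0] := n_big.
have key (y w : R) : delta ^+ 2 / 2 <= y -> delta <= w -> m <= y * w * Np.
  move=> hy hw; rewrite (_ : m = delta ^+ 2 / 2 * delta * (nn ^+ 2 / 4)); last by rewrite /m; field.
  have x1 : 0 <= delta ^+ 2 / 2 by rewrite divr_ge0// sqr_ge0.
  have x3 : 0 <= nn ^+ 2 / 4 by rewrite divr_ge0// sqr_ge0.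
  apply: ler_pM => //; first by rewrite mulr_ge0// ltW.
  by apply: ler_pM => //; exact: ltW.
have d2 : delta ^+ 2 / 2 <= delta by nra.
by split; apply: key; lra.
Qed.

Let n_pow (j : nat) : (j <= 32)%N -> u ^+ j <= nn.
Proof. by move=> j32; rewrite nu ler_weXn2l. Qed.

Let s_ge1 : 1 <= s.
Proof.
have /andP[h _] := s_bounds; apply: le_trans h.
have := ler_wpM2l (sqr_ge0 delta) (@n_pow 2 isT); rewrite -exprMn mulrC.
have := ud; set y := delta * u; rewrite (_ : u * delta = y) 1?mulrC//.
rewrite (_ : (delta * u) ^+ 2 = y ^+ 2)//; nra.
Qed.

Let W_ge : 128 <= W.
Proof.
have n1 := nnu; have : 1 <= u ^+ 4 by rewrite exprn_ege1.
by rewrite /W; nra.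
Qed.

Let Wm : 2 * (W + 2) <= m.
Proof.
have [_ n0] := n_big; apply: (@le_trans _ _ (4 * W)); first by have := W_ge; lra.
have mi := m_inv; rewrite -(ler_pV2) ?inE ?unitfE ?gt_eqF ?m0 ?mulr_gt0 ?exprn_gt0//.
apply: le_trans mi _; rewrite -[leRHS]mul1r ler_pdivlMr ?mulr_gt0 ?exprn_gt0//.
rewrite [leLHS](_ : _ = u ^+ 7 / nn / 4); last by rewrite /W; field; rewrite gt_eqF.
have : u ^+ 7 / nn <= 1 by rewrite ler_pdivrMr// mul1r n_pow.
by lra.
Qed.

Let v0_gt0 : 0 < v0.
Proof.
have [_ n0] := n_big; apply: lt_le_trans v0_bounds.
by rewrite divr_gt0// mulr_gt0// exprn_gt0.
Qed.

(** The sum of inverses is 1/v0, and 1/v0 - 1/s^2 = (s^2 - v0)/(v0 s^2), where the numerator is O(n)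
    and each denominator has order n^2. *)
Let inverse_sum : `|mu^-1 + (K%:R - mu)^-1 + (M%:R - mu)^-1 + (N%:R - K%:R - M%:R + mu)^-1
  - (s ^+ 2)^-1| <= u ^+ 8 / nn ^+ 3.
Proof.
have [e1 e2 e3 e4] := abcdE; have [_ n0] := n_big.
have /andP[a1 a2] := al_bounds; have /andP[p1 p2] := hM; have d0 := dl0.
have al0 : 0 < al by apply: lt_le_trans a1; rewrite divr_gt0 ?exprn_gt0.
have Np0 : Np != 0 by rewrite gt_eqF.
have -> : mu^-1 + (K%:R - mu)^-1 + (M%:R - mu)^-1 + (N%:R - K%:R - M%:R + mu)^-1 = v0^-1.
  rewrite e4 e3 e2 e1 /v0.
  have x1 : 1 - al != 0 by rewrite gt_eqF//; lra.
  have x2 : 1 - p != 0 by rewrite gt_eqF//; lra.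
  have x3 : p != 0 by rewrite gt_eqF//; lra.
  have x4 : al != 0 by rewrite gt_eqF.
  move: al (p) Np x1 x2 x3 x4 Np0 => y w z *; field.
  by apply/and5P; split.
have ss : 0 < s ^+ 2 by rewrite exprn_gt0.
rewrite (_ : v0^-1 - _ = (variance - v0) * (v0^-1 * (s ^+ 2)^-1)); last first.
  by rewrite -sE; field; rewrite !gt_eqF.
have vs0 : 0 <= v0^-1 * (s ^+ 2)^-1 by rewrite mulr_ge0// invr_ge0 ltW.
rewrite normrM distrC [`|_ * _|]ger0_norm//.
have v_inv : v0^-1 <= u ^+ 4 / nn ^+ 2.
  have d4 : 0 < delta ^+ 4 by rewrite exprn_gt0.
  have n2 : 0 < nn ^+ 2 by rewrite exprn_gt0.
  apply: (@le_trans _ _ (delta ^+ 4 * nn ^+ 2 / 16)^-1).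
    have X : 0 < delta ^+ 4 * nn ^+ 2 / 16 by rewrite divr_gt0// mulr_gt0.
    by rewrite lef_pV2 ?posrE//; exact: v0_bounds.
  rewrite (_ : _^-1 = (delta ^+ 4)^-1 * 64 ^+ 4 * (16 / 64 ^+ 4 / nn ^+ 2)); last first.
    by field; rewrite !gt_eqF.
  apply: le_trans (ler_wpM2r _ (dinv_pow 4)) _; first by rewrite !divr_ge0// ltW.
  rewrite [leLHS](_ : _ = u ^+ 4 / nn ^+ 2 * (16 / 64 ^+ 4)); last by field; rewrite gt_eqF.
  by rewrite ler_piMr ?divr_ge0 ?exprn_ge0 ?(ltW u0)//; lra.
have u4n : 0 <= u ^+ 4 / nn ^+ 2 by rewrite divr_ge0// exprn_ge0 ?(ltW u0)// ltW.
rewrite [leRHS](_ : _ = nn * (u ^+ 4 / nn ^+ 2 * (u ^+ 4 / nn ^+ 2))); last first.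
  by field; rewrite gt_eqF.
apply: ler_pM => //.
apply: ler_pM; rewrite ?invr_ge0 ?(ltW v0_gt0) ?(ltW ss)//.
by apply: le_trans s_inv _; lra.
Qed.

Local Notation eta := (ratio_error mu (K%:R - mu) (M%:R - mu) (N%:R - K%:R - M%:R + mu) m s (W + 2)).

Let eta_le : eta <= 8 * u ^+ 14 / nn ^+ 2.
Proof.
have [_ n0] := n_big; have wg := W_ge.
have n2 : 0 < nn ^+ 2 by rewrite exprn_gt0.
pose z : R := (nn ^+ 2)^-1; have z0 : 0 <= z by rewrite invr_ge0 ltW.
have up (i j : nat) : (i <= j)%N -> u ^+ i * z <= u ^+ j * z.
  by move=> ij; rewrite ler_wpM2r// ler_weXn2l.
have t1 : (W + 2) * `|mu^-1 + (K%:R - mu)^-1 + (M%:R - mu)^-1 + (N%:R - K%:R - M%:R + mu)^-1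
     - (s ^+ 2)^-1| <= 2 * (u ^+ 12 * z).
  apply: (@le_trans _ _ (2 * W * (u ^+ 8 / nn ^+ 3))).
    by apply: ler_pM => //; lra.
  by rewrite le_eqVlt /W /z; apply/orP; left; apply/eqP; field; rewrite gt_eqF.
have t2 : ((W + 2) / m) ^+ 2 <= u ^+ 14 * z.
  have h : (W + 2) / m <= u ^+ 7 / nn.
    apply: (@le_trans _ _ (2 * W * (u ^+ 3 / nn ^+ 2 / 16))).
      by apply: ler_pM; [lra|rewrite invr_ge0 ltW|lra|exact: m_inv].
    rewrite [leLHS](_ : _ = u ^+ 7 / nn / 8); last by rewrite /W; field; rewrite gt_eqF.
    have : 0 <= u ^+ 7 / nn by rewrite divr_ge0 ?exprn_ge0 ?(ltW u0)// ltW.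
    by lra.
  rewrite (_ : u ^+ 14 * z = (u ^+ 7 / nn) ^+ 2); last by rewrite /z; field; rewrite gt_eqF.
  apply: lerXn2r => //; rewrite nnegrE; last by rewrite divr_ge0 ?exprn_ge0 ?(ltW u0)// ltW.
  by rewrite divr_ge0 ?(ltW m0)//; lra.
have t3 : 2 / m <= u ^+ 3 * z.
  have := m_inv; have : 0 <= u ^+ 3 / nn ^+ 2 by rewrite divr_ge0 ?exprn_ge0 ?(ltW u0)// ltW.
  by rewrite /z; lra.
have t4 : (2 * s ^+ 2)^-1 <= u ^+ 4 * z.
  have := s_inv; rewrite invfM; have : 0 <= u ^+ 4 / nn ^+ 2 by rewrite divr_ge0 ?exprn_ge0 ?(ltW u0)// ltW.
  by rewrite /z; lra.
have := up 12 14 isT; have := up 3 14 isT; have := up 4 14 isT.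
rewrite /ratio_error -/z; rewrite -/z in t1 t2 t3 t4 *.
have : 0 <= u ^+ 14 * z by rewrite mulr_ge0// exprn_ge0// ltW.
lra.
Qed.

Let s_le : s ^+ 2 <= nn ^+ 2 / 32.
Proof. by have /andP[_ h] := variance_bounds; rewrite sE. Qed.

Let error_le : eta * (2 * W + 3) + (2 * W + 3) / (2 * s ^+ 2) <= kap.
Proof.
have [_ n0] := n_big; have wg := W_ge.
have e := eta_le.
have u0' := u0.
have x1 : eta * (2 * W + 3) <= 24 * u ^+ 18 / nn.
  apply: (@le_trans _ _ (8 * u ^+ 14 / nn ^+ 2 * (3 * W))).
    apply: (@le_trans _ _ (8 * u ^+ 14 / nn ^+ 2 * (2 * W + 3))).
      by apply: ler_wpM2r => //; lra.
    apply: ler_wpM2l; last by lra.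
    by rewrite divr_ge0 ?mulr_ge0 ?exprn_ge0 ?(ltW u0)// ltW.
  by rewrite le_eqVlt /W; apply/orP; left; apply/eqP; field; rewrite gt_eqF.
have x2 : (2 * W + 3) / (2 * s ^+ 2) <= u ^+ 18 / nn.
  rewrite invfM; apply: (@le_trans _ _ (3 * W * (2^-1 * (u ^+ 4 / nn ^+ 2 / 16)))).
    apply: ler_pM; [lra| |lra|].
      by rewrite mulr_ge0// invr_ge0 sqr_ge0.
    by apply: ler_wpM2l => //; exact: s_inv.
  rewrite [leLHS](_ : _ = u ^+ 8 / nn * (3 / 32)); last by rewrite /W; field; rewrite gt_eqF.
  have y1 : u ^+ 8 / nn <= u ^+ 18 / nn by rewrite ler_wpM2r ?invr_ge0 ?(ltW n0)// ler_weXn2l.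
  have y2 : 0 <= u ^+ 8 / nn by rewrite divr_ge0 ?exprn_ge0 ?(ltW u0)// ltW.
  by lra.
have x3 : 25 * (u ^+ 18 / nn) <= kap.
  rewrite /kap nu -[leRHS]mul1r ler_pdivlMr ?exprn_gt0//.
  rewrite [leLHS](_ : _ = 25 / u ^+ 8); last by field; rewrite gt_eqF.
  rewrite ler_pdivrMr ?exprn_gt0// mul1r.
  have h := u_ge128; apply: (@le_trans _ _ (u ^+ 1)); first by rewrite expr1; lra.
  by rewrite ler_weXn2l.
by lra.
Qed.

Let W2 : nn ^+ 2 * u ^+ 8 = W ^+ 2. Proof. by rewrite /W; ring. Qed.

Let W_ratio : 32 * u ^+ 8 <= W ^+ 2 / s ^+ 2.
Proof.
have ss : 0 < s ^+ 2 by rewrite exprn_gt0.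
rewrite ler_pdivlMr// -W2; have := ler_wpM2l (exprn_ge0 8 (ltW u0)) s_le.
by lra.
Qed.

Let u8 : u / 24 <= u ^+ 8.
Proof.
have h : u ^+ 1 <= u ^+ 8 by rewrite ler_weXn2l.
by rewrite expr1 in h; have := u0; lra.
Qed.

Let kapE (c : R) : c * u ^+ 6 <= 1 -> c <= kap.
Proof. by move=> h; rewrite /kap -[leRHS]mul1r ler_pdivlMr ?exprn_gt0. Qed.

Let tail1 : Num.sqrt 2 * expR (- (W ^+ 2 / (4 * s ^+ 2))) <= kap.
Proof.
apply: kapE; apply: le_trans (@E0_pow 6 2 isT _); last by lra.
apply: ler_wpM2r; first by rewrite exprn_ge0// ltW.
apply: ler_pM; rewrite ?sqrtr_ge0 ?expR_ge0//.
  by rewrite -[leRHS]ger0_norm// -sqrtr_sqr ler_wsqrtr//; lra.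
rewrite /E0 ler_expR lerN2 invfM mulrCA; have := W_ratio; have := u8; have := exprn_ge0 8 (ltW u0).
by lra.
Qed.

Let tail2 : 4 * expR (- ((W - 1) ^+ 2 / (2 * s ^+ 2))) <= 4 * E0.
Proof.
apply: ler_wpM2l => //; rewrite /E0 ler_expR lerN2 invfM mulrCA.
have h : W ^+ 2 / s ^+ 2 <= 4 * ((W - 1) ^+ 2 / s ^+ 2).
  rewrite mulrA ler_wpM2r ?invr_ge0 ?sqr_ge0//; have := W_ge; nra.
by have := W_ratio; have := u8; have := exprn_ge0 8 (ltW u0); lra.
Qed.

Let M_le : M.+1%:R <= u ^+ 64 :> R.
Proof.
have [_ MN] := edges_strict; have : M.+1%:R <= N%:R :> R by rewrite ler_nat.
have /andP[_ h] := edge_count_bounds; have := sqr_ge0 nn.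
by rewrite (_ : u ^+ 64 = nn ^+ 2); [lra|rewrite nu; ring].
Qed.

Let tail3 : M.+1%:R * (4 * expR (- ((W - 1) ^+ 2 / (2 * s ^+ 2)))) <= kap.
Proof.
apply: kapE; apply: le_trans (@E0_pow 70 4 isT _); last by lra.
rewrite [leRHS](_ : _ = u ^+ 64 * (4 * E0) * u ^+ 6); last by ring.
apply: ler_wpM2r; first by rewrite exprn_ge0// ltW.
by apply: ler_pM; rewrite ?mulr_ge0 ?expR_ge0.
Qed.

Let peak_ge : nn^-1 <= normal_peak s.
Proof.
have [_ n0] := n_big; rewrite /normal_peak lef_pV2 ?posrE//; last first.
  by rewrite sqrtr_gt0 pmulrn_lgt0// mulr_gt0 ?pi_gt0// exprn_gt0.
rewrite -[leRHS]ger0_norm ?(ltW n0)// -sqrtr_sqr ler_wsqrtr//.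
have p4 : pi <= 4 :> R by have := pihalf_lt2 R; lra.
have have p0 := pi_gt0 R; have sl := s_le.
rewrite -mulr_natl; nra.
Qed.

Let peak_le : nn * normal_peak s <= u ^+ 2 / 32.
Proof.
have [_ n0] := n_big; have /andP[h _] := s_bounds.
have h2 : normal_peak s <= s^-1.
  rewrite /normal_peak lef_pV2 ?posrE//; last first.
    by rewrite sqrtr_gt0 pmulrn_lgt0// mulr_gt0 ?pi_gt0// exprn_gt0.
  rewrite -[leLHS]ger0_norm ?(ltW s0)// -sqrtr_sqr ler_wsqrtr//.
  have p2 := pi_ge2 R; have := sqr_ge0 s; rewrite -[_ *+ 2]mulr_natl; nra.
have h3 : s^-1 <= (delta ^+ 2 * nn / 2)^-1.
  by rewrite lef_pV2 ?posrE// divr_gt0// mulr_gt0// exprn_gt0.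
apply: (@le_trans _ _ (nn * (delta ^+ 2 * nn / 2)^-1)).
  by apply: ler_wpM2l; [exact: ltW|exact: le_trans h3].
rewrite [leLHS](_ : _ = (delta ^+ 2)^-1 * 64 ^+ 2 * (2 / 64 ^+ 2)); last first.
  by field; rewrite !gt_eqF.
apply: le_trans (ler_wpM2r _ (dinv_pow 2)) _; first by rewrite divr_ge0.
by have := sqr_ge0 u; lra.
Qed.

Let tail4 : 4 * expR (- ((W - 1) ^+ 2 / (2 * s ^+ 2))) <= kap * normal_peak s.
Proof.
apply: le_trans tail2 _; have [_ n0] := n_big.
apply: (@le_trans _ _ (kap * nn^-1)); last first.
  by apply: ler_wpM2l; [rewrite invr_ge0 exprn_ge0// ltW|exact: peak_ge].
rewrite /kap nu -invfM -exprD -[leRHS]mul1r ler_pdivlMr ?exprn_gt0//.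
by apply: E0_pow => //; lra.
Qed.

Lemma hypergeometric_local_limit (z : nat) :
  nn * `|hypergeometric R N K M z - phi n M k z%:R| <= u ^- 4.
Proof.
have [k2 [kn n2]] := order_size_bounds; have [M0 MN] := edges_strict.
have [m1 m2 m3 m4] := mE; have wg := W_ge; have [_ n0] := n_big.
have KN : (K <= N)%N by exact: leq_bin2l.
have bcad : (K%:R - mu) * (M%:R - mu) = mu * (N%:R - K%:R - M%:R + mu).
  by have [e1 e2 e3 e4] := abcdE; rewrite e4 e3 e2 e1; ring.
have W1 : 1 <= W by lra.
have k4 : kap <= 4^-1.
  rewrite /kap lef_pV2 ?posrE ?exprn_gt0//; apply: (@le_trans _ _ (u ^+ 1)).
    by rewrite expr1; have := u_ge128; lra.
  by rewrite ler_weXn2l.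
have H := local_limit_of_step_ratio (hypergeometric_ge0 R N K M) (@hypergeometric_out R N K M)
  (sum_hypergeometric R KN (ltnW MN)) _ m1 m2 m3 m4 s_ge1 W1 Wm bcad k4 error_le tail1 tail3 tail4 z.
apply: (@le_trans _ _ (nn * (20 * kap * normal_peak s))).
  apply: ler_wpM2l; first exact: ltW.
  by apply: H => y; exact: hypergeometric_rec.
rewrite mulrCA; apply: (@le_trans _ _ (20 * kap * (u ^+ 2 / 32))).
  by apply: ler_wpM2l; [rewrite mulr_ge0// invr_ge0 exprn_ge0// ltW|exact: peak_le].
rewrite [leLHS](_ : _ = u ^- 4 * (20 / 32)); last by rewrite /kap; field; rewrite gt_eqF.
apply: ler_piMr; first by rewrite invr_ge0 exprn_ge0// ltW.
by rewrite ler_pdivrMr// mul1r ler_nat.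
Qed.

(** Serves the negative integers z. The mean exceeds W, so such points lie in the tail of the
    density. *)
Lemma phi_negative (y : R) : y <= 0 -> nn * `|phi n M k y| <= u ^- 4.
Proof.
move=> y0; have [m1 _ _ _] := mE; have [_ n0] := n_big; have wg := W_ge; have wm := Wm.
rewrite /phi ger0_norm ?normal_pdf_ge0// normal_pdfE ?gt_eqF ?s0//.
rewrite -/mu -/s /normal_fun mulrA.
have W2y : W ^+ 2 <= (y - mu) ^+ 2 by rewrite -[leRHS]sqrrN; apply: lerXn2r; rewrite ?nnegrE; lra.
have h : expR (- (y - mu) ^+ 2 / (s ^+ 2 *+ 2)) <= E0.
  rewrite /E0 ler_expR mulNr lerN2.
  have i0 : 0 <= (s ^+ 2 *+ 2)^-1 by rewrite invr_ge0 mulrn_wge0// sqr_ge0.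
  apply: le_trans (ler_wpM2r i0 W2y).
  rewrite -[s ^+ 2 *+ 2]mulr_natl invfM mulrCA.
  by have := W_ratio; have := u8; have := exprn_ge0 8 (ltW u0); lra.
apply: (@le_trans _ _ (u ^+ 2 / 32 * E0)).
  apply: ler_pM; rewrite ?expR_ge0//.
  by rewrite mulr_ge0 ?(ltW n0)// invr_ge0 sqrtr_ge0.
rewrite -[leRHS]mul1r ler_pdivlMr ?exprn_gt0//.
rewrite [leLHS](_ : _ = 32^-1 * E0 * u ^+ 6); last by ring.
by apply: E0_pow => //; lra.
Qed.

End DenseRegime.

(** * Concentration of the edge count distribution over the random graph *)

Lemma edge_dev_le1 (R : realType) (n k : nat) (e S : {set 'I_n}) :
  (k <= n)%N -> `|edge_dev R k e S| <= 1.
Proof.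
move=> kn; rewrite /edge_dev; case: eqP => _; last by rewrite mul0r normr0.
have K1 : 0 <= ('C(k, 2)%:R / 'C(n, 2)%:R : R) <= 1.
  rewrite divr_ge0//=; have [->|n0] := eqVneq ('C(n, 2)%:R : R) 0.
    by rewrite invr0 mulr0 ler01.
  by rewrite ler_pdivrMr ?mul1r ?ler_nat ?leq_bin2l// lt_neqAle eq_sym n0 ler0n.
rewrite mul1r ler_norml; move: K1; set c := _ / _ => /andP[c0 c1].
by case: (e \subset S); rewrite /= ?mulr1n ?mulr0n; lra.
Qed.

Lemma expR2_le16 (R : realType) : expR 2 <= 16 :> R.
Proof.
have h : expR (2^-1) <= 2 :> R.
  have e : expR (2^-1) * expR (- 2^-1) = 1 :> R by rewrite -expRD subrr expR0.
  have := expR_ge1Dx (- 2^-1 : R); have := expR_ge0 (2^-1 : R); nra.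
have -> : 2 = 4%:R * 2^-1 :> R by lra.
rewrite expRM_natl; apply: le_trans (_ : 2 ^+ 4 <= _); last by lra.
by rewrite lerXn2r// nnegrE ?expR_ge0.
Qed.

Lemma expR_half_le2X (R : realType) (m : nat) : expR (m%:R / 2) <= (2 ^ m)%:R :> R.
Proof.
rewrite expRM_natl natrX lerXn2r ?nnegrE ?expR_ge0//.
have e : expR (2^-1) * expR (- 2^-1) = 1 :> R by rewrite -expRD subrr expR0.
by have := expR_ge1Dx (- 2^-1 : R); have := expR_ge0 (2^-1 : R); nra.
Qed.

Lemma expR_le_bin (R : realType) (n k : nat) : (k <= n)%N ->
  expR ((minn k (n - k))%:R / 2) <= 'C(n, k)%:R :> R.
Proof.
move=> kn; apply: le_trans (expR_half_le2X _ _) _; rewrite ler_nat.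
by rewrite -{2}(subnKC kn); exact: exp2_le_bin.
Qed.

Section Concentration.
Variables (R : realType) (delta u : R) (n k M : nat).
Hypothesis dl0 : 0 < delta.
Hypothesis hM : delta <= M%:R / 'C(n, 2)%:R <= 1 - delta.
Hypothesis hk : delta <= k%:R / n%:R <= 1 - delta.
Hypothesis nu : n%:R = u ^+ 32.
Hypothesis u_ge : 64 / delta <= u.
Hypothesis u_ge2 : 32 <= delta ^+ 2 * u.
Hypothesis u_exp : u ^+ 300 <= expR (u / 24).

Local Notation nn := (n%:R : R).
Local Notation q := (M%:R / 'C(n, 2)%:R : R).
Local Notation Ex := (expect (bernoulli_weight (@pair_prob R n q))).
Local Notation f := (cos_average (@subset_weight R n k) (@edge_dev R n k)).

Let u128 : 128 <= u. Proof. exact: u_ge128 dl0 hk u_ge. Qed.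
Let u0 : 0 < u. Proof. by have := u128; lra. Qed.
Let u1 : 1 <= u. Proof. by have := u128; lra. Qed.
Let n0 : 0 < nn. Proof. by rewrite nu exprn_gt0. Qed.
Let sizes := order_size_bounds dl0 hk nu u_ge.
Let k2 : (2 <= k)%N. Proof. by have [] := sizes. Qed.
Let kn : (k <= n)%N. Proof. by have [_ []] := sizes. Qed.
Let w0 := @subset_weight_ge0 R n k.
Let w1 := sum_subset_weight R kn.

Let q01 : 0 <= q <= 1.
Proof. by have /andP[h1 h2] := hM; have d0 := dl0; apply/andP; split; lra. Qed.

Let p01 := pair_prob01 (n := n) q01.

(** Only a fraction of order u^2/n of the frequencies is low, so u^(-5) suffices for them. The
    others are essentially all, and u^(-40) leaves u^(-8) after multiplication by n = u^32. *)
Definition tolerance (t : R) : R := if t <= u ^+ 2 / nn then u ^- 5 else u ^- 40.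

(** The squared gradient is at most 2 t^2 (n u^16 + 2n) + 2 t^4 N, where u^16 is the square root of
    n; its leading term is 2 u^(-12), whence v = 3 u^(-12). The parameter l = u^6/6 keeps l^2 v
    below 1 and makes l u^(-5) = u/6. *)
Let low t a : 0 <= t -> t <= u ^+ 2 / nn ->
  Ex (fun G => (u ^- 5 <= `|f t a G - Ex (f t a)|)%R%:R) <= 2 * expR (2 - u / 6).
Proof.
move=> t0 tu; pose v : R := 3 / u ^+ 12.
have un (i : nat) : 0 < u ^+ i by rewrite exprn_gt0.
have -> : u / 6 = (u ^+ 6 / 6) * u ^- 5 by field; rewrite gt_eqF.
apply: (bernoulli_concentration (v := v) p01).
- by rewrite divr_ge0// ltW.
- by rewrite divr_ge0// ltW.
- move=> G; pose A := [set e : {set 'I_n} | #|e| == 2%N]%SET.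
  have bA e S : e \notin A -> edge_dev R k e S = 0.
    by rewrite inE => /negbTE h; rewrite /edge_dev h mul0r.
  apply: le_trans (sum_edge_diff_cos_average w0 w1 t a G _ bA) _.
    by move=> e S; exact: edge_dev_le1.
  have r2 : (u ^+ 16) ^+ 2 = nn by rewrite nu -exprM.
  have Q := expect_edge_dev_corr_le k2 kn (un 16%N) r2.
  rewrite card_pairs; have /andP[_ Nn] := edge_count_bounds dl0 hk nu u_ge.
  have t2 : t ^+ 2 <= (u ^+ 2 / nn) ^+ 2 by rewrite lerXn2r ?nnegrE ?divr_ge0 ?(ltW n0) ?(ltW (un _)).
  have t4 : t ^+ 4 <= (u ^+ 2 / nn) ^+ 4 by rewrite lerXn2r ?nnegrE ?divr_ge0 ?(ltW n0) ?(ltW (un _)).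
  have c1 : 2 * t ^+ 2 * (nn * u ^+ 16 + 2 * nn) <= 2 * (u ^+ 2 / nn) ^+ 2 * (nn * u ^+ 16 + 2 * nn).
    apply: ler_wpM2r; last by apply: ler_wpM2l.
    by rewrite addr_ge0// mulr_ge0// ltW.
  have c2 : 2 * t ^+ 4 * 'C(n, 2)%:R <= 2 * (u ^+ 2 / nn) ^+ 4 * (nn ^+ 2 / 2).
    by apply: ler_pM => //; [rewrite mulr_ge0// exprn_ge0|apply: ler_wpM2l].
  have c0 : 2 * t ^+ 2 * expect (@subset_weight R n k) (fun S => expect (@subset_weight R n k)
     (fun S' => `|\sum_e edge_dev R k e S * edge_dev R k e S'|)) <=
     2 * t ^+ 2 * (nn * u ^+ 16 + 2 * nn).
    by apply: ler_wpM2l => //; rewrite mulr_ge0// sqr_ge0.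
  apply: le_trans (lerD (le_trans c0 c1) c2) _.
  rewrite nu [leLHS](_ : _ = (2 + 4 / u ^+ 16 + u ^- 44) / u ^+ 12); last by field; rewrite gt_eqF.
  rewrite /v ler_wpM2r ?invr_ge0 ?(ltW (un _))//.
  have i16 : (u ^+ 16)^-1 <= 128^-1.
    rewrite lef_pV2 ?posrE//; apply: le_trans u128 _; rewrite -[leLHS]expr1 ler_weXn2l//.
  have i44 : (u ^+ 44)^-1 <= 128^-1.
    rewrite lef_pV2 ?posrE//; apply: le_trans u128 _; rewrite -[leLHS]expr1 ler_weXn2l//.
  by lra.
- by move=> G; exact: cos_average_le1.
- rewrite /v [leLHS](_ : _ = 12^-1); last by field; rewrite gt_eqF.
  by lra.
Qed.

Let E1_small : u ^+ 80 * expR (- (u / 2)) <= expR (- (u / 6)).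
Proof.
have h : u ^+ 80 <= expR (u / 24) by apply: le_trans u_exp; rewrite ler_weXn2l.
apply: le_trans (ler_wpM2r (expR_ge0 _) h) _.
by rewrite -expRD ler_expR; have := u0; lra.
Qed.

(** As n + 1 <= exp(u/24), the numerator is at most exp(u^31/12), while C(n, k) >= exp(delta n / 2)
    with n = u^32. *)
Let ball : n.+1%:R ^+ (2 * Num.truncn (u ^+ 30)) / 'C(n, k)%:R <= expR (- (u / 2)).
Proof.
have u30 : 0 <= u ^+ 30 by rewrite exprn_ge0// ltW.
have /andP[r1 r2] := truncn_itv u30; set r := Num.truncn _ in r1 r2 *.
have C0 : 0 < 'C(n, k)%:R :> R by rewrite ltr0n bin_gt0.
have n1 : n.+1%:R <= expR (u / 24) :> R.
  apply: le_trans u_exp; apply: (@le_trans _ _ (u ^+ 33)); last by rewrite ler_weXn2l.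
  have e1 : 1 <= u ^+ 32 by rewrite exprn_ege1.
  by rewrite -natr1 nu exprS; have := u128; nra.
have h1 : n.+1%:R ^+ (2 * r) <= expR (u ^+ 31 / 12) :> R.
  apply: (@le_trans _ _ (expR (u / 24) ^+ (2 * r))).
    by apply: lerXn2r; rewrite ?nnegrE ?expR_ge0.
  rewrite -expRM_natl ler_expR natrM exprSr -/r.
  have := ler_wpM2r (ltW u0) r1; lra.
have h2 : expR (delta * nn / 2) <= 'C(n, k)%:R.
  apply: le_trans (expR_le_bin R kn); rewrite ler_expR ler_wpM2r ?invr_ge0//.
  have /andP[k1 kk2] := hk; move: k1 kk2; rewrite ler_pdivlMr// ler_pdivrMr// => k1 kk2.
  rewrite /minn; case: ifP => _//; rewrite natrB//; lra.
rewrite ler_pdivrMr//; apply: le_trans h1 _.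
apply: le_trans (ler_wpM2l (expR_ge0 _) h2); rewrite -expRD ler_expR.
have e31 : u ^+ 31 <= delta * nn / 64.
  have d : 64 <= u * delta by have := u_ge; rewrite ler_pdivrMr.
  have u31 : 0 <= u ^+ 31 by rewrite exprn_ge0// ltW.
  by rewrite nu (exprS u 31); have := ler_wpM2r u31 d; lra.
have e1 : u <= u ^+ 31 by rewrite -[leLHS]expr1 ler_weXn2l.
by have := u0; lra.
Qed.

(** Chebyshev's inequality with the second moment bound. The far pairs have exponent at least
    (delta/2)(u^4/(8 n^2))(u^30/2)(delta n/2) = delta^2 u^2 / 64 >= u/2, and the loss u^80 from
    Chebyshev is absorbed by the exponential. *)
Let high t a : t <= pi -> u ^+ 2 / nn < t ->
  Ex (fun G => (u ^- 40 <= `|f t a G - Ex (f t a)|)%R%:R) <= 2 * expR (2 - u / 6).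
Proof.
move=> tpi tu; have un (i : nat) : 0 < u ^+ i by rewrite exprn_gt0.
have t0 : 0 <= t by apply: ltW (lt_trans _ tu); rewrite divr_gt0.
have bw0 := bernoulli_weight_ge0 p01.
have s0 : 0 < u ^- 40 by rewrite invr_gt0.
apply: (@le_trans _ _ (Ex (fun G => ((u ^- 40) ^+ 2 <= (f t a G - Ex (f t a)) ^+ 2)%R%:R))).
  apply: ler_expect => // G; rewrite -[(_ - _) ^+ 2]real_normK ?num_real//.
  by rewrite ler_pXn2r ?nnegrE// ltW.
apply: le_trans (markov_expect bw0 _ _) _; first by rewrite exprn_gt0.
  by move=> G; exact: sqr_ge0.
have sbw := @sum_bernoulli_weight R _ (@pair_prob R n q).
rewrite (expect_variance sbw).
rewrite ler_pdivrMr ?exprn_gt0//.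
apply: (@le_trans _ _ (Ex (fun G => f t a G ^+ 2))); first by rewrite gerBl sqr_ge0.
apply: le_trans (expect_sqr_cos_average_le p01 w0 _ _ _) _.
apply: le_trans (expect_exp_edge_dist_le k2 kn t (Num.truncn (u ^+ 30)) q01) _.
have u30 : 0 <= u ^+ 30 by exact: ltW.
have tail : expR (- (q * (1 - q) * (1 - cos t) * ((Num.truncn (u ^+ 30))%:R * (k%:R - 1)))) <=
    expR (- (u / 2)).
  rewrite ler_expR lerN2.
  have ct := one_minus_cos_ge (t := t); rewrite t0 tpi in ct; have {}ct := ct isT.
  have t2 : u ^+ 4 / nn ^+ 2 <= t ^+ 2.
    rewrite (_ : u ^+ 4 / nn ^+ 2 = (u ^+ 2 / nn) ^+ 2); last by field; rewrite gt_eqF.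
    by apply: lerXn2r; rewrite ?nnegrE// ?divr_ge0 ?(ltW n0) ?(ltW (un _))// ltW.
  have ct2 : u ^+ 4 / nn ^+ 2 / 8 <= 1 - cos t by lra.
  have /andP[_ r2] := truncn_itv u30.
  have r3 : u ^+ 30 / 2 <= (Num.truncn (u ^+ 30))%:R :> R.
    have : u <= u ^+ 30 by rewrite -[leLHS]expr1 ler_weXn2l.
    by move: r2; rewrite -natr1; have := u128; lra.
  have d0 := dl0.
  have k3 : delta * nn / 2 <= k%:R - 1.
    have /andP[k1 _] := hk; move: k1; rewrite ler_pdivlMr// => k1.
    have dn : 2 <= delta * nn.
      have d : 64 <= u * delta by have := u_ge; rewrite ler_pdivrMr.
      have : u <= nn by rewrite nu -[leLHS]expr1 ler_weXn2l.
      by move=> un'; nra.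
    lra.
  have qq : delta / 2 <= q * (1 - q).
    by have /andP[h1 h2] := hM; move: q h1 h2 => y *; nra.
  apply: (@le_trans _ _ (delta / 2 * (u ^+ 4 / nn ^+ 2 / 8) * (u ^+ 30 / 2 * (delta * nn / 2)))).
    rewrite nu [leRHS](_ : _ = delta ^+ 2 * u * u / 64); last by field; rewrite gt_eqF.
    by have := ler_wpM2r (ltW u0) u_ge2; lra.
  have dd : 0 <= delta / 2 by rewrite divr_ge0// ltW.
  have x1 : 0 <= u ^+ 4 / nn ^+ 2 / 8 by rewrite !divr_ge0// ?sqr_ge0// ltW.
  have x2 : 0 <= u ^+ 30 / 2 by rewrite divr_ge0.
  have x3 : 0 <= delta * nn / 2 by rewrite divr_ge0// mulr_ge0// ltW.
  by apply: ler_pM; [rewrite mulr_ge0|rewrite mulr_ge0|apply: ler_pM|apply: ler_pM].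
apply: le_trans (lerD ball tail) _.
rewrite -exprVn -exprM [leRHS](_ : _ = 2 * expR (2 - u / 6) / u ^+ 80); last by rewrite exprVn.
rewrite ler_pdivlMr//.
have e2 : 1 <= expR 2 :> R by rewrite -[leLHS](@expR0 R) ler_expR.
rewrite expRD; have e0 := expR_ge0 (- (u / 6)).
have := E1_small; nra.
Qed.

Lemma cos_average_tail t a : 0 <= t <= pi ->
  Ex (fun G => (tolerance t <= `|f t a G - Ex (f t a)|)%R%:R) <= 2 * expR (2 - u / 6).
Proof.
move=> /andP[t0 tpi]; rewrite /tolerance.
by case: (leP t (u ^+ 2 / nn)) => tu; [exact: low|exact: high].
Qed.

Lemma count_le_real (m : nat) (Y : R) : 0 <= Y ->
  \sum_(j < m) (j.+1%:R <= Y)%R%:R <= Y.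
Proof.
move=> Y0; elim: m => [|m IH]; first by rewrite big_ord0.
rewrite big_ord_recr /=; case: (leP m.+1%:R Y) => h; last by rewrite addr0.
apply: le_trans h; rewrite -[leRHS]natr1 lerD2r.
apply: (@le_trans _ _ (\sum_(j < m) 1)); last by rewrite sumr_const card_ord.
by apply: ler_sum => j _; case: (j.+1%:R <= Y)%R; rewrite ?ler01.
Qed.

(** The total error of the Fourier inversion when every frequency stays within its tolerance. *)
Lemma sum_tolerance_le (m : nat) :
  nn * (m.*2.+1%:R^-1 * (2 * \sum_(j < m) tolerance (frequency R m j))) <= u ^- 3.
Proof.
have p2 := pi_ge2 R; have un (i : nat) : 0 < u ^+ i by rewrite exprn_gt0.
set L : R := m.*2.+1%:R; have L0 : 0 < L by rewrite ltr0n.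
(* Bounds the number of low frequencies; 4 is a lower bound for 2 pi. *)
pose Y : R := u ^+ 2 / nn * L / 4.
have Y0 : 0 <= Y by rewrite divr_ge0// mulr_ge0 ?divr_ge0 ?(ltW n0) ?(ltW (un _))// ltW.
have t1 : \sum_(j < m) tolerance (frequency R m j) <= Y * u ^- 5 + m%:R * u ^- 40.
  apply: (@le_trans _ _ (\sum_(j < m) ((j.+1%:R <= Y)%R%:R * u ^- 5 + u ^- 40))).
    apply: ler_sum => j _; rewrite /tolerance.
    have i5 : 0 <= u ^- 5 by rewrite invr_ge0 ltW.
    have i40 : 0 <= u ^- 40 by rewrite invr_ge0 ltW.
    case: (leP (frequency R m j) (u ^+ 2 / nn)) => h; last by rewrite lerDr mulr_ge0.
    rewrite (_ : (j.+1%:R <= Y)%R = true) ?mul1r ?lerDl//.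
    rewrite /Y ler_pdivlMr//; apply: le_trans (ler_wpM2r (ltW L0) h).
    rewrite /frequency divfK ?gt_eqF// mulrC ler_wpM2r//; lra.
  rewrite big_split /= sumr_const card_ord -mulr_suml mulr_natl lerD2r.
  by apply: ler_wpM2r; [rewrite invr_ge0 ltW|exact: count_le_real].
have mL : 2 * m%:R <= L.
  by rewrite /L -natrM ler_nat mul2n leqnSn.
apply: (@le_trans _ _ (nn * (L^-1 * (2 * (Y * u ^- 5 + m%:R * u ^- 40))))).
  apply: ler_wpM2l; first exact: ltW.
  apply: ler_wpM2l; first by rewrite invr_ge0 ltW.
  exact: ler_wpM2l.
rewrite [leLHS](_ : _ = u ^- 3 / 2 + u ^- 8 * (2 * m%:R / L)); last first.
  by rewrite /Y nu; field; rewrite !gt_eqF.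
have a1 : 2 * m%:R / L <= 1 by rewrite ler_pdivrMr// mul1r.
have a2 : u ^- 8 <= u ^- 3 / 2.
  rewrite (_ : u ^- 8 = u ^- 3 * u ^- 5); last by field; rewrite gt_eqF.
  apply: ler_wpM2l; first by rewrite invr_ge0 ltW.
  rewrite lef_pV2 ?posrE//; apply: (@le_trans _ _ (u ^+ 1)); last by rewrite ler_weXn2l.
  by rewrite expr1; have := u128; lra.
rewrite [leRHS]splitr lerD2l; apply: le_trans a2.
by apply: ler_piMr => //; rewrite invr_ge0 ltW.
Qed.

Local Notation N := 'C(n, 2).
Local Notation mu := ('C(k, 2)%:R * M%:R / N%:R : R).

Definition edge_count_pr (G : {set {set 'I_n}}) (z : nat) : R :=
  expect (@subset_weight R n k) (fun S => (induced_edges G S == z)%:R).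

(** The inversion formula with each cosine average replaced by its mean over the product space.
    Graphs with other numbers of edges enter this mean, so it is not itself the probability of an
    event. *)
Definition centre (z : nat) : R := N.*2.+1%:R^-1 *
  (1 + 2 * \sum_(j < N) Ex (f (frequency R N j) (frequency R N j * (z%:R - mu)))).

Lemma sum_edge_dev G S : G \in graphs_with_edges n M ->
  \sum_(e in G) edge_dev R k e S = (induced_edges G S)%:R - mu.
Proof.
rewrite mem_graphs_with_edges => /andP[GE /eqP GM].
rewrite (eq_bigr (fun e : {set 'I_n} => (e \subset S)%:R - 'C(k, 2)%:R / N%:R)); last first.
  by move=> e eG; rewrite /edge_dev; have := fintype.subsetP GE e eG; rewrite inE => ->; rewrite mul1r.
rewrite sumrB sumr_const GM; congr (_ - _); last by rewrite -[_ *+ M]mulr_natr mulrAC.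
rewrite /induced_edges -sum1_card natr_sum big_mkcond [RHS]big_mkcond.
by apply: eq_bigr => e _; rewrite inE; case: (e \in G); case: (e \subset S).
Qed.

Lemma induced_edges_le G S : G \in graphs_with_edges n M -> (induced_edges G S <= M)%N.
Proof.
rewrite mem_graphs_with_edges => /andP[_ /eqP <-]; apply: subset_leq_card.
by apply/fintype.subsetP => e; rewrite inE => /andP[].
Qed.

Let MN := edges_strict dl0 hM hk nu u_ge.

Lemma edge_count_pr_fourier G z : G \in graphs_with_edges n M -> (z <= N)%N ->
  edge_count_pr G z = N.*2.+1%:R^-1 *
  (1 + 2 * \sum_(j < N) f (frequency R N j) (frequency R N j * (z%:R - mu)) G).
Proof.
move=> GA zN; have [_ /ltnW MN'] := MN.
rewrite /edge_count_pr (@eq_expect _ _ _ _ (fun S => N.*2.+1%:R^-1 * (1 + 2 *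
   \sum_(j < N) cos (frequency R N j * ((induced_edges G S)%:R - z%:R))))); last first.
  by move=> S; apply: fourier_indicator => //; exact: leq_trans (induced_edges_le S GA) MN'.
rewrite expectZ expectD expectZ expect_sum (expect_cst w1).
congr (_ * (1 + 2 * _)); apply: eq_bigr => j _; apply: eq_expect => S.
by rewrite sum_edge_dev//; congr cos; ring.
Qed.

Definition deviates (G : {set {set 'I_n}}) (j z : nat) : bool :=
  let t := frequency R N j in let a := t * (z%:R - mu) in
  tolerance t <= `|f t a G - Ex (f t a)|.

Definition atypical (G : {set {set 'I_n}}) : bool :=
  [exists j : 'I_N, [exists z : 'I_N.+1, deviates G j z]].

Lemma edge_count_pr_typical G z : G \in graphs_with_edges n M -> ~~ atypical G ->
  (z <= N)%N -> nn * `|edge_count_pr G z - centre z| <= u ^- 3.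
Proof.
move=> GA; rewrite negb_exists => /forallP typ zN.
apply: le_trans (sum_tolerance_le N); apply: ler_wpM2l; first exact: ltW.
rewrite edge_count_pr_fourier// /centre -mulrBr opprD addrACA subrr add0r -mulrBr -sumrB.
rewrite 2!normrM ger0_norm ?invr_ge0//; apply: ler_wpM2l; first by rewrite invr_ge0.
rewrite ger0_norm//; apply: ler_wpM2l => //.
apply: le_trans (ler_norm_sum _ _ _) _; apply: ler_sum => j _.
have := typ j; rewrite negb_exists => /forallP/(_ (Ordinal (zN : z < N.+1)%N)) /=.
by rewrite -ltNge => /ltW.
Qed.

Lemma atypical_pr : Ex (fun G => (atypical G)%:R) <=
  N%:R * N.+1%:R * (2 * expR (2 - u / 6)).
Proof.
have bw0 := bernoulli_weight_ge0 p01.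
apply: (@le_trans _ _ (Ex (fun G => \sum_(j < N) \sum_(z < N.+1) (deviates G j z)%:R))).
  apply: ler_expect => // G; case: (boolP (atypical G)) => [|_]; last first.
    by rewrite sumr_ge0// => j _; rewrite sumr_ge0.
  move=> /existsP[j /existsP[z h]].
  rewrite (bigD1 j)//= (bigD1 z)//= h -addrA lerDl addr_ge0 ?sumr_ge0// => i _.
  by rewrite sumr_ge0.
rewrite expect_sum (eq_bigr _ (fun j _ => expect_sum _ _ _ _)).
apply: (@le_trans _ _ (\sum_(j < N) \sum_(z < N.+1) 2 * expR (2 - u / 6))).
  apply: ler_sum => j _; apply: ler_sum => z _.
  by apply: cos_average_tail; exact: frequency_itv.
by rewrite !sumr_const !card_ord -mulrnA -[leLHS]mulr_natr mulnC natrM [leLHS]mulrC.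
Qed.

(** Three factors of at most u^64 are lost, two from the union bound over frequencies and values,
    one from conditioning on M edges; one more [u] covers the constant 2 e^2, which gives the
    exponent 193. *)
Lemma atypical_fraction :
  #|[set G in graphs_with_edges n M | atypical G]%SET|%:R / #|graphs_with_edges n M|%:R
  <= expR (- (u / 8)).
Proof.
have [M0 MN'] := MN.
apply: le_trans (uniform_le_bernoulli R atypical M0 MN') _.
have Nu : N.+1%:R <= u ^+ 64 :> R.
  have /andP[_ h] := edge_count_bounds dl0 hk nu u_ge.
  rewrite -natr1; apply: (@le_trans _ _ (nn ^+ 2)); last by rewrite nu -exprM.
  have n128 : 128 <= nn by rewrite nu; apply: le_trans u128 _; rewrite -[leLHS]expr1 ler_weXn2l.
  by nra.
apply: le_trans (ler_wpM2l _ atypical_pr) _ => //.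
have N1 : N%:R <= u ^+ 64 :> R by apply: le_trans Nu; rewrite ler_nat.
have u64 : 0 <= u ^+ 64 by rewrite exprn_ge0// ltW.
apply: (@le_trans _ _ (u ^+ 64 * (u ^+ 64 * u ^+ 64 * (2 * expR (2 - u / 6))))).
  apply: ler_pM => //.
  by apply: ler_wpM2r => //; apply: ler_pM.
have e2 := expR2_le16 R.
have h : u ^+ 193 <= expR (u / 24) by apply: le_trans u_exp; rewrite ler_weXn2l.
have u192 : 0 <= u ^+ 192 by rewrite exprn_ge0// ltW.
rewrite expRD; have E := expR_ge0 (- (u / 6)).
apply: (@le_trans _ _ (u ^+ 193 * expR (- (u / 6)))).
  have -> : u ^+ 64 * (u ^+ 64 * u ^+ 64 * (2 * (expR 2 * expR (- (u / 6))))) =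
      u ^+ 64 * u ^+ 64 * u ^+ 64 * (2 * expR 2) * expR (- (u / 6)).
    by rewrite !mulrA.
  rewrite -!exprD (exprSr u 192); apply: ler_wpM2r => //; apply: ler_wpM2l => //.
  by have := u128; lra.
apply: le_trans (ler_wpM2r E h) _; rewrite -expRD ler_expR; have := u0; lra.
Qed.

Let A := graphs_with_edges n M.

Let A0 : 0 < #|A|%:R :> R.
Proof. by have [_ /ltnW h] := MN; rewrite /A card_graphs_with_edges ltr0n bin_gt0. Qed.

Lemma edge_count_pr01 G z : 0 <= edge_count_pr G z <= 1.
Proof.
apply/andP; split; first by apply: expect_ge0 => // S; rewrite ler0n.
by apply: (expect_le_cst w0 w1) => S; case: (_ == _).
Qed.

Lemma centre_norm_le1 z : `|centre z| <= 1.
Proof.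
have bw0 := bernoulli_weight_ge0 p01.
have sbw := @sum_bernoulli_weight R _ (@pair_prob R n q).
rewrite /centre normrM ger0_norm ?invr_ge0// mulrC ler_pdivrMr// mul1r.
apply: le_trans (ler_normD _ _) _; rewrite normr1 normrM [`|2|]ger0_norm//.
rewrite -[X in _ <= X%:R]addn1 natrD addrC lerD2r -mul2n natrM; apply: ler_wpM2l => //.
apply: le_trans (ler_norm_sum _ _ _) _; rewrite -[X in _ <= X%:R]card_ord -sumr_const.
apply: ler_sum => j _; apply: (expect_norm_le_cst bw0 sbw) => G.
exact: cos_average_le1.
Qed.

(** Exchange the two averages: for a fixed k-set S, e(S) counts how many of M random pairs fall
    among the K pairs inside S. *)
Lemma average_edge_count_pr z :
  \sum_(G in A) edge_count_pr G z / #|A|%:R = hypergeometric R N 'C(k, 2) M z.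
Proof.
have [_ /ltnW MN'] := MN.
have H (S : {set 'I_n}) : #|S| = k -> \sum_(G in A) ((induced_edges G S == z)%:R : R) / #|A|%:R =
    hypergeometric R N 'C(k, 2) M z.
  move=> Sk; rewrite /hypergeometric; case: leqP => [zM|Mz]; last first.
    rewrite big1// => G GA; rewrite (_ : (_ == z) = false) ?mul0r//.
    by apply/negbTE; rewrite neq_ltn (leq_ltn_trans (induced_edges_le S GA) Mz).
  rewrite -mulr_suml /A card_graphs_with_edges; congr (_ / _).
  rewrite -natr_sum -natrM; congr _%:R.
  pose E := [set e : {set 'I_n} | #|e| == 2%N]%SET.
  pose ES := [set e : {set 'I_n} | (e \subset S) && (#|e| == 2%N)]%SET.
  have sub : ES \subset E by apply/fintype.subsetP => e; rewrite !inE => /andP[].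
  have := card_subsets_by_intersection sub zM.
  rewrite card_pairs cards_draws Sk => <-; rewrite -sum1_card big_mkcond [RHS]big_mkcond.
  apply: eq_bigr => G _; rewrite inE mem_graphs_with_edges -/E.
  case: (boolP (G \subset E)) => //= GE; case: eqP => //= _.
  rewrite (_ : induced_edges G S = #|(G :&: ES)%SET|); first by case: (_ == z).
  apply: eq_card => e; rewrite !inE; case: (boolP (e \in G)) => //= eG.
  by have := fintype.subsetP GE e eG; rewrite inE => ->; rewrite andbT.
rewrite /edge_count_pr -mulr_suml -expect_sum mulrC -expectZ.
rewrite -[RHS](expect_cst w1); apply: eq_bigr => S _; rewrite /subset_weight.
case: (eqVneq #|S| k) => Sk; last by rewrite !mul0r.
by rewrite -(H S Sk) -mulr_suml [#|A|%:R^-1 * _]mulrC.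
Qed.

(** Average over all graphs with M edges: a typical one is within u^(-3)/n of [centre z], an
    atypical one within 2, and the atypical fraction is exponentially small. *)
Lemma centre_hypergeometric z : (z <= N)%N ->
  nn * `|centre z - hypergeometric R N 'C(k, 2) M z| <= 2 * u ^- 3.
Proof.
move=> zN; rewrite -average_edge_count_pr.
have -> : centre z - \sum_(G in A) edge_count_pr G z / #|A|%:R =
    \sum_(G in A) (centre z - edge_count_pr G z) / #|A|%:R.
  have c1 : \sum_(G in A) centre z / #|A|%:R = centre z.
    by rewrite sumr_const -[LHS]mulr_natr divfK ?gt_eqF.
  by rewrite -{1}c1 -sumrB; apply: eq_bigr => G _; rewrite mulrBl.
pose bad (G : {set {set 'I_n}}) : R := (atypical G)%:R.
apply: (@le_trans _ _ (\sum_(G in A) (u ^- 3 + nn * (2 * bad G)) / #|A|%:R)).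
  rewrite -[nn in leLHS]ger0_norm ?(ltW n0)// -normrM mulr_sumr.
  apply: le_trans (ler_norm_sum _ _ _) _; apply: ler_sum => G GA.
  rewrite (mulrA nn (_ - _)) normrM [`|_^-1|]ger0_norm ?invr_ge0//.
  rewrite ler_wpM2r ?invr_ge0// normrM [`|nn|]ger0_norm ?(ltW n0)//.
  rewrite distrC /bad; case: (boolP (atypical G)) => at'; last first.
    by rewrite !mulr0 addr0 edge_count_pr_typical.
  rewrite mulr1; apply: (@le_trans _ _ (nn * 2)); last by rewrite lerDr invr_ge0 exprn_ge0// ltW.
  apply: ler_wpM2l; first exact: ltW.
  apply: le_trans (ler_normB _ _) _; have := centre_norm_le1 z.
  by have /andP[h1 h2] := edge_count_pr01 G z; rewrite (ger0_norm h1); lra.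
rewrite -mulr_suml big_split /= sumr_const -!mulr_sumr mulrDl -[_ *+ _]mulr_natr mulfK ?gt_eqF//.
have -> : \sum_(G in A) bad G = #|[set G in A | atypical G]%SET|%:R.
  rewrite -sum1_card natr_sum big_mkcond [RHS]big_mkcond; apply: eq_bigr => G _.
  by rewrite inE /bad; case: (G \in A); case: (atypical G).
have h := atypical_fraction; rewrite -/A in h.
rewrite -!mulrA mulrA.
have x1 : nn * 2 * (#|[set G in A | atypical G]%SET|%:R / #|A|%:R) <= nn * 2 * expR (- (u / 8)).
  by apply: ler_wpM2l => //; rewrite mulr_ge0// ltW.
have x2 : nn * 2 * expR (- (u / 8)) <= u ^- 3.
  rewrite -[leRHS]mul1r ler_pdivlMr ?exprn_gt0// mulrAC.
  have e : expR (u / 8) * expR (- (u / 8)) = 1 by rewrite -expRD subrr expR0.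
  rewrite -[leRHS]e; apply: ler_wpM2r; first exact: expR_ge0.
  apply: (@le_trans _ _ (expR (u / 24))); last by rewrite ler_expR; have := u0; lra.
  apply: le_trans u_exp; apply: (@le_trans _ _ (u ^+ 36)); last by rewrite ler_weXn2l.
  rewrite nu [leLHS](_ : _ = u ^+ 35 * 2); last by ring.
  by rewrite (exprSr u 35) ler_wpM2l ?exprn_ge0 ?(ltW u0)//; have := u128; lra.
lra.
Qed.

(** Here 4 = 1 + 2 + 1: from the graph to the centre, from the centre to the hypergeometric
    probability, from there to the normal density. *)
Lemma edge_count_pr_normal G z : G \in A -> ~~ atypical G ->
  nn * `|edge_count_pr G z - phi n M k z%:R| <= 4 * u ^- 3.
Proof.
move=> GA typ; have h1 := hypergeometric_local_limit dl0 hM hk nu u_ge u_exp z.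
have i3 : 0 <= u ^- 3 by rewrite invr_ge0 exprn_ge0// ltW.
have i43 : u ^- 4 <= u ^- 3.
  by rewrite lef_pV2 ?posrE ?exprn_gt0// ler_weXn2l.
have [_ MN'] := MN.
(* The inversion formula covers only z <= N; beyond it both probabilities are 0. *)
have [zN|Nz] := leqP z N; last first.
  have Mz : (M < z)%N by exact: ltn_trans MN' Nz.
  have -> : edge_count_pr G z = hypergeometric R N 'C(k, 2) M z.
    rewrite hypergeometric_out// /edge_count_pr (@eq_expect _ _ _ _ (fun=> 0)) ?(expect_cst w1)//.
    move=> S; rewrite (_ : (_ == z) = false)//.
    by apply/negbTE; rewrite neq_ltn (leq_ltn_trans (induced_edges_le S GA) Mz).
  by apply: le_trans h1 _; lra.
have h2 := centre_hypergeometric zN; have h3 := edge_count_pr_typical GA typ zN.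
move: h1 h2 h3; set X := edge_count_pr G z; set B := centre z.
set h := hypergeometric _ _ _ _ _; set P := phi _ _ _ _ => h1 h2 h3.
have tri : `|X - P| <= `|X - B| + `|B - h| + `|h - P|.
  rewrite (_ : X - P = (X - B) + (B - h) + (h - P)); last by ring.
  by apply: le_trans (ler_normD _ _) _; rewrite lerD2r ler_normD.
have := ler_wpM2l (ltW n0) tri; rewrite !mulrDr; lra.
Qed.

Lemma uniform_pr_edge_count G (z : int) :
  uniform_pr R (subsets_of_size n k) (fun S => (induced_edges G S)%:Z = z) =
  if z is Posz z' then edge_count_pr G z' else 0.
Proof.
have cS : #|subsets_of_size n k|%:R = 'C(n, k)%:R :> R.
  by have := card_draws 'I_n k; rewrite card_ord /subsets_of_size => ->.
rewrite /uniform_pr cS; case: z => z; last first.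
  rewrite (_ : [set x in _ | _]%SET = finset.set0) ?cards0 ?mul0r//.
  by apply/setP => S; rewrite !inE; apply/negbTE/negP => /andP[_ /asboolP].
rewrite /edge_count_pr /expect -sum1_card natr_sum mulr_suml [LHS]big_mkcond.
apply: eq_bigr => S _; rewrite !inE /subset_weight.
have -> : `[< (induced_edges G S)%:Z = z%:Z >] = (induced_edges G S == z).
  by apply/asboolP/eqP => [[]|->].
case: (#|S| == k); last by rewrite !mul0r.
by case: (_ == z); rewrite /= ?mulr1 ?mulr0.
Qed.

Lemma uniform_pr_local_limit :
  1 - expR (- (u / 8)) <= uniform_pr R A (fun G => forall z : int,
    nn * `| uniform_pr R (subsets_of_size n k) (fun S => (induced_edges G S)%:Z = z)
            - phi n M k z%:~R | <= 4 * u ^- 3).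
Proof.
have i3 : 0 <= u ^- 3 by rewrite invr_ge0 exprn_ge0// ltW.
have h := atypical_fraction; rewrite -/A in h.
rewrite lerBlDr; apply: le_trans (lerD (lexx _) h).
rewrite /uniform_pr -mulrDl ler_pdivlMr// mul1r -natrD ler_nat.
set P := [set x in A | `[< _ >]]%SET.
apply: leq_trans (leq_card_setU P [set G in A | atypical G]%SET).
apply: subset_leq_card; apply/fintype.subsetP => G GA; rewrite !inE.
have GA' := GA; rewrite /A /graphs_with_edges inE in GA'; rewrite GA' /=.
case: (boolP (atypical G)) => typ; rewrite ?orbT// orbF; apply/asboolP => z.
rewrite -[X in `|X - _|]/(uniform_pr R (subsets_of_size n k)
  (fun S => (induced_edges G S)%:Z = z)).
rewrite uniform_pr_edge_count; case: z => z.
  by have := edge_count_pr_normal z GA typ.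
rewrite sub0r normrN; apply: (@le_trans _ _ (u ^- 4)).
  apply: (phi_negative dl0 hM hk nu u_ge u_exp).
  by rewrite NegzE mulrNz oppr_le0 ler0z.
have i43 : u ^- 4 <= u ^- 3 by rewrite lef_pV2 ?posrE ?exprn_gt0// ler_weXn2l.
by lra.
Qed.

End Concentration.

Local Open Scope classical_set_scope.
Local Open Scope ring_scope.

(** * From powers of u back to powers of n *)

Lemma le_uniform_pr (R : realType) (T : finType) (A : {set T}) (P Q : T -> Prop) :
  (forall x, P x -> Q x) -> uniform_pr R A P <= uniform_pr R A Q.
Proof.
move=> PQ; rewrite /uniform_pr ler_wpM2r ?invr_ge0// ler_nat.
apply: subset_leq_card; apply/fintype.subsetP => x; rewrite !inE.
by case/andP=> -> /asboolP/PQ/asboolP.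
Qed.

Lemma near_root32 (R : realType) (U : R) : 1 <= U ->
  \forall n \near \oo, exists u : R, [/\ U <= u, n%:R = u ^+ 32 &
    n%:R `^ 64^-1 = Num.sqrt u].
Proof.
move=> U1; near=> n.
have U0 : 0 <= U by lra.
have nU : U ^+ 32 <= n%:R by near: n; exact: nbhs_infty_ger.
have u0 := powR_ge0 (n%:R : R) 32^-1.
exists (n%:R `^ 32^-1).
have e : n%:R = (n%:R `^ 32^-1) ^+ 32 :> R.
  by rewrite -powR_mulrn// -powRrM mulVf ?pnatr_eq0// powRr1.
split => //.
- by rewrite -(@ler_pXn2r _ 32)// ?nnegrE// -e.
- by rewrite -powR12_sqrt// -powRrM; congr (_ `^ _); lra.
Unshelve. all: by end_near. Qed.

(** After raising to the 14th power the claim without [eps] is 4^14 u^32 <= u^42, which holds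
    because 16 <= u. *)
Lemma root_error (R : realType) (x u eps : R) : 128 <= u -> x = u ^+ 32 -> 0 < eps ->
  4 * u ^- 3 <= x `^ (- (1 / 14) + eps).
Proof.
move=> u128 xu e0; have u0 : 0 < u by lra.
have u1 : 1 <= u by lra.
have x1 : 1 <= x by rewrite xu exprn_ege1.
have x0 : 0 < x by lra.
apply: (@le_trans _ _ (x `^ (- (1 / 14)))); last by rewrite ler_powR//; lra.
rewrite powRN ler_pdivrMr ?exprn_gt0// mulrC ler_pdivlMr ?powR_gt0//.
rewrite -(@ler_pXn2r _ 14)// ?nnegrE ?mulr_ge0 ?powR_ge0// ?exprn_ge0// ?(ltW u0)//.
rewrite exprMn -[(_ `^ _) ^+ _]powR_mulrn ?powR_ge0// -powRrM.
have -> : 1 / 14 * 14%:R = 1 :> R by lra.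
rewrite powRr1 ?(ltW x0)// xu -exprM (exprD u 10 32).
apply: ler_wpM2r; first by rewrite exprn_ge0// ltW.
apply: (@le_trans _ _ (u ^+ 7)); last by rewrite ler_weXn2l.
by rewrite (exprM 4 2 7) ler_pXn2r// ?nnegrE; lra.
Qed.
Theorem theorem1p2 (R : realType) (delta : R) (M k : nat -> nat) :
  0 < delta ->
  (\forall n \near \oo,
     delta <= (M n)%:R / 'C(n, 2)%:R <= 1 - delta /\
     delta <= (k n)%:R / n%:R <= 1 - delta) ->
  forall eps : R, 0 < eps ->
  with_very_high_probability (fun n : nat =>
    uniform_pr R (graphs_with_edges n (M n)) (fun G =>
      forall z : int,
        n%:R * `| uniform_pr R (subsets_of_size n (k n))
                    (fun S => (induced_edges G S)%:Z = z)
                  - phi n (M n) (k n) z%:~R |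
        <= n%:R `^ (- (1 / 14) + eps))).
Proof.
(* Half of the exponent 1/32, so that n^(1/64) is the square root of [u]; this is at most u/8 once u
   >= 64, which absorbs the constant 8 in the failure probability. *)
move=> dl0 hMk eps eps0; exists 64^-1; first by rewrite invr_gt0.
(* Each summand secures one lower bound on [u]; the last is the threshold of [exprn_le_expR] for c =
   1/24 and j = 300. *)
pose U := 128 + 64 / delta + 32 / delta ^+ 2 + (301%:R / 24^-1) ^+ 301 : R.
have a1 : 0 <= 64 / delta by rewrite divr_ge0// ltW.
have a2 : 0 <= 32 / delta ^+ 2 by rewrite divr_ge0// exprn_ge0// ltW.
have a3 : 0 <= (301%:R / 24^-1) ^+ 301 :> R by rewrite exprn_ge0// divr_ge0.
have [U128 Ud Ud2 Ue] : [/\ 128 <= U, 64 / delta <= U, 32 / delta ^+ 2 <= U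
    & (301%:R / 24^-1) ^+ 301 <= U].
  by rewrite /U; set c := (_ ^+ 301); move: a3; rewrite -/c => a3; split; lra.
have U1 : 1 <= U by apply: le_trans U128; rewrite ler1n.
apply: filterS2 hMk (near_root32 U1) => n [hM hk] [u [Uu nu n64]].
have u128 : 128 <= u := le_trans U128 Uu.
have u0 : 0 < u by apply: lt_le_trans u128.
have u_exp : u ^+ 300 <= expR (u / 24).
  rewrite mulrC; apply: (@exprn_le_expR _ 24^-1 300); rewrite ?invr_gt0 ?(ltW u0)//.
  exact: le_trans Ue Uu.
have u_ge2 : 32 <= delta ^+ 2 * u.
  by rewrite mulrC -ler_pdivrMr ?exprn_gt0//; apply: le_trans Uu.
have H := uniform_pr_local_limit dl0 hM hk nu (le_trans Ud Uu) u_ge2 u_exp.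
apply: le_trans (le_trans _ H) _.
  rewrite lerD2l lerN2 ler_expR lerN2 n64.
  have s0 : 0 <= Num.sqrt u := sqrtr_ge0 _.
  have s2 : Num.sqrt u ^+ 2 = u by rewrite sqr_sqrtr// ltW.
  have s8 : 8 <= Num.sqrt u by rewrite -(@ler_pXn2r _ 2)// ?nnegrE// s2; lra.
  by rewrite -[in leRHS]s2; nra.
apply: le_uniform_pr => G PG z; apply: le_trans (PG z) _.
exact: root_error.
Qed.
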